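(* Given $\epsilon_0>0$, there exist $q(\epsilon_0)\in\mathbb{N}$ and $\epsilon>0$ such that: if $q\ge q(\epsilon_0)$ is a prime power, $X$ is a $2$-dimensional non-partite Ramanujan complex that is a quotient of the Bruhat–Tits building of $PGL_3(\mathbb{F}_q((t)))$, and $\alpha\in C^1(X,\mathbb{F}_2)$ is a locally minimal $1$-cochain with $\|\alpha\|<\frac{1}{4(1+\epsilon_0)}$, then $\|\delta_1(\alpha)\|\ge\epsilon\|\alpha\|$.
   Context: Building and Ramanujan quotients: for $F=\mathbb{F}_q((t))$ with $\mathcal{O}=\mathbb{F}_q[[t]]$, $\pi=t$, $\tilde A_2(F)$ has vertices the homothety classes of $\mathcal{O}$-lattices in $F^3$, with $[L_0],\dots,[L_i]$ an $i$-cell iff representatives satisfy $\pi L_0'\subsetneq L_i'\subsetneq\cdots\subsetneq L_0'$. A quotient is $X=\Gamma\backslash\tilde A_2(F)$, $\Gamma\le G=PGL_3(F)$ cocompact discrete with $\mathrm{dist}(\gamma x,x)>2$ for all vertices $x$, $1\ne\gamma\in\Gamma$. Non-partite means $\Gamma G_0=G$, $G_0=PSL_3(F)\cdot PGL_3(\mathcal{O})$. With vertex colors $\tau([L])=\mathrm{val}\det(\text{basis})\bmod 3$, edge colors $\tau(x,y)=\tau(x)-\tau(y)$, Hecke operators $A_jf(x)=\sum_{\tau(x,y)=j}f(y)$ ($j=1,2$), a non-partite $X$ is Ramanujan if every joint eigenvalue of $(A_1,A_2)$ on functions on $X(0)$ orthogonal to constants lies in the joint spectrum of $(A_1,A_2)$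 on $L^2$ of the building's vertices. Cochains: for $\sigma\in X(i)$, $c(\sigma)$ is the number of $2$-cells containing $\sigma$, $w(\sigma)=c(\sigma)/(\binom{3}{i+1}|X(2)|)$; $C^i(X,\mathbb{F}_2)$ = functions $X(i)\to\mathbb{F}_2$ identified with subsets, $\|\alpha\|=\sum_{\sigma\in\alpha}w(\sigma)$; $\delta_i(\alpha)(\sigma)=\sum_{\tau\subset\sigma,\dim\tau=i}\alpha(\tau)$. For a vertex $v$, the link $X_v=\{\sigma\setminus\{v\}:v\in\sigma\in X\}$ is a graph, and $\alpha\in C^1(X)$ induces $\alpha_v\in C^0(X_v)$, $\alpha_v(u)=\alpha(\{u,v\})$. $\alpha\in C^1(X,\mathbb{F}_2)$ is locally minimal if for every vertex $v$, $\|\alpha_v\|\le\|\alpha_v+\mathbf{1}\|$ in $X_v$ (norm in $X_v$ defined by its own weights; $\mathbf{1}$ the constant function). *)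

(* Defs.v *)
From HB Require Import structures.
From mathcomp Require Import all_boot all_order all_algebra.
From mathcomp Require Import fraction complex.
From mathcomp Require Import all_classical reals ereal esum.

Set Implicit Arguments.
Unset Strict Implicit.
Unset Printing Implicit Defensive.

Import Order.TTheory GRing.Theory Num.Theory.
Local Open Scope ring_scope.

(* A complex on a finite vertex type [V] is a [{set {set V}}]; an i-cell is
   a member with i+1 elements. *)

Section Complexes.
Variable V : finType.
Implicit Types (X : {set {set V}}) (s t : {set V}) (v : V).

Definition cells X (i : nat) : {set {set V}} := [set s in X | #|s| == i.+1].

Definition coface_count (d : nat) X s : nat :=
  #|[set t in cells X d | s \subset t]|.

(* [d] is the dimension of the complex: 2 for a quotient of the building, 1
   for a vertex link; [#|s|] is i+1 for an i-cell [s]. *)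
Definition weight (R : realType) (d : nat) X s : R :=
  (coface_count d X s)%:R / ('C(d.+1, #|s|) * #|cells X d|)%:R.

(* An i-cochain is a function on [{set V}] of which only the values on
   [cells X i] are ever used. *)
Definition cochain : Type := {set V} -> 'F_2.

Definition cnorm (R : realType) (d : nat) X (i : nat) (a : cochain) : R :=
  \sum_(s in cells X i | a s != 0) weight R d X s.

Definition coboundary X (i : nat) (a : cochain) : cochain :=
  fun s => \sum_(t in cells X i | t \subset s) a t.

Definition link X v : {set {set V}} := [set s :\ v | s in [set s in X | v \in s]].

(* On the singleton [set u] this is a [set u; v]. *)
Definition link_cochain (a : cochain) v : cochain := fun s => a (v |: s).

Definition locally_minimal (R : realType) X (a : cochain) : Prop :=
  forall v, [set v] \in X ->
    cnorm R 1 (link X v) 0 (link_cochain a v)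
      <= cnorm R 1 (link X v) 0 (fun s => link_cochain a v s + 1).

End Complexes.

(* K[[t]], coefficient by coefficient. The alias is needed because [nat -> K]
   carries the pointwise product. *)

Definition fps (K : fieldType) : Type := nat -> K.

Section PowerSeries.
Variable K : fieldType.
Implicit Types a b c : fps K.

HB.instance Definition _ := Choice.copy (fps K) (nat -> K).

Definition fps_zero : fps K := fun _ => 0.
Definition fps_one : fps K := fun n => (n == 0%N)%:R.
Definition fps_opp a : fps K := fun n => - a n.
Definition fps_add a b : fps K := fun n => a n + b n.
Definition fps_mul a b : fps K := fun n => \sum_(i < n.+1) a i * b (n - i)%N.

Fact fps_addA : associative fps_add.
Proof. by move=> a b c; apply/funext => n; rewrite /fps_add addrA. Qed.
Fact fps_addC : commutative fps_add.
Proof. by move=> a b; apply/funext => n; rewrite /fps_add addrC. Qed.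
Fact fps_add0 : left_id fps_zero fps_add.
Proof. by move=> a; apply/funext => n; rewrite /fps_add add0r. Qed.
Fact fps_addN : left_inverse fps_zero fps_opp fps_add.
Proof. by move=> a; apply/funext => n; rewrite /fps_add addNr. Qed.

HB.instance Definition _ :=
  GRing.isZmodule.Build (fps K) fps_addA fps_addC fps_add0 fps_addN.

Let tr (n : nat) a : {poly K} := \poly_(i < n.+1) a i.

Let trE n a i : (i <= n)%N -> (tr n a)`_i = a i.
Proof. by move=> le_in; rewrite coef_poly ltnS le_in. Qed.

Let fps_mulE n a b i : (i <= n)%N -> fps_mul a b i = (tr n a * tr n b)`_i.
Proof.
move=> le_in; rewrite coefM; apply: eq_bigr => j _.
by rewrite !trE // (leq_trans _ le_in) ?leq_subr // -ltnS.
Qed.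

Fact fps_mulC : commutative fps_mul.
Proof. by move=> a b; apply/funext => n; rewrite !(@fps_mulE n) // mulrC. Qed.

Fact fps_mulA : associative fps_mul.
Proof.
move=> a b c; apply/funext => n.
transitivity ((tr n a * tr n b * tr n c)`_n).
  rewrite -mulrA coefM; apply: eq_bigr => i _.
  by rewrite (@fps_mulE n) ?leq_subr // trE // -ltnS.
rewrite coefM; apply: eq_bigr => i _.
by rewrite (@fps_mulE n) ?trE ?leq_subr // -ltnS.
Qed.

Fact fps_mul1 : left_id fps_one fps_mul.
Proof.
move=> a; apply/funext => n.
rewrite /fps_mul big_ord_recl /fps_one eqxx mul1r subn0 big1 ?addr0 // => i _.
by rewrite mul0r.
Qed.

Fact fps_mulDl : left_distributive fps_mul fps_add.
Proof.
move=> a b c; apply/funext => n.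
by rewrite /fps_add /fps_mul -big_split; apply: eq_bigr => i _; rewrite mulrDl.
Qed.

Fact fps_one_neq0 : fps_one != 0 :> fps K.
Proof. by apply/eqP => /(congr1 (fun a : fps K => a 0%N)) /eqP; rewrite oner_eq0. Qed.

HB.instance Definition _ :=
  GRing.Zmodule_isComNzRing.Build (fps K)
    fps_mulA fps_mulC fps_mul1 fps_mulDl fps_one_neq0.

Definition fps_unit : pred (fps K) := fun a => `[< exists b : fps K, b * a = 1 >].
Definition fps_inv a : fps K := xget a [set b : fps K | b * a = 1]%classic.

Fact fps_mulV : {in fps_unit, left_inverse 1 fps_inv *%R}.
Proof. by move=> a /asboolP; rewrite /fps_inv; apply: (@xgetPex _ a). Qed.

Fact fps_unitP a b : b * a = 1 -> fps_unit a.
Proof. by move=> ba1; apply/asboolP; exists b. Qed.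

Fact fps_inv_out : {in [predC fps_unit], fps_inv =1 id}.
Proof.
move=> a /asboolP na; rewrite /fps_inv; case: xgetP => // b _ ba1.
by case: na; exists b.
Qed.

HB.instance Definition _ :=
  GRing.ComNzRing_hasMulInverse.Build (fps K) fps_mulV fps_unitP fps_inv_out.

Fact fps_idomain : GRing.integral_domain_axiom (fps K).
Proof.
have lowest a : a != 0 -> {n | a n != 0 & forall i, (i < n)%N -> a i = 0}.
  move=> a0; have ex : exists n, a n != 0.
    apply: contrapT => /forallNP na; move/eqP: a0; apply; apply/funext => n.
    by apply/eqP; apply: contrapT => /negP/na.
  exists (ex_minn ex); case: ex_minnP => // m _ m_min i lt_im.
  by apply/eqP; apply/negPn/negP => /m_min; rewrite leqNgt lt_im.
move=> a b ab0; apply/norP => -[/lowest[m am0 ma] /lowest[n bn0 nb]].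
move/(congr1 (fun c : fps K => c (m + n)%N)): ab0; apply/eqP.
have lt_m : (m < (m + n).+1)%N by rewrite ltnS leq_addr.
change (fps_mul a b (m + n)%N != 0).
rewrite /fps_mul (bigD1 (Ordinal lt_m)) //= addKn big1 ?addr0 ?mulf_neq0 //.
move=> i; rewrite -val_eqE /= neq_ltn => /orP[lt_im | lt_mi].
  by rewrite ma ?mul0r.
rewrite [b _]nb ?mulr0 // ltn_subLR ?ltn_add2r //.
by rewrite -ltnS.
Qed.

HB.instance Definition _ :=
  GRing.ComUnitRing_isIntegral.Build (fps K) fps_idomain.

Definition fps_t : fps K := fun n => (n == 1%N)%:R.

End PowerSeries.

(* K((t)) as the fraction field of K[[t]]. *)
Notation laurent K := {fraction (fps K)}.

Local Open Scope classical_set_scope.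

Section Building.
Variable K : fieldType.
Local Notation O := (fps K).
Local Notation F := (laurent K).
Implicit Types (g h : 'M[F]_3) (L M : set 'cV[F]_3).

Definition unif : F := tofrac (fps_t K).

Definition is_integral : set F := range (@tofrac O).

(* For x = 0 the set is empty and the value is the default 0. *)
Definition laurent_val (x : F) : int :=
  xget 0 [set n : int |
    exists2 u : O, u \is a GRing.unit & x = unif ^ n * tofrac u].

Definition lattice_of g : set 'cV[F]_3 :=
  [set g *m v | v in [set v : 'cV[F]_3 | forall i, is_integral (v i ord0)]].

Definition is_lattice L : Prop := exists2 g, g \in unitmx & L = lattice_of g.

Definition scale_lattice (a : F) L : set 'cV[F]_3 := [set a *: v | v in L].

Definition homothety_class L : set (set 'cV[F]_3) :=
  [set scale_lattice a L | a in [set a | a != 0]].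

Definition is_vertex (c : set (set 'cV[F]_3)) : Prop :=
  exists2 L, is_lattice L & c = homothety_class L.

Definition vertex : Type := {c : set (set 'cV[F]_3) | `[< is_vertex c >]}.
HB.instance Definition _ := Choice.on vertex.

(* x 0, ..., x i are the vertices of an i-cell, in an order for which the
   representatives L 0, ..., L i form the required chain. *)
Definition building_cell (i : nat) (x : 'I_i.+1 -> vertex) : Prop :=
  exists L : 'I_i.+1 -> set 'cV[F]_3,
    [/\ forall k, \val (x k) (L k),
        forall j k : 'I_i.+1, (j < k)%N -> L k `<` L j
      & scale_lattice unif (L ord0) `<` L ord_max].

Definition adjacent : rel vertex := fun x y =>
  `[< exists2 e : 'I_2 -> vertex, building_cell e
        & [set x; y] = range e >].

Definition dist_le (n : nat) (x y : vertex) : Prop :=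
  exists2 p : seq vertex, path adjacent x p /\ last x p = y & (size p <= n)%N.

Definition color (x : vertex) : 'Z_3 :=
  xget 0 [set k : 'Z_3 |
    exists g, [/\ g \in unitmx, \val x (lattice_of g)
                & k = (laurent_val (\det g))%:~R]].

Definition colored_edge (j : 'Z_3) (x y : vertex) : Prop :=
  adjacent x y /\ color x - color y = j.

Definition act_lattice g L : set 'cV[F]_3 := [set g *m v | v in L].

Definition moves_to g (x y : vertex) : Prop :=
  \val y = [set act_lattice g L | L in \val x].

(* A subgroup of PGL_3(F) is represented by its full inverse image in GL_3(F),
   i.e. by a subgroup of GL_3(F) containing all nonzero scalar matrices. *)

Definition GL3 : set 'M[F]_3 := [set g | g \in unitmx].

Definition scalars : set 'M[F]_3 := [set a%:M | a in [set a : F | a != 0]].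

Definition pgl_subgroup (Gam : set 'M[F]_3) : Prop :=
  [/\ Gam `<=` GL3, scalars `<=` Gam,
      forall g h, Gam g -> Gam h -> Gam (g *m h)
    & forall g, Gam g -> Gam (invmx g)].

Definition gl_open (U : set 'M[F]_3) : Prop :=
  U `<=` GL3 /\
  forall g, U g -> exists n : nat, forall h, GL3 h ->
    (forall i j, is_integral ((h - g) i j / unif ^+ n)) -> U h.

(* The open subsets of PGL_3(F) are the open subsets of GL_3(F) that are
   invariant under the scalars; the identity is isolated in the subgroup. *)
Definition pgl_discrete (Gam : set 'M[F]_3) : Prop :=
  exists U : set 'M[F]_3,
    [/\ gl_open U, forall z g, scalars z -> U g -> U (z *m g),
        U 1%:M & U `&` Gam `<=` scalars].

(* Compactness of Gam \ PGL_3(F) in the quotient topology, whose open sets are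
   the Gam-invariant open subsets of GL_3(F). *)
Definition pgl_cocompact (Gam : set 'M[F]_3) : Prop :=
  forall C : set (set 'M[F]_3),
    (forall U, C U -> gl_open U /\ forall g h, Gam g -> U h -> U (g *m h)) ->
    GL3 `<=` \bigcup_(U in C) U ->
    exists2 D : set (set 'M[F]_3), finite_set D /\ D `<=` C
      & GL3 `<=` \bigcup_(U in D) U.

Definition large_displacement (Gam : set 'M[F]_3) : Prop :=
  forall g x y, Gam g -> ~ scalars g -> moves_to g x y -> ~ dist_le 2 y x.

(* The inverse image in GL_3(F) of PSL_3(F) . PGL_3(O). *)
Definition G0 : set 'M[F]_3 :=
  [set g | exists z s (k : 'M[O]_3),
     [/\ scalars z, \det s = 1, k \in unitmx
       & g = z *m s *m map_mx (@tofrac O) k]].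

Definition non_partite (Gam : set 'M[F]_3) : Prop :=
  forall g, GL3 g -> exists c h, [/\ Gam c, G0 h & g = c *m h].

(* [p] identifies the finite type [V] with the set of Gam-orbits of vertices;
   for cocompact Gam this orbit set is finite. *)

Definition is_quotient_map (V : finType) (Gam : set 'M[F]_3) (p : vertex -> V)
    : Prop :=
  (forall u, exists x, p x = u) /\
  (forall x y, p x = p y <-> exists2 g, Gam g & moves_to g x y).

Definition quotient_complex (V : finType) (p : vertex -> V) : {set {set V}} :=
  finset (fun s : {set V} =>
    `[< exists i (x : 'I_i.+1 -> vertex),
          building_cell x /\ s = [set p (x k) | k in 'I_i.+1]%SET >]).

Definition quotient_edge (V : finType) (p : vertex -> V) (j : 'Z_3) (u v : V)
    : Prop :=
  exists x y, [/\ p x = u, p y = v & colored_edge j x y].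

End Building.

Section Hecke.
Variable R : realType.
Local Notation C := (R[i]%type).

(* The operator A_j when [E] is the relation "(x, y) is an edge of color j". *)
Definition hecke (T : choiceType) (E : T -> T -> Prop) (f : T -> C) : T -> C :=
  fun x => \sum_(y \in [set y | E x y]) f y.

Definition l2sq (T : choiceType) (f : T -> C) : \bar R :=
  \esum_(x in [set: T]) (Normc.normc (f x) ^+ 2)%:E.

(* The A_j commute and are normal on L^2, so their joint spectrum consists of
   the joint approximate eigenvalues. *)
Definition joint_spectrum (T : choiceType) (E : 'Z_3 -> T -> T -> Prop)
    (l1 l2 : C) : Prop :=
  forall e : R, 0 < e -> exists f : T -> C,
    [/\ l2sq f = 1%E,
        (l2sq (fun x => (hecke (E 1%R) f x - l1 * f x)%R) < e%:E)%E
      & (l2sq (fun x => (hecke (E 2%:R%R) f x - l2 * f x)%R) < e%:E)%E].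

Definition nonconstant_joint_eigenvalue (T : finType)
    (E : 'Z_3 -> T -> T -> Prop) (l1 l2 : C) : Prop :=
  exists f : T -> C,
    [/\ exists x, f x != 0, \sum_x f x = 0,
        forall x, hecke (E 1) f x = l1 * f x
      & forall x, hecke (E 2%:R) f x = l2 * f x].

Definition is_ramanujan (K : fieldType) (V : finType) (p : vertex K -> V)
    : Prop :=
  forall l1 l2 : C,
    nonconstant_joint_eigenvalue (quotient_edge p) l1 l2 ->
    joint_spectrum (@colored_edge K) l1 l2.

End Hecke.

(* Main.v *)
Require Import Defs.
From HB Require Import structures.
From mathcomp Require Import all_boot all_order all_algebra.
From mathcomp Require Import fraction complex.
From mathcomp Require Import spectral ring lra zify.
From mathcomp Require Import all_classical reals ereal esum.

(** Write [q] for the order of the residue field. A vertex of the building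
    is adjacent to the [q^2+q+1] points and [q^2+q+1] lines of the projective
    plane of [L/tL], and its link is the incidence graph of that plane; large
    displacement makes the quotient map injective on stars, so the same holds
    in the quotient.

    For a 1-cochain [a], counting at each vertex [u] the triangles in which
    exactly one of the two edges at [u] lies in [a] gives
    [|delta a| >= sum_u cross(u) - (q+1)|a|], and the spectral gap of the
    incidence graph bounds [cross(u)] below by
    [(q+1)(x - x^2/(2(q^2+q+1))) - sqrt q x] where [x] is the degree of [a]
    at [u]. Local minimality is [x <= q^2+q+1], so thin vertices, for which
    [x] is smaller by a factor [1-mu], contribute a definite gain. If thin
    vertices carry a small part of [a], almost all of [a] lies inside the set
    of fat vertices, which has relative density less than [1/2] by the bound
    on the norm of [a]; this contradicts the expander mixing lemma for large
    [q].

    The eigenvalue bound needed there is only [o(q^2)], and it is obtained from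
    Schur's test on the building with the weight [sqrt q ^ (3 m - d)], where
    [d] is the valuation of the determinant and [m] the least valuation of a
    first coordinate on the lattice: both Hecke operators multiply this weight
    by [q + (q+1) sqrt q]. The operator [A_1] on the quotient is normal because
    two distinct lattices with a common superlattice of index [q] have only one,
    and then they also have a common sublattice of index [q]. *)

Set Implicit Arguments.
Unset Strict Implicit.
Unset Printing Implicit Defensive.

Import Order.TTheory GRing.Theory Num.Theory.
Local Open Scope ring_scope.

(** * Power series and valuations *)

(** The obstacle is that local information gives nothing in the extreme case. At a vertex of degree
    [x = q^2+q+1], the largest that local minimality allows, the bound on [cross] has main term
    [(q+1)x/2]; as the degrees add up to [2|a|], the sum of these is exactly the subtracted term
    [(q+1)|a|]. A global argument has to exclude that nearly all of [a] sits at such vertices, and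
    1/4 is the constant it needs: every vertex has [2(q^2+q+1)] edges, so the norm bound keeps the
    average degree below [(q^2+q+1)/(2(1+eps0))], and the density of fat vertices below about
    [1/(2(1+eps0))]. By mixing, a fat vertex then sends on average at most about
    [(q^2+q+1)/(1+eps0)] edges to fat vertices, whereas nearly [q^2+q+1] edges of [a] would have to
    go there.

    The Ramanujan condition speaks only of joint eigenvectors of [A_1] and [A_2]. Since [A_2] is the
    transpose of [A_1], normality makes the eigenvectors of [A_1] joint ones, and lets eigenvalues
    control the quadratic form of [A_1]. *)

Section PowerSeriesTheory.
Variable K : fieldType.
Local Notation O := (fps K).
Local Notation F := (laurent K).
Local Notation t := (fps_t K).
Implicit Types (a b c : O).

Definition fps_red (a : O) : K := a 0%N.
Definition fps_const (c : K) : O := fun n => if n == 0%N then c else 0.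

Fact fps_red_additive : zmod_morphism fps_red.
Proof. by []. Qed.
HB.instance Definition _ := GRing.isZmodMorphism.Build O K fps_red fps_red_additive.

Fact fps_red_multiplicative : monoid_morphism fps_red.
Proof. by split=> // a b; rewrite /fps_red /= {1}/GRing.mul /= /fps_mul big_ord1 subnn. Qed.
HB.instance Definition _ := GRing.isMonoidMorphism.Build O K fps_red fps_red_multiplicative.

Fact fps_const_additive : zmod_morphism fps_const.
Proof.
move=> a b; apply/funext => n; rewrite /fps_const.
change ((if n == 0%N then a - b else 0) = (if n == 0%N then a else 0) - (if n == 0%N then b else 0)).
by case: ifP; rewrite ?subr0.
Qed.
HB.instance Definition _ := GRing.isZmodMorphism.Build K O fps_const fps_const_additive.

Fact fps_const_multiplicative : monoid_morphism fps_const.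
Proof.
split; first by apply/funext => n; rewrite /fps_const /GRing.one /= /fps_one; case: ifP.
move=> a b; apply/funext => n.
change (fps_const (a * b) n = fps_mul (fps_const a) (fps_const b) n).
rewrite /fps_mul big_ord_recl subn0 big1 ?addr0; last by move=> i _; rewrite mul0r.
by rewrite /fps_const; case: ifP => //; rewrite mulr0.
Qed.
HB.instance Definition _ := GRing.isMonoidMorphism.Build K O fps_const fps_const_multiplicative.

Lemma fps_constK : cancel fps_const fps_red.
Proof. by []. Qed.

Lemma fps_red_t : fps_red t = 0.
Proof. by []. Qed.

Lemma fps_t_neq0 : t != 0.
Proof. by apply/eqP => /(congr1 (fun a : O => a 1%N)) /eqP; rewrite /fps_t /= oner_eq0. Qed.

Lemma fps_red0_divt a : fps_red a = 0 -> exists b, a = t * b.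
Proof.
move=> a0; exists (fun n => a n.+1); apply/funext => -[|n].
  by change (a 0%N = fps_mul t (fun n => a n.+1) 0%N); rewrite /fps_mul big_ord1 mul0r.
change (a n.+1 = fps_mul t (fun n => a n.+1) n.+1).
rewrite /fps_mul big_ord_recl mul0r add0r big_ord_recl /= mul1r big1 ?addr0 ?subSS ?subn0 //.
by move=> i _; rewrite mul0r.
Qed.

(** The first [n] coefficients of the inverse of [a]. Each depends on all earlier ones, so the
    recursion carries the whole list. *)
Fixpoint fps_inv_seq (a : O) n : seq K :=
  if n is n'.+1 then
    let s := fps_inv_seq a n' in
    rcons s ((a 0%N)^-1 * ((n' == 0%N)%:R - \sum_(i < n') s`_i * a (n' - i)%N))
  else [::].

Lemma size_fps_inv_seq a n : size (fps_inv_seq a n) = n.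
Proof. by elim: n => //= n IH; rewrite size_rcons IH. Qed.

Lemma nth_fps_inv_seq a n i : (i < n)%N -> (fps_inv_seq a n)`_i = (fps_inv_seq a i.+1)`_i.
Proof.
elim: n => // n IH; rewrite ltnS leq_eqVlt => /orP[/eqP-> //|lt_in].
by rewrite [LHS]/= nth_rcons size_fps_inv_seq lt_in IH.
Qed.

Lemma fps_unitE a : (a \is a GRing.unit) = (fps_red a != 0).
Proof.
apply/idP/idP => [ua|a0]; first by rewrite -unitfE; apply: rmorph_unit.
suff [b ba1] : exists b, b * a = 1 by apply/unitrPr; exists b; rewrite mulrC.
exists (fun n => (fps_inv_seq a n.+1)`_n); apply/funext => n.
change (fps_mul (fun n => (fps_inv_seq a n.+1)`_n) a n = (n == 0%N)%:R).
rewrite /fps_mul big_ord_recr /= subnn nth_rcons size_fps_inv_seq ltnn eqxx.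
have -> : \sum_(i < n) (rcons (fps_inv_seq a i)
    ((a 0%N)^-1 * ((nat_of_ord i == 0%N)%:R
       - \sum_(j < i) (fps_inv_seq a i)`_j * a (i - j)%N)))`_i * a (n - i)%N
  = \sum_(i < n) (fps_inv_seq a n)`_i * a (n - i)%N.
  by apply: eq_bigr => i _; rewrite (@nth_fps_inv_seq a n).
by rewrite mulrAC mulVf // mul1r addrC subrK.
Qed.

Lemma fps_factor a : a != 0 -> exists n u, u \is a GRing.unit /\ a = t ^+ n * u.
Proof.
move=> a0; have [n an0] : exists n, a n != 0.
  apply: contrapT => /forallNP na; move/eqP: a0; apply; apply/funext => n.
  by apply/eqP; apply: contrapT => /negP/na.
elim: n a an0 {a0} => [|n IH] a an0.
  by exists 0%N, a; rewrite fps_unitE expr0 mul1r.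
have [a0|] := eqVneq (fps_red a) 0; last first.
  by move=> a0; exists 0%N, a; rewrite fps_unitE expr0 mul1r.
have [b ab] := fps_red0_divt a0.
have bn : b n != 0.
  move: an0; rewrite ab.
  have -> : (t * b) n.+1 = b n; last by [].
  change (fps_mul t b n.+1 = b n).
  rewrite /fps_mul big_ord_recl mul0r add0r big_ord_recl /= mul1r big1 ?addr0 ?subSS ?subn0 //.
  by move=> i _; rewrite mul0r.
have [m [u [uu bu]]] := IH _ bn.
by exists m.+1, u; rewrite ab bu exprS mulrA.
Qed.

Implicit Types (x y z : F) (m n : int).
Local Notation iota := (@tofrac O).
Local Notation pi := (unif K).

Lemma unif_neq0 : pi != 0.
Proof. by rewrite /unif tofrac_eq0 fps_t_neq0. Qed.

(** The valuation as a relation. Unlike [laurent_val], which defaults to 0 at [x = 0], it holds of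
    no [n] there. *)
Definition has_val x n := exists2 u : O, u \is a GRing.unit & x = pi ^ n * iota u.

Lemma has_val_neq0 x n : has_val x n -> x != 0.
Proof.
case=> u uu ->; rewrite mulf_eq0 negb_or (expfz_neq0 _ unif_neq0) tofrac_eq0.
by apply: contraTneq uu => ->; rewrite unitr0.
Qed.

Lemma has_valM x y m n : has_val x m -> has_val y n -> has_val (x * y) (m + n).
Proof.
case=> u uu -> [v vv ->]; exists (u * v); first by rewrite unitrM uu.
by rewrite rmorphM expfzDr ?unif_neq0 // mulrACA.
Qed.


Lemma has_val_iota a : has_val (iota a) 0 <-> a \is a GRing.unit.
Proof.
split=> [[u uu]|ua]; last by exists a; rewrite // expr0z mul1r.
by rewrite expr0z mul1r => /eqP; rewrite tofrac_eq => /eqP->.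
Qed.

(** If the exponents differed, the unit that goes with the smaller one would be a multiple of
    [t]. *)
Lemma has_val_uniq x m n : has_val x m -> has_val x n -> m = n.
Proof.
wlog le_mn : m n / m <= n.
  by move=> W xm xn; case: (leP m n) => [|/ltW] le; [|symmetry]; apply: W.
case=> u uu -> [v vv].
have [k ->] : exists k : nat, n = m + k%:Z.
  by exists `|n - m|%N; rewrite gez0_abs ?subr_ge0 // subrKC.
rewrite expfzDr ?unif_neq0 // -mulrA => /(mulfI (expfz_neq0 _ unif_neq0)).
rewrite -exprnP -rmorphXn -rmorphM => /eqP; rewrite tofrac_eq => /eqP uE.
case: k uE => [|k] uE; first by rewrite addr0.
by move: uu; rewrite fps_unitE uE exprS -mulrA rmorphM /= fps_red_t mul0r eqxx.
Qed.

Lemma laurent_valE x n : has_val x n -> laurent_val x = n.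
Proof.
move=> xn; apply: (@has_val_uniq x) => //; rewrite /laurent_val.
by case: xgetP => [m _ //|/(_ n)]; case.
Qed.

Lemma laurent_frac x : exists a b, b != 0 /\ x = iota a / iota b.
Proof.
elim/quotW: x => r.
have d0 : \d_r != 0 := denom_ratioP r.
exists \n_r, \d_r; split=> //.
apply: (canRL (mulfK _)); first by rewrite tofrac_eq0.
unlock FracField.tofrac; rewrite -[LHS]FracField.pi_mul /FracField.mulf /=.
apply/eqmodP; rewrite /= FracField.equivfE !numden_Ratio ?oner_eq0 ?mulr1 //.
by rewrite mulrC.
Qed.

Lemma has_val_ex x : x != 0 -> exists n, has_val x n.
Proof.
have [a [b [b0 ->]]] := laurent_frac x.
rewrite mulf_eq0 invr_eq0 negb_or !tofrac_eq0 => /andP[/fps_factor[m [u [uu ->]]] _].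
have [n [v [vv ->]]] := fps_factor b0.
exists (m%:Z - n%:Z), (u * v^-1); first by rewrite unitrM unitrV uu.
rewrite !rmorphM rmorphV // !rmorphXn invfM expfzDr ?unif_neq0 //.
by rewrite mulrACA exprnN -exprnP.
Qed.

Lemma has_valV x n : has_val x n -> has_val x^-1 (- n).
Proof.
move=> xn; have x0 := has_val_neq0 xn.
have [m xm] : exists m, has_val x^-1 m by apply: has_val_ex; rewrite invr_eq0.
have := has_valM xn xm; rewrite divff // => h1.
have h0 : has_val 1 0 by exists 1; rewrite ?unitr1 // expr0z rmorph1 mulr1.
suff -> : - n = m by [].
by apply/eqP; rewrite eq_sym -addr_eq0 addrC (has_val_uniq h1 h0).
Qed.

Lemma integralP x : is_integral x <-> exists a, x = iota a.
Proof. by split=> [[a _ <-]|[a ->]]; exists a. Qed.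

Lemma has_val_pi n : has_val (pi ^ n) n.
Proof. by exists 1; rewrite ?unitr1 // rmorph1 mulr1. Qed.

Lemma has_valX x m k : has_val x m -> has_val (x ^+ k) (m *+ k).
Proof.
move=> xm; elim: k => [|k IH]; first exact: (has_val_pi 0).
by rewrite exprS mulrS; apply: has_valM.
Qed.

End PowerSeriesTheory.

(** * Lattices *)

Section Lattices.
Local Open Scope classical_set_scope.
Variable K : finFieldType.
Local Notation O := (fps K).
Local Notation F := (laurent K).
Local Notation iota := (@tofrac O).
Local Notation pi := (unif K).
Local Notation red := (@fps_red K).
Local Notation const := (@fps_const K).
Implicit Types (g h : 'M[F]_3) (k : 'M[O]_3) (w : 'cV[O]_3) (L M : set 'cV[F]_3).

Lemma lattice_ofP g (v : 'cV[F]_3) :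
  lattice_of g v <-> exists w, v = g *m map_mx iota w.
Proof.
split=> [[u ui <-]|[w ->]]; last first.
  by exists (map_mx iota w) => // i; rewrite mxE; exists (w i ord0).
have [f fP] : {f : 'I_3 -> O & forall i, u i ord0 = iota (f i)}.
  by apply: (@choice _ _ (fun i a => u i ord0 = iota a)) => i; apply/integralP.
exists (\col_i f i); congr (_ *m _); apply/matrixP => i j.
by rewrite ord1 fP !mxE.
Qed.

Lemma map_iota_inj m n : injective (@map_mx O F iota m n).
Proof.
move=> A B /matrixP AB; apply/matrixP => i j.
by have := AB i j; rewrite !mxE => /eqP; rewrite tofrac_eq => /eqP.
Qed.

(** The columns of the integral matrix are the coordinates of the columns of [h] in the basis
    [g]. *)
Lemma lattice_of_sub g h :
  lattice_of h `<=` lattice_of g <-> exists k, h = g *m map_mx iota k.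
Proof.
split=> [hg|[k ->]]; last first.
  move=> v /lattice_ofP[w ->]; apply/lattice_ofP.
  by exists (k *m w); rewrite map_mxM mulmxA.
have [f fP] : {f : 'I_3 -> 'cV[O]_3 & forall j, col j h = g *m map_mx iota (f j)}.
  apply: (@choice _ _ (fun j w => col j h = g *m map_mx iota w)) => j.
  apply/lattice_ofP/hg/lattice_ofP; exists (delta_mx j ord0).
  by rewrite map_delta_mx colE.
exists (\matrix_(i, j) f j i ord0); apply/matrixP => i j.
have /matrixP/(_ i ord0) := fP j; rewrite !mxE => ->.
by apply: eq_bigr => l _; rewrite !mxE.
Qed.

Lemma scale_lattice_of (a : F) g : scale_lattice a (lattice_of g) = lattice_of (a *: g).
Proof.
apply/seteqP; split=> v.
  by case=> u /lattice_ofP[w ->] <-; apply/lattice_ofP; exists w; rewrite scalemxAl.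
by case/lattice_ofP=> w ->; exists (g *m map_mx iota w); rewrite ?scalemxAl //; apply/lattice_ofP; exists w.
Qed.

Lemma act_lattice_of h g : act_lattice h (lattice_of g) = lattice_of (h *m g).
Proof.
apply/seteqP; split=> v.
  by case=> u /lattice_ofP[w ->] <-; apply/lattice_ofP; exists w; rewrite mulmxA.
by case/lattice_ofP=> w ->; exists (g *m map_mx iota w); rewrite ?mulmxA //; apply/lattice_ofP; exists w.
Qed.

Lemma has_val_det_unit k : has_val (\det (map_mx iota k)) 0 <-> k \in unitmx.
Proof. by rewrite det_map_mx has_val_iota unitmxE. Qed.

Lemma lattice_of_unit g k : k \in unitmx ->
  lattice_of (g *m map_mx iota k) = lattice_of g.
Proof.
move=> ku; apply/seteqP; split; apply/lattice_of_sub; first by exists k.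
by exists (invmx k); rewrite -mulmxA -map_mxM mulmxV // map_mx1 mulmx1.
Qed.

Lemma det_neq0 g : g \in unitmx -> \det g != 0.
Proof. by rewrite unitmxE unitfE. Qed.

Lemma lattice_of_eq g h : g \in unitmx -> h \in unitmx ->
  lattice_of h = lattice_of g <-> exists2 k, k \in unitmx & h = g *m map_mx iota k.
Proof.
move=> gu hu; split=> [hg|[k ku ->]]; last exact: lattice_of_unit.
have [k hk] : exists k, h = g *m map_mx iota k by apply/lattice_of_sub; rewrite hg.
have [k' gk] : exists k, g = h *m map_mx iota k by apply/lattice_of_sub; rewrite hg.
exists k => //; suff /mulmx1_unit[] : k *m k' = 1%:M by [].
apply: (@map_iota_inj 3 3); rewrite map_mxM map_mx1.
by apply: (can_inj (mulKmx gu)); rewrite mulmxA -hk -gk mulmx1.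
Qed.

Lemma lattice_of_sub_val g h n : g \in unitmx -> h \in unitmx ->
  has_val (\det g) n -> has_val (\det h) n ->
  lattice_of h `<=` lattice_of g -> lattice_of h = lattice_of g.
Proof.
move=> gu hu gn hn /lattice_of_sub[k hk].
apply/(lattice_of_eq gu hu); exists k; last exact: hk.
apply/has_val_det_unit.
have := has_valM (has_valV gn) hn; rewrite addNr hk det_mulmx.
by rewrite (mulKf (det_neq0 gu)).
Qed.

Lemma lattice_of_eq_val g h m n : g \in unitmx -> h \in unitmx ->
  lattice_of h = lattice_of g -> has_val (\det g) m -> has_val (\det h) n -> m = n.
Proof.
move=> gu hu hg gm hn; have [k /has_val_det_unit k0 hE] := (lattice_of_eq gu hu).1 hg.
have := has_valM gm k0; rewrite -det_mulmx -hE addr0 => hm.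
exact: has_val_uniq hm hn.
Qed.

Lemma has_val_detZ (a : F) g m n : has_val a m -> has_val (\det g) n ->
  has_val (\det (a *: g)) (m *+ 3 + n).
Proof. by move=> am gn; rewrite detZ; apply: has_valM => //; apply: has_valX. Qed.

Lemma lattice_ofD g u v : lattice_of g u -> lattice_of g v -> lattice_of g (u + v).
Proof.
move=> /lattice_ofP[w ->] /lattice_ofP[w' ->].
by apply/lattice_ofP; exists (w + w'); rewrite map_mxD mulmxDr.
Qed.

(** The preimage of [W] under reduction modulo [t], in the coordinates [g]. For a subspace [W] it is
    a lattice between [t L] and [L]. Inclusions can be tested on arbitrary sets [W], by means of
    constant lifts. *)
Definition sub_lattice g (W : {set 'cV[K]_3}) : set 'cV[F]_3 :=
  [set g *m map_mx iota w | w in [set w | map_mx red w \in W]].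

Lemma sub_latticeP g W w : g \in unitmx ->
  sub_lattice g W (g *m map_mx iota w) <-> map_mx red w \in W.
Proof.
move=> gu; split=> [[w' w'W /(can_inj (mulKmx gu))/map_iota_inj <-]//|wW].
by exists w.
Qed.

Lemma sub_lattice_subset g (W W' : {set 'cV[K]_3}) : g \in unitmx ->
  (sub_lattice g W `<=` sub_lattice g W') <-> (W \subset W').
Proof.
move=> gu; split=> [WW'|/fintype.subsetP WW'].
  apply/fintype.subsetP => v vW.
  have redc : map_mx red (map_mx const v) = v.
    by apply/matrixP => i j; rewrite !mxE fps_constK.
  have /WW'/(sub_latticeP _ _ gu) : sub_lattice g W (g *m map_mx iota (map_mx const v)).
    by apply/(sub_latticeP _ _ gu); rewrite redc.
  by rewrite redc.
by move=> v [w /= wW <-]; exists w => //=; apply: WW'.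
Qed.

Lemma act_sub_lattice h g W : act_lattice h (sub_lattice g W) = sub_lattice (h *m g) W.
Proof.
apply/seteqP; split=> v.
  by case=> u [w wW <-] <-; exists w; rewrite // mulmxA.
by case=> w wW <-; exists (g *m map_mx iota w); rewrite ?mulmxA //; exists w.
Qed.

Lemma red0_divt w : map_mx red w = 0 -> exists w', w = fps_t K *: w'.
Proof.
move=> w0; have [f fP] : {f : 'I_3 -> O & forall i, w i ord0 = fps_t K * f i}.
  apply: (@choice _ _ (fun i a => w i ord0 = fps_t K * a)) => i; apply: fps_red0_divt.
  by have /matrixP/(_ i ord0) := w0; rewrite !mxE.
by exists (\col_i f i); apply/matrixP => i j; rewrite ord1 fP !mxE.
Qed.

Lemma sub_latticeT g : sub_lattice g [set: 'cV[K]_3]%SET = lattice_of g.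
Proof.
apply/seteqP; split=> v; first by case=> w _ <-; apply/lattice_ofP; exists w.
by case/lattice_ofP=> w ->; exists w => //=; rewrite inE.
Qed.

Lemma sub_lattice0 g : sub_lattice g [set 0 : 'cV[K]_3]%SET = scale_lattice pi (lattice_of g).
Proof.
rewrite scale_lattice_of; apply/seteqP; split=> v.
  case=> w /=; rewrite inE => /eqP/red0_divt[w' ->] <-; apply/lattice_ofP; exists w'.
  by rewrite map_mxZ -scalemxAr scalemxAl.
case/lattice_ofP=> w ->; exists (fps_t K *: w) => /=.
  by rewrite inE map_mxZ /= fps_red_t scale0r.
by rewrite map_mxZ -scalemxAr scalemxAl.
Qed.

(* The span of the first d columns of B. *)
Definition flag_space (B : 'M[K]_3) (d : nat) : {set 'cV[K]_3} :=
  [set w | [forall i : 'I_3, (d <= i)%N ==> ((invmx B *m w) i ord0 == 0)]]%SET.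

(** With [B] lifted by constants, multiplying its columns from index [d] on by [t] gives a basis of
    the preimage of the span of the first [d] columns. *)
Definition flag_diag (d : nat) : 'M[O]_3 :=
  diag_mx (\row_(i < 3) if (i < d)%N then 1 else fps_t K).

Definition flag_mx g B d := g *m map_mx iota (map_mx const B *m flag_diag d).

Lemma sub_lattice_flag g B d : B \in unitmx ->
  sub_lattice g (flag_space B d) = lattice_of (flag_mx g B d).
Proof.
move=> Bu.
have cBV : map_mx const B *m map_mx const (invmx B) = 1%:M.
  by rewrite -map_mxM mulmxV // map_mx1.
have redc m n (A : 'M[K]_(m, n)) : map_mx red (map_mx const A) = A.
  by apply/matrixP => i j; rewrite !mxE fps_constK.
apply/seteqP; split=> v.
  case=> w /=; rewrite inE => /forallP wB <-; apply/lattice_ofP.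
  pose w' := map_mx const (invmx B) *m w.
  have [f fP] : {f : 'I_3 -> O &
      forall i, w' i ord0 = (if (i < d)%N then 1 else fps_t K) * f i}.
    apply: (@choice _ _ (fun i a => w' i ord0 = (if (i < d)%N then 1 else fps_t K) * a)) => i.
    case: ltnP => [_|di]; first by exists (w' i ord0); rewrite mul1r.
    apply: fps_red0_divt; have /implyP/(_ di)/eqP := wB i.
    have -> : invmx B *m map_mx red w = map_mx red w' by rewrite map_mxM redc.
    by rewrite mxE.
  exists (\col_i f i); rewrite /flag_mx -mulmxA -map_mxM; congr (_ *m map_mx _ _).
  rewrite -[w]mul1mx -cBV -!mulmxA; congr (_ *m _).
  by apply/matrixP => i j; rewrite -/w' ord1 fP mul_diag_mx !mxE.
case/lattice_ofP=> w ->; exists (map_mx const B *m flag_diag d *m w); last first.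
  by rewrite [in LHS]map_mxM mulmxA.
rewrite /= inE; apply/forallP => i; apply/implyP => di.
rewrite -mulmxA map_mxM redc mulKmx // mxE mul_diag_mx !mxE ltnNge di /=.
by rewrite rmorphM /= fps_red_t mul0r.
Qed.

Lemma flag_mx_unit g B d : g \in unitmx -> B \in unitmx -> flag_mx g B d \in unitmx.
Proof.
move=> gu Bu; rewrite /flag_mx unitmx_mul gu /= unitmxE unitfE det_map_mx tofrac_eq0.
rewrite det_mulmx det_diag mulf_neq0 //.
  by rewrite det_map_mx fmorph_eq0 -unitfE -unitmxE.
apply/prodf_neq0 => i _; rewrite mxE; case: ifP => _; [exact: oner_neq0|exact: fps_t_neq0].
Qed.

Lemma has_val_flag_mx g B d n : (d <= 3)%N -> g \in unitmx -> B \in unitmx ->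
  has_val (\det g) n -> has_val (\det (flag_mx g B d)) (n + (3 - d)%N%:Z).
Proof.
move=> d3 gu Bu gn; rewrite /flag_mx det_mulmx; apply: has_valM => //.
exists (\det (map_mx const B)).
  by rewrite fps_unitE det_map_mx /= fps_constK -unitfE -unitmxE.
rewrite det_map_mx det_mulmx det_diag rmorphM mulrC; congr (_ * _).
rewrite -exprnP -rmorphXn; congr (iota _).
by case: d d3 => [|[|[|[|]]]] // _; rewrite !big_ord_recl big_ord0 !mxE /= ?mul1r ?mulr1 // !exprS expr0 ?mulr1.
Qed.

Lemma flag_space0 B : B \in unitmx -> flag_space B 0 = [set 0]%SET.
Proof.
move=> Bu; apply/setP => w; rewrite !inE; apply/forallP/eqP => [wB|-> i]; last first.
  by rewrite mulmx0 mxE eqxx implybT.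
rewrite -[w](mulKVmx Bu); suff -> : invmx B *m w = 0 by rewrite mulmx0.
by apply/matrixP => i j; rewrite ord1 [RHS]mxE; apply/eqP/(implyP (wB i)).
Qed.

Lemma flag_space3 B d : (3 <= d)%N -> flag_space B d = [set: _]%SET.
Proof.
move=> d3; apply/setP => w; rewrite !inE; apply/forallP => i; apply/implyP => di.
by have := leq_trans d3 di; rewrite leqNgt ltn_ord.
Qed.

(** The subspace is the image of the transition matrix modulo [t]; the rank factorisation of that
    matrix supplies the basis [B] adapted to it. *)
Lemma sub_lattice_between g h : g \in unitmx ->
  scale_lattice pi (lattice_of g) `<` lattice_of h -> lattice_of h `<` lattice_of g ->
  exists B d, [/\ B \in unitmx, (0 < d < 3)%N & lattice_of h = sub_lattice g (flag_space B d)].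
Proof.
move=> gu [pgh hpg] [/lattice_of_sub[k hk] gh].
pose U := map_mx red k; pose B := col_ebase U; pose d := \rank U.
have Bu : B \in unitmx := col_ebase_unit U.
have hE : lattice_of h = sub_lattice g (flag_space B d).
  have UE : B *m pid_mx d *m row_ebase U = U := mulmx_ebase U.
  apply/seteqP; split=> v.
    case/lattice_ofP=> w ->; rewrite hk -mulmxA -map_mxM; apply/(sub_latticeP _ _ gu).
    rewrite inE; apply/forallP => i; apply/implyP => di.
    rewrite map_mxM -/U -UE -!mulmxA mulKmx // mxE big1 // => j _.
    by rewrite mxE ltnNge di andbF mul0r.
  case=> w /=; rewrite inE => /forallP wB <-.
  pose y := invmx (row_ebase U) *m (invmx B *m map_mx red w).
  have Uy : U *m y = map_mx red w.
    rewrite -UE /y -!mulmxA mulKVmx ?row_ebase_unit //.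
    rewrite -[RHS](mulKVmx Bu); congr (_ *m _); apply/matrixP => i j; rewrite ord1.
    rewrite mxE (bigD1 i) //= big1 => [|l li]; last first.
      by rewrite mxE eq_sym (inj_eq val_inj) (negPf li) mul0r.
    rewrite addr0 mxE eqxx /=; case: ltnP => [_|di]; first by rewrite mul1r.
    by rewrite mul0r (eqP (implyP (wB i) di)).
  (* [k] times the constant lift of [y] has the same reduction as [w], so the difference is
     divisible by [t]; that part lies in [t L], which [lattice_of h] contains. *)
  have [|w' wE] := @red0_divt (w - k *m map_mx const y).
    rewrite map_mxB map_mxM -/U.
    have -> : map_mx red (map_mx const y) = y by apply/matrixP => i j; rewrite !mxE fps_constK.
    by rewrite Uy subrr.
  have -> : g *m map_mx iota w = h *m map_mx iota (map_mx const y) + pi *: (g *m map_mx iota w').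
    rewrite hk -mulmxA -map_mxM scalemxAr -mulmxDr -[pi *: _]map_mxZ -map_mxD.
    by rewrite -wE addrC subrK.
  apply: lattice_ofD; first by apply/lattice_ofP; exists (map_mx const y).
  by apply: pgh; exists (g *m map_mx iota w') => //; apply/lattice_ofP; exists w'.
exists B, d; split=> //; apply/andP; split.
  rewrite lt0n; apply: contra_notN hpg => /eqP d0.
  by rewrite hE d0 flag_space0 // sub_lattice0.
by rewrite ltnNge; apply: contra_notN gh => d3; rewrite hE flag_space3 // sub_latticeT.
Qed.

End Lattices.

(** * The projective plane over the residue field *)

Section Plane.
Variable K : finFieldType.
Local Notation q := #|K|.
Implicit Types (v w : 'cV[K]_3) (l : 'rV[K]_3) (W : {set 'cV[K]_3}).

(** Subspaces are kept as sets of vectors, so that inclusion and counting are those of finite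
    sets. *)
Definition subspaces (d : nat) : {set {set 'cV[K]_3}} :=
  [set flag_space B d | B : 'M[K]_3 in unitmx].

Definition span1 v : {set 'cV[K]_3} := [set c *: v | c : K].
Definition ker1 l : {set 'cV[K]_3} := [set w | l *m w == 0].

Lemma span1P v w : reflect (exists c, w = c *: v) (w \in span1 v).
Proof. by apply: (iffP imsetP) => [[c _ ->]|[c ->]]; exists c. Qed.

Lemma subspaces1P W : reflect (exists2 v, v != 0 & W = span1 v) (W \in subspaces 1).
Proof.
have flagE (B : 'M[K]_3) (a : K) : B \in unitmx -> a != 0 ->
    flag_space B 1 = span1 (B *m (a *: delta_mx ord0 ord0)).
  move=> Bu a0; apply/setP => w; rewrite inE; apply/forallP/span1P => [wB|[c ->] i].
    exists (a^-1 * (invmx B *m w) ord0 ord0).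
    rewrite -{1}[w](mulKVmx Bu) scalemxAr scalerA mulrAC mulVf // mul1r.
    congr (_ *m _); apply/matrixP => i j; rewrite !ord1 [in RHS]mxE [delta_mx _ _ _ _]mxE eqxx andbT.
    have [->|i0] := eqVneq i ord0; first by rewrite mulr1.
    by rewrite mulr0; apply/eqP/(implyP (wB i)); rewrite lt0n.
  apply/implyP => i0; rewrite -scalemxAr mulKmx // !mxE andbT.
  by rewrite -val_eqE /= gtn_eqF // !mulr0.
apply: (iffP imsetP) => [[B Bu ->]|[v v0 ->]].
  exists (B *m (1 *: delta_mx ord0 ord0)); last by apply: flagE; rewrite ?oner_eq0.
  rewrite scale1r; apply: contraTneq (oner_neq0 K) => B0.
  have := congr1 (mulmx (invmx B)) B0; rewrite mulKmx // mulmx0 => /matrixP/(_ ord0 ord0).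
  by rewrite !mxE !eqxx /= => /eqP->.
have rk1 : \rank v = 1%N.
  by apply/eqP; rewrite eqn_leq rank_leq_col lt0n mxrank_eq0.
pose B := col_ebase v; exists B; first exact: col_ebase_unit.
set r := row_ebase v ord0 ord0.
have r0 : r != 0.
  by have := row_ebase_unit v; rewrite unitmxE det_mx11 unitfE.
rewrite (flagE _ r) //; last exact: col_ebase_unit.
rewrite -{1}[v]mulmx_ebase -mulmxA; congr (span1 (_ *m _)).
apply/matrixP => i j; rewrite !ord1 rk1 mxE big_ord1 !mxE !andbT mulrC -val_eqE /=.
by case: (nat_of_ord i) (ltn_ord i).
Qed.

Lemma subspaces2P W : reflect (exists2 l, l != 0 & W = ker1 l) (W \in subspaces 2).
Proof.
have flagE (B : 'M[K]_3) (a : K) : B \in unitmx -> a != 0 ->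
    flag_space B 2 = ker1 (a *: row ord_max (invmx B)).
  move=> Bu a0; apply/setP => w; rewrite !inE -scalemxAl scalemx_eq0 (negPf a0) /=.
  rewrite -row_mul; apply/forallP/eqP => [wB|/matrixP wB i].
    by apply/matrixP => i j; rewrite !ord1 [LHS]mxE [RHS]mxE; apply/eqP/(implyP (wB ord_max)).
  apply/implyP => i2; have -> : i = ord_max by apply/val_inj/anti_leq; rewrite i2 -ltnS ltn_ord.
  by have := wB ord0 ord0; rewrite mxE [X in _ = X]mxE => ->.
apply: (iffP imsetP) => [[B Bu ->]|[l l0 ->]].
  exists (1 *: row ord_max (invmx B)); last by apply: flagE; rewrite ?oner_eq0.
  rewrite scale1r; apply: contraTneq (oner_neq0 K) => B0.
  have := congr1 (mulmx ^~ B) B0; rewrite -row_mul mulVmx // mul0mx => /matrixP/(_ ord0 ord_max).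
  by rewrite !mxE eqxx /= => /eqP->.
have rk1 : \rank l = 1%N.
  by apply/eqP; rewrite eqn_leq rank_leq_row lt0n mxrank_eq0.
(* The rank factorisation makes [l] a multiple of the first row of [row_ebase l], whereas
   [flag_space _ 2] is cut out by the last coordinate; hence the swap of the two rows. *)
pose B := invmx (xrow ord0 ord_max (row_ebase l)).
have Bu : B \in unitmx.
  by rewrite unitmx_inv xrowE unitmx_mul unitmx_perm row_ebase_unit.
exists B => //.
set r := col_ebase l ord0 ord0.
have r0 : r != 0.
  by have := col_ebase_unit l; rewrite unitmxE det_mx11 unitfE.
rewrite (flagE _ r) // /B invmxK.
congr ker1; rewrite -{1}[l]mulmx_ebase -mulmxA; apply/matrixP => i j.
rewrite ord1 mxE big_ord1 !mxE -/r rk1; congr (_ * _).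
rewrite (bigD1 ord0) //= big1 ?addr0 => [|k k0]; last first.
  rewrite [pid_mx _ _ _]mxE; case: eqP => [k0'|_]; last by rewrite mul0r.
  by case/eqP: k0; apply/val_inj.
by rewrite mxE mul1r perm.tpermR.
Qed.

(** The nonzero scalars act freely on [D], and the fibres of [f] are their orbits, of [q - 1]
    elements each. *)
Lemma card_scaling_classes (E : finType) (m n : nat) (f : 'M[K]_(m, n) -> E) (D : {set 'M[K]_(m, n)}) :
  (forall v : 'M_(m, n), v \in D -> v != 0) ->
  (forall (c : K) (v : 'M_(m, n)), c != 0 -> v \in D -> c *: v \in D) ->
  (forall v w : 'M_(m, n), v \in D -> w \in D -> (f v == f w) = [exists c, w == c *: v]) ->
  (#|f @: D| * q.-1 = #|D|)%N.
Proof.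
move=> D0 DZ fE; rewrite -[RHS]sum1_card (partition_big_imset f) /= -sum_nat_const.
apply: eq_bigr => y /imsetP[v vD ->]; rewrite sum1dep_card.
have -> : [set w in D | f w == f v] = [set c *: v | c in predC1 (0 : K)].
  apply/setP => w; rewrite inE; apply/andP/imsetP => [[wD fwv]|[c c0 ->]].
    have /existsP[c /eqP wc] : [exists c, w == c *: v] by rewrite -fE // eq_sym.
    by exists c; rewrite // inE; apply: contraNneq (D0 w wD) => c0; rewrite wc c0 scale0r.
  split; first by apply: DZ.
  by rewrite eq_sym fE ?DZ //; apply/existsP; exists c.
rewrite card_imset ?cardC1 // => c c' /eqP; rewrite -subr_eq0 -scalerBl scaler_eq0.
by rewrite (negPf (D0 v vD)) orbF subr_eq0 => /eqP.
Qed.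

Lemma span1_eq v w : v != 0 -> w != 0 -> (span1 v == span1 w) = [exists c, w == c *: v].
Proof.
move=> v0 w0; apply/eqP/existsP => [vw|[c /eqP wc]].
  have /span1P[c wc] : w \in span1 v by rewrite vw; apply/span1P; exists 1; rewrite scale1r.
  by exists c; rewrite wc.
have c0 : c != 0 by apply: contraNneq w0 => c0; rewrite wc c0 scale0r.
apply/setP => u; apply/span1P/span1P => -[d ->].
  by exists (d / c); rewrite wc scalerA divfK.
by exists (d * c); rewrite wc scalerA.
Qed.

Lemma cV_neq0P m (l : 'rV[K]_m) : l != 0 -> exists v : 'cV[K]_m, l *m v = 1.
Proof.
move=> /rV0Pn[i li]; exists ((l ord0 i)^-1 *: delta_mx i ord0).
rewrite -scalemxAr -colE; apply/matrixP => a b; rewrite !ord1 !mxE eqxx mulVf //.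
Qed.

(** The [q] fibres of [w -> l w] partition [K^3] into translates of the kernel. *)
Lemma card_ker1 l : l != 0 -> #|ker1 l| = (q ^ 2)%N.
Proof.
move=> /cV_neq0P[v lv].
have q_gt0 : (0 < q)%N by apply/card_gt0P; exists 0.
apply/eqP; rewrite -(eqn_pmul2l q_gt0) -expnS; apply/eqP.
rewrite -[3%N]/((3 * 1)%N) -card_mx -[RHS]sum1_card.
rewrite [RHS](partition_big (fun w : 'cV[K]_3 => (l *m w) ord0 ord0) predT) //=.
rewrite -sum_nat_const; apply: eq_bigr => c _; rewrite sum1dep_card.
rewrite -(card_imset _ (addrI (c *: v))); apply: eq_card => w; rewrite !inE.
apply/imsetP/eqP => [[u]|lw].
  by rewrite inE => /eqP lu ->; rewrite mulmxDr lu addr0 -scalemxAr lv !mxE mulr1.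
exists (w - c *: v); last by rewrite addrC subrK.
rewrite inE mulmxBr -scalemxAr lv; apply/eqP/matrixP => i j; rewrite !ord1 !mxE eqxx mulr1.
by rewrite -lw mxE subrr.
Qed.

Lemma card_coker1 v : v != 0 -> #|[set l : 'rV[K]_3 | l *m v == 0]| = (q ^ 2)%N.
Proof.
move=> v0; rewrite -(@card_ker1 v^T) ?trmx_eq0 // -(card_imset _ (can_inj (@trmxK K 1 3))).
apply: eq_card => w; rewrite !inE; apply/imsetP/eqP => [[l]|vw].
  by rewrite inE => /eqP lv ->; rewrite -trmx_mul lv trmx0.
by exists w^T; rewrite ?trmxK // inE -[v]trmxK -trmx_mul vw trmx0.
Qed.

Lemma ker1_eq l l' : l != 0 -> l' != 0 -> (ker1 l == ker1 l') = [exists c, l' == c *: l].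
Proof.
move=> l0 l'0; apply/eqP/existsP => [ll'|[c /eqP l'c]].
  have [v lv] := cV_neq0P l0.
  exists ((l' *m v) ord0 ord0); apply/eqP/matrixP => i j; rewrite !ord1.
  have : delta_mx j ord0 - l ord0 j *: v \in ker1 l'.
    rewrite -ll' inE mulmxBr -colE -scalemxAr lv; apply/eqP/matrixP => a b.
    by rewrite !ord1 !mxE eqxx mulr1 subrr.
  rewrite inE mulmxBr -colE -scalemxAr subr_eq0 => /eqP/matrixP/(_ ord0 ord0).
  by rewrite !mxE mulrC.
have c0 : c != 0 by apply: contraNneq l'0 => c0; rewrite l'c c0 scale0r.
by apply/setP => w; rewrite !inE l'c -scalemxAl scalemx_eq0 (negPf c0).
Qed.

Let q1 : (0 < q.-1)%N.
Proof. by rewrite -subn1 subn_gt0; apply: card_finNzRing_gt1. Qed.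

Let qq : q = q.-1.+1.
Proof. by rewrite prednK // (leq_trans q1) // leq_pred. Qed.

Let card_nz (m n : nat) : #|[set~ 0 : 'M[K]_(m, n)]| = (q ^ (m * n)).-1.
Proof. by rewrite cardsC1 card_mx. Qed.

Let plane_count : ((q ^ 2 + q + 1) * q.-1 = (q ^ 3).-1)%N.
Proof.
rewrite [in LHS]qq [in RHS]qq; move: q.-1 => x; apply: succn_inj; rewrite prednK ?expn_gt0 //.
by rewrite !expnS expn0; nia.
Qed.

Let line_count : ((q + 1) * q.-1 = (q ^ 2).-1)%N.
Proof.
rewrite [in LHS]qq [in RHS]qq; move: q.-1 => x; apply: succn_inj; rewrite prednK ?expn_gt0 //.
by rewrite !expnS expn0; nia.
Qed.

Lemma card_subspaces1 : #|subspaces 1| = (q ^ 2 + q + 1)%N.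
Proof.
apply/eqP; rewrite -(eqn_pmul2r q1) plane_count -[3%N]/((3 * 1)%N) -card_nz; apply/eqP.
rewrite -(@card_scaling_classes _ 3 1 span1 [set~ 0]) //=.
- congr (_ * _)%N; apply: eq_card => W; apply/subspaces1P/imsetP.
    by case=> v v0 ->; exists v; rewrite // !inE.
  by case=> v; rewrite !inE => v0 ->; exists v.
- by move=> v; rewrite !inE.
- by move=> c v c0; rewrite !inE scalemx_eq0 (negPf c0).
- by move=> v w; rewrite !inE; apply: span1_eq.
Qed.

Lemma card_subspaces2 : #|subspaces 2| = (q ^ 2 + q + 1)%N.
Proof.
apply/eqP; rewrite -(eqn_pmul2r q1) plane_count -[3%N]/((1 * 3)%N) -card_nz; apply/eqP.
rewrite -(@card_scaling_classes _ 1 3 ker1 [set~ 0]) //=.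
- congr (_ * _)%N; apply: eq_card => W; apply/subspaces2P/imsetP.
    by case=> v v0 ->; exists v; rewrite // !inE.
  by case=> v; rewrite !inE => v0 ->; exists v.
- by move=> v; rewrite !inE.
- by move=> c v c0; rewrite !inE scalemx_eq0 (negPf c0).
- by move=> v w; rewrite !inE; apply: ker1_eq.
Qed.

Lemma span1_sub v l : (span1 v \subset ker1 l) = (l *m v == 0).
Proof.
apply/fintype.subsetP/idP => [/(_ v)|/eqP lv w /span1P[c ->]]; last first.
  by rewrite inE -scalemxAr lv scaler0.
by rewrite inE => -> //; apply/span1P; exists 1; rewrite scale1r.
Qed.

Lemma card_subspaces1_in W : W \in subspaces 2 ->
  #|[set U in subspaces 1 | U \subset W]| = (q + 1)%N.
Proof.
case/subspaces2P=> l l0 ->; apply/eqP; rewrite -(eqn_pmul2r q1) line_count -(card_ker1 l0).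
rewrite (cardsD1 0 (ker1 l)) inE mulmx0 eqxx /=; apply/eqP.
rewrite -(@card_scaling_classes _ 3 1 span1 (ker1 l :\ 0)) //=.
- congr (_ * _)%N; apply: eq_card => W1; rewrite inE; apply/andP/imsetP.
    by case=> /subspaces1P[v v0 ->]; rewrite span1_sub => lv; exists v; rewrite // !inE v0.
  case=> v; rewrite !inE => /andP[v0 lv] ->; split; last by rewrite span1_sub.
  by apply/subspaces1P; exists v.
- by move=> v; rewrite !inE => /andP[].
- by move=> c v c0; rewrite !inE scalemx_eq0 (negPf c0) -scalemxAr scalemx_eq0 (negPf c0).
- by move=> v w; rewrite !inE => /andP[v0 _] /andP[w0 _]; apply: span1_eq.
Qed.

Lemma card_subspaces2_over W : W \in subspaces 1 ->
  #|[set U in subspaces 2 | W \subset U]| = (q + 1)%N.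
Proof.
case/subspaces1P=> v v0 ->; apply/eqP; rewrite -(eqn_pmul2r q1) line_count -(card_coker1 v0).
rewrite (cardsD1 0 [set l : 'rV[K]_3 | _]) inE mul0mx eqxx /=; apply/eqP.
rewrite -(@card_scaling_classes _ 1 3 ker1 ([set l : 'rV[K]_3 | l *m v == 0] :\ 0)) //=.
- congr (_ * _)%N; apply: eq_card => W1; rewrite inE; apply/andP/imsetP.
    by case=> /subspaces2P[l l0 ->]; rewrite span1_sub => lv; exists l; rewrite // !inE l0.
  case=> l; rewrite !inE => /andP[l0 lv] ->; split; last by rewrite span1_sub.
  by apply/subspaces2P; exists l.
- by move=> l; rewrite !inE => /andP[].
- by move=> c l c0; rewrite !inE scalemx_eq0 (negPf c0) -scalemxAl scalemx_eq0 (negPf c0).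
- by move=> v1 w; rewrite !inE => /andP[v10 _] /andP[w0 _]; apply: ker1_eq.
Qed.

Lemma subspaces1_disjoint W W' w : W \in subspaces 1 -> W' \in subspaces 1 ->
  w \in W -> w \in W' -> w != 0 -> W = W'.
Proof.
case/subspaces1P=> v v0 -> /subspaces1P[v' v'0 ->] wv wv' w0.
have aux u : u != 0 -> w \in span1 u -> span1 u = span1 w.
  move=> u0 wu; have [c wc] := span1P _ _ wu; apply/eqP; rewrite span1_eq //.
  by apply/existsP; exists c; rewrite wc.
by rewrite (aux v) // (aux v').
Qed.

(** Independent generators [v], [v'] have [q^2] distinct linear combinations, so these already
    exhaust any plane that contains both. *)
Lemma subspaces2_join W W' U U' : W \in subspaces 1 -> W' \in subspaces 1 -> W != W' ->
  U \in subspaces 2 -> U' \in subspaces 2 -> W \subset U -> W' \subset U ->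
  W \subset U' -> W' \subset U' -> U = U'.
Proof.
case/subspaces1P=> v v0 -> /subspaces1P[v' v'0 ->] vv'.
pose P := [set x.1 *: v + x.2 *: v' | x : K * K].
have inP l : l != 0 -> span1 v \subset ker1 l -> span1 v' \subset ker1 l -> ker1 l = P.
  move=> l0; rewrite !span1_sub => /eqP lv /eqP lv'; apply/esym/eqP; rewrite eqEcard.
  apply/andP; split.
    apply/fintype.subsetP => _ /imsetP[x _ ->].
    by rewrite inE mulmxDr -!scalemxAr lv lv' !scaler0 addr0.
  rewrite card_ker1 // card_imset ?card_prod ?mulnn // => -[a b] [c d] /= /eqP.
  rewrite -subr_eq0 opprD addrACA -!scalerBl => /eqP E.
  have bd : b - d = 0.
    apply: contraNeq vv' => bd; rewrite span1_eq //; apply/existsP.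
    exists (- ((b - d)^-1 * (a - c))); apply/eqP.
    move/eqP: E; rewrite addrC addr_eq0 => /eqP E.
    by rewrite scaleNr -scalerA -scalerN -E scalerA mulVf // scale1r.
  move: E; rewrite bd scale0r addr0 => /eqP; rewrite scalemx_eq0 (negPf v0) orbF subr_eq0.
  by move/eqP: bd; rewrite subr_eq0 => /eqP-> /eqP->.
by move=> /subspaces2P[l l0 ->] /subspaces2P[l' l'0 ->] *; rewrite (inP l) // (inP l').
Qed.

(** Two functionals stacked form a 2 by 3 matrix, which has a nonzero kernel vector. *)
Lemma subspaces2_meet U U' : U \in subspaces 2 -> U' \in subspaces 2 ->
  exists2 W, W \in subspaces 1 & (W \subset U) && (W \subset U').
Proof.
case/subspaces2P=> l l0 -> /subspaces2P[l' l'0 ->].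
have [v v0 /eqP] : exists2 v : 'cV[K]_3, v != 0 & col_mx l l' *m v = 0.
  have : kermx (col_mx l l')^T != 0.
    by rewrite kermx_eq0 /row_free ltn_eqF // ltnS rank_leq_col.
  case/rowV0Pn=> u /sub_kermxP uA u0; exists u^T; first by rewrite trmx_eq0.
  by apply: trmx_inj; rewrite trmx_mul trmxK uA trmx0.
rewrite mul_col_mx col_mx_eq0 => /andP[lv l'v].
exists (span1 v); last by rewrite !span1_sub lv.
by apply/subspaces1P; exists v.
Qed.

End Plane.

Local Open Scope classical_set_scope.

(** * Stars of the building *)

Lemma unitmx_scale (F : fieldType) n (a : F) (g : 'M[F]_n) :
  a != 0 -> g \in unitmx -> a *: g \in unitmx.
Proof. by move=> a0 gu; rewrite unitmxZ // unitfE. Qed.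

Lemma Z3_natr_inj d d' : d%:R = d'%:R :> 'Z_3 -> (0 < d < 3)%N -> (0 < d' < 3)%N -> d = d'.
Proof. by move/(congr1 val); case: d d' => [|[|[|d]]] [|[|[|d']]]. Qed.

Section ProperSets.
Variable T : Type.
Implicit Types A B C : set T.

Lemma sub_proper_trans A B C : A `<=` B -> B `<` C -> A `<` C.
Proof.
by move=> AB [BC CB]; split=> [|CA]; [exact: subset_trans BC|apply: CB; exact: subset_trans AB].
Qed.

Lemma proper_sub_trans A B C : A `<` B -> B `<=` C -> A `<` C.
Proof.
by move=> [AB BA] BC; split=> [|CA]; [exact: subset_trans BC|apply: BA; exact: subset_trans CA].
Qed.

Lemma proper_trans A B C : A `<` B -> B `<` C -> A `<` C.
Proof. by move=> [AB _]; apply: sub_proper_trans. Qed.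

End ProperSets.

(** * Vertices, their colours and cells, described by subspaces of the residue space *)

Section Vertices.
Variable K : finFieldType.
Local Notation O := (fps K).
Local Notation F := (laurent K).
Local Notation iota := (@tofrac O).
Local Notation pi := (unif K).
Local Notation lattice := (set 'cV[F]_3).
Implicit Types (g h : 'M[F]_3) (L M : lattice) (x y z : vertex K).

Lemma scale_latticeA (a b : F) L : scale_lattice a (scale_lattice b L) = scale_lattice (a * b) L.
Proof.
apply/seteqP; split=> v; first by case=> u [w Lw <-] <-; exists w; rewrite // scalerA.
by case=> w Lw <-; exists (b *: w); rewrite ?scalerA //; exists w.
Qed.

Lemma scale_lattice1 L : scale_lattice 1 L = L.
Proof.
apply/seteqP; split=> v; first by case=> u Lu <-; rewrite scale1r.
by move=> Lv; exists v; rewrite ?scale1r.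
Qed.

Lemma scale_lattice_subset (a : F) L M : L `<=` M -> scale_lattice a L `<=` scale_lattice a M.
Proof. by move=> LM v [u Lu <-]; exists u => //; apply: LM. Qed.

Lemma scale_lattice_proper (a : F) L M : a != 0 -> L `<` M -> scale_lattice a L `<` scale_lattice a M.
Proof.
move=> a0 [LM ML]; split; first exact: scale_lattice_subset.
move=> h; apply: ML; have := @scale_lattice_subset a^-1 _ _ h.
by rewrite !scale_latticeA mulVf // !scale_lattice1.
Qed.

Definition vertex_rep x g := g \in unitmx /\ \val x (lattice_of g).

Lemma homothety_scale (a : F) L : a != 0 -> homothety_class (scale_lattice a L) = homothety_class L.
Proof.
move=> a0; apply/seteqP; split=> M [b b0 <-].
  by exists (b * a); [exact: mulf_neq0 b0 a0|rewrite scale_latticeA].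
exists (b / a); first by rewrite /= mulf_eq0 invr_eq0 negb_or b0 a0.
by rewrite scale_latticeA (divfK a0).
Qed.

Lemma vertex_mem_class x L : \val x L -> \val x = homothety_class L.
Proof.
case: x => c /= /asboolP[M [g gu ->] ->] [a a0 <-].
by rewrite homothety_scale.
Qed.

Lemma vertex_mem_inj x y L : \val x L -> \val y L -> x = y.
Proof. by move=> /vertex_mem_class xL /vertex_mem_class yL; apply/val_inj; rewrite xL yL. Qed.

Lemma vertex_scale x L (a : F) : a != 0 -> \val x L -> \val x (scale_lattice a L).
Proof. by move=> a0 /vertex_mem_class->; exists a. Qed.

Lemma vertex_memP x L : \val x L -> exists2 g, vertex_rep x g & L = lattice_of g.
Proof.
move=> xL; have /asboolP[M [g gu ->] xM] := valP x.
have [a a0 Lg] : homothety_class (lattice_of g) L by rewrite -xM.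
have agu : a *: g \in unitmx := unitmx_scale a0 gu.
exists (a *: g); last by rewrite -Lg scale_lattice_of.
by split=> //; rewrite -scale_lattice_of Lg.
Qed.

Lemma vertex_repP x : exists g, vertex_rep x g.
Proof.
case: x => c cv; have /asboolP[M [g gu Mg] cM] := cv.
exists g; split=> //=; rewrite cM; exists 1; first exact: oner_neq0.
by rewrite scale_lattice1.
Qed.

Lemma vertex_ex g : g \in unitmx -> exists x, vertex_rep x g.
Proof.
move=> gu; have cP : `[< is_vertex (homothety_class (lattice_of g)) >].
  by apply/asboolP; exists (lattice_of g) => //; exists g.
exists (exist (fun c => `[< is_vertex c >]) _ cP); split=> //=; exists 1; first exact: oner_neq0.
by rewrite scale_lattice1.
Qed.

Lemma vertex_rep_scale x g h : vertex_rep x g -> vertex_rep x h ->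
  exists2 a, a != 0 & lattice_of h = lattice_of (a *: g).
Proof.
move=> [gu /vertex_mem_class xg] [hu]; rewrite xg => -[a a0 <-].
by exists a; rewrite // scale_lattice_of.
Qed.

(** Two bases of one vertex give lattices that differ by a scalar, and a scalar of valuation [l]
    adds [3 l] to the valuation of the determinant. This makes the colour well defined modulo 3; a
    scalar of valuation 0 is a unit and leaves the lattice unchanged. *)
Lemma vertex_rep_val x g h m n : vertex_rep x g -> vertex_rep x h ->
  has_val (\det g) m -> has_val (\det h) n ->
  exists l : int, n = l *+ 3 + m /\ (l = 0 -> lattice_of h = lattice_of g).
Proof.
move=> xg xh gm hn; have [a a0 hE] := vertex_rep_scale xg xh.
have [l al] := has_val_ex a0.
have agu : a *: g \in unitmx := unitmx_scale a0 xg.1.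
exists l; split.
  by apply/esym/(lattice_of_eq_val agu xh.1 hE _ hn); apply: has_val_detZ.
move=> l0; move: al hE; rewrite l0 => -[u uu]; rewrite expr0z mul1r => -> ->.
have -> : iota u *: g = g *m map_mx iota u%:M.
  by rewrite map_scalar_mx mul_mx_scalar.
by apply: lattice_of_unit; rewrite unitmxE det_scalar unitrX.
Qed.

Lemma vertex_rep_val_eq x g h n : vertex_rep x g -> vertex_rep x h ->
  has_val (\det g) n -> has_val (\det h) n -> lattice_of h = lattice_of g.
Proof.
move=> xg xh gn hn; have [l [lE]] := vertex_rep_val xg xh gn hn; apply.
by lia.
Qed.

Lemma color_rep x g n : vertex_rep x g -> has_val (\det g) n -> color x = n%:~R.
Proof.
move=> xg gn; rewrite /color; case: xgetP => [k _|/(_ (n%:~R))]; last first.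
  by case; exists g; split; [exact: xg.1|exact: xg.2|rewrite (laurent_valE gn)].
case=> h [hu xh ->]; have [m hm] := has_val_ex (det_neq0 hu).
rewrite (laurent_valE hm).
have [l [-> _]] := vertex_rep_val xg (conj hu xh) gn hm.
rewrite rmorphD rmorphMn /= -mulr_natr (_ : 3%:R = 0 :> 'Z_3) ?mulr0 ?add0r //.
exact/val_inj.
Qed.

Lemma lattice_of_proper_pi g : g \in unitmx -> scale_lattice pi (lattice_of g) `<` lattice_of g.
Proof.
move=> gu; rewrite -sub_lattice0 -sub_latticeT; split.
  by apply/(sub_lattice_subset _ _ gu); apply: finset.subsetT.
move/(sub_lattice_subset _ _ gu)/fintype.subsetP/(_ (const_mx 1)).
rewrite !inE => /(_ isT)/eqP/matrixP/(_ ord0 ord0)/eqP.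
by rewrite !mxE oner_eq0.
Qed.

Definition nbhd : {set {set 'cV[K]_3}} := (subspaces K 1 :|: subspaces K 2)%SET.

Lemma nbhdP (W : {set 'cV[K]_3}) :
  reflect (exists B d, [/\ B \in unitmx, (0 < d < 3)%N & W = flag_space B d]) (W \in nbhd).
Proof.
apply: (iffP setUP) => [[]/imsetP[B Bu ->]|[B [[|[|[|d]]] [Bu // _ ->]]]].
- by exists B, 1%N.
- by exists B, 2%N.
- by left; apply/imsetP; exists B.
- by right; apply/imsetP; exists B.
Qed.

Lemma card_subspace1 (W : {set 'cV[K]_3}) : W \in subspaces K 1 -> #|W| = #|K|.
Proof.
case/subspaces1P=> v v0 ->; rewrite card_imset // => c c' /eqP.
by rewrite -subr_eq0 -scalerBl scalemx_eq0 (negPf v0) orbF subr_eq0 => /eqP.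
Qed.

Lemma card_subspace2 (W : {set 'cV[K]_3}) : W \in subspaces K 2 -> #|W| = (#|K| ^ 2)%N.
Proof. by case/subspaces2P=> l l0 ->; apply: card_ker1. Qed.

Lemma subspaces12 (W : {set 'cV[K]_3}) : W \in subspaces K 1 -> W \in subspaces K 2 -> False.
Proof.
move=> /card_subspace1 W1 /card_subspace2; rewrite W1.
by have := card_finNzRing_gt1 K; move: #|K| => q; rewrite !expnS expn0; nia.
Qed.

Lemma nbhd_proper g (W : {set 'cV[K]_3}) : g \in unitmx -> W \in nbhd ->
  scale_lattice pi (lattice_of g) `<` sub_lattice g W /\ sub_lattice g W `<` lattice_of g.
Proof.
move=> gu WN.
have [q1 q2 q3 q4] : [/\ 1 < #|K|, #|K| < #|K| ^ 3, 1 < #|K| ^ 2 & #|K| ^ 2 < #|K| ^ 3]%N.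
  have := card_finNzRing_gt1 K; move: #|K| => q; rewrite !expnS expn0 => q1.
  by split; nia.
have [W1 W3 W0] : [/\ (1 < #|W|)%N, (#|W| < #|K| ^ 3)%N & 0 \in W].
  case/setUP: WN => WN.
    rewrite (card_subspace1 WN); split=> //.
    by case/subspaces1P: WN => v _ ->; apply/span1P; exists 0; rewrite scale0r.
  rewrite (card_subspace2 WN); split=> //.
  by case/subspaces2P: WN => v _ ->; rewrite inE mulmx0.
rewrite -sub_lattice0 -sub_latticeT; split; split.
- by apply/(sub_lattice_subset _ _ gu); rewrite finset.sub1set.
- by move/(sub_lattice_subset _ _ gu)/subset_leq_card; rewrite cards1 leqNgt W1.
- by apply/(sub_lattice_subset _ _ gu); apply: finset.subsetT.
- move/(sub_lattice_subset _ _ gu)/subset_leq_card.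
  by rewrite cardsT card_mx muln1 leqNgt W3.
Qed.

Lemma nbhd_rep g (W : {set 'cV[K]_3}) : g \in unitmx -> W \in nbhd ->
  exists y, \val y (sub_lattice g W).
Proof.
move=> gu /nbhdP[B [d [Bu _ ->]]].
have [y [_ yB]] := vertex_ex (flag_mx_unit d gu Bu).
by exists y; rewrite sub_lattice_flag.
Qed.

Lemma sub_lattice_rep g B d y : g \in unitmx -> B \in unitmx ->
  \val y (sub_lattice g (flag_space B d)) -> vertex_rep y (flag_mx g B d).
Proof. by move=> gu Bu; rewrite (sub_lattice_flag _ _ Bu) => yB; split; [exact: flag_mx_unit|exact: yB]. Qed.

Lemma between_nbhd g M y : g \in unitmx -> \val y M ->
  scale_lattice pi (lattice_of g) `<` M -> M `<` lattice_of g ->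
  exists2 W, W \in nbhd & M = sub_lattice g W.
Proof.
move=> gu /vertex_memP[h _ ->] pgh hg.
have [B [d [Bu d12 hE]]] := sub_lattice_between gu pgh hg.
by exists (flag_space B d) => //; apply/nbhdP; exists B, d.
Qed.

Lemma color_flag x y g B d : vertex_rep x g -> B \in unitmx -> (d <= 3)%N ->
  \val y (sub_lattice g (flag_space B d)) -> color x - color y = d%:R.
Proof.
move=> xg Bu d3 yB; have [n gn] := has_val_ex (det_neq0 xg.1).
have yr := sub_lattice_rep xg.1 Bu yB.
rewrite (color_rep xg gn) (color_rep yr (has_val_flag_mx d3 xg.1 Bu gn)).
by rewrite rmorphD opprD addrA subrr add0r; apply/val_inj; case: d d3 {yB yr} => [|[|[|[|]]]].
Qed.

Lemma color_subspaces x y g d (W : {set 'cV[K]_3}) : vertex_rep x g -> W \in subspaces K d -> (d <= 3)%N ->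
  \val y (sub_lattice g W) -> color x - color y = d%:R.
Proof. by move=> xg /imsetP[B Bu ->]; apply: color_flag. Qed.

(** The colour of [y] determines the dimension. Then both lattices have the same determinant
    valuation and represent the same vertex, so they coincide. *)
Lemma nbhd_inj x y g (W W' : {set 'cV[K]_3}) : vertex_rep x g -> W \in nbhd -> W' \in nbhd ->
  \val y (sub_lattice g W) -> \val y (sub_lattice g W') -> W = W'.
Proof.
move=> xg /nbhdP[B [d [Bu d3 ->]]] /nbhdP[B' [d' [B'u d'3 ->]]] yB yB'.
have dd' : d = d'.
  have := color_flag xg B'u _ yB'; rewrite (color_flag xg Bu _ yB); last by case/andP: d3 => _ /ltnW.
  by move/(_ (ltnW (proj2 (andP d'3))))/Z3_natr_inj; apply.
have [n gn] := has_val_ex (det_neq0 xg.1).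
have d3' : (d <= 3)%N by case/andP: d3 => _ /ltnW.
subst d'; have E := vertex_rep_val_eq (sub_lattice_rep xg.1 Bu yB) (sub_lattice_rep xg.1 B'u yB')
  (has_val_flag_mx d3' xg.1 Bu gn) (has_val_flag_mx d3' xg.1 B'u gn).
have E' : sub_lattice g (flag_space B d) = sub_lattice g (flag_space B' d).
  exact: etrans (sub_lattice_flag g d Bu) (etrans (esym E) (esym (sub_lattice_flag g d B'u))).
apply/eqP; rewrite finset.eqEsubset; apply/andP; split.
  by apply/(sub_lattice_subset _ _ xg.1); rewrite E'.
by apply/(sub_lattice_subset _ _ xg.1); rewrite E'.
Qed.


Lemma vertex_rep_normalize x g M : vertex_rep x g -> \val x M ->
  exists2 a : F, a != 0 & scale_lattice a M = lattice_of g.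
Proof.
move=> xg /vertex_memP[h xh ->]; have [a a0 E] := vertex_rep_scale xh xg.
by exists a; rewrite // scale_lattice_of E.
Qed.

Lemma scale_lattice_swap (a b : F) L : scale_lattice a (scale_lattice b L) = scale_lattice b (scale_lattice a L).
Proof. by rewrite !scale_latticeA mulrC. Qed.

Lemma flag_nbhd x y z g L M : vertex_rep x g -> \val y M -> \val z L ->
  scale_lattice pi (lattice_of g) `<` M -> M `<` L -> L `<` lattice_of g ->
  exists U W, [/\ U \in subspaces K 1, W \in subspaces K 2, U \subset W,
    M = sub_lattice g U & L = sub_lattice g W].
Proof.
move=> xg yM zL pM ML LG.
have MG : M `<` lattice_of g := proper_trans ML LG.
have pL : scale_lattice pi (lattice_of g) `<` L := proper_trans pM ML.
have [U UN ME] := between_nbhd xg.1 yM pM MG.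
have [W WN LE] := between_nbhd xg.1 zL pL LG.
have UW : U \subset W by apply/(sub_lattice_subset _ _ xg.1); rewrite -ME -LE; case: ML.
have ltUW : (#|U| < #|W|)%N.
  rewrite ltnNge; apply/negP => leWU; case: ML => _; apply.
  have UEW : U = W by apply/eqP; rewrite finset.eqEcard UW leWU.
  by rewrite ME LE UEW.
exists U, W; case/setUP: UN => UN; case/setUP: WN => WN; split=> //.
- by move: ltUW; rewrite (card_subspace1 UN) (card_subspace1 WN) ltnn.
- by move: ltUW; rewrite (card_subspace2 UN) (card_subspace1 WN); nia.
- by move: ltUW; rewrite (card_subspace2 UN) (card_subspace1 WN); nia.
- by move: ltUW; rewrite (card_subspace2 UN) (card_subspace2 WN) ltnn.
Qed.

(** Cells of two and three vertices with an explicit chain of lattices. Both notions are invariant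
    under cyclic rotation, so [linked] is symmetric, but [triangle] is not: colours fix the cyclic
    order. *)
Definition linked x y := exists M0 M1,
  [/\ \val x M0, \val y M1, M1 `<` M0 & scale_lattice pi M0 `<` M1].

Definition triangle x y z := exists M0 M1 M2,
  [/\ \val x M0, \val y M1 & \val z M2] /\
  [/\ M1 `<` M0, M2 `<` M1 & scale_lattice pi M0 `<` M2].

(** Multiplied by [t], the largest lattice of the chain becomes the smallest. *)
Lemma linked_sym x y : linked x y -> linked y x.
Proof.
move=> [M0 [M1 [x0 y1 M10 pM]]]; exists M1, (scale_lattice pi M0); split=> //.
  exact: vertex_scale (unif_neq0 K) x0.
exact: scale_lattice_proper (unif_neq0 K) M10.
Qed.

Lemma triangle_rot x y z : triangle x y z -> triangle y z x.
Proof.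
move=> [M0 [M1 [M2 [[x0 y1 z2] [M10 M21 pM]]]]].
exists M1, M2, (scale_lattice pi M0); split; split=> //.
  exact: vertex_scale (unif_neq0 K) x0.
exact: scale_lattice_proper (unif_neq0 K) M10.
Qed.

Lemma linkedP x y g : vertex_rep x g ->
  linked x y <-> exists2 W, W \in nbhd & \val y (sub_lattice g W).
Proof.
move=> xg; split=> [[M0 [M1 [x0 y1 M10 pM]]]|[W WN yW]]; last first.
  have [pW Wg] := nbhd_proper xg.1 WN.
  by exists (lattice_of g), (sub_lattice g W); split=> //; exact: xg.2.
have [a a0 aM] := vertex_rep_normalize xg x0.
have [|||W WN WE] := @between_nbhd g (scale_lattice a M1) y xg.1.
- exact: vertex_scale.
- by rewrite -aM scale_lattice_swap; exact: scale_lattice_proper.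
- by rewrite -aM; exact: scale_lattice_proper.
by exists W => //; rewrite -WE; exact: vertex_scale.
Qed.

(** Chains decrease, so the line [W] precedes the point [U] that it contains; hence the order
    [x z y]. *)
Lemma triangleP x y z g : vertex_rep x g ->
  triangle x z y <-> exists U W, [/\ U \in subspaces K 1, W \in subspaces K 2, U \subset W,
    \val y (sub_lattice g U) & \val z (sub_lattice g W)].
Proof.
move=> xg; split=> [[M0 [M1 [M2 [[x0 z1 y2] [M10 M21 pM]]]]]|[U [W [U1 W2 UW yU zW]]]]; last first.
  have [UN WN] : U \in nbhd /\ W \in nbhd by rewrite !inE U1 W2 orbT.
  have [pU _] := nbhd_proper xg.1 UN; have [_ Wg] := nbhd_proper xg.1 WN.
  exists (lattice_of g), (sub_lattice g W), (sub_lattice g U).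
  split; split=> //; first exact: xg.2.
  split; first by apply/(sub_lattice_subset _ _ xg.1).
  move/(sub_lattice_subset _ _ xg.1) => WU.
  by apply: (subspaces12 U1); have /eqP-> : U == W by rewrite finset.eqEsubset UW WU.
have [a a0 aM] := vertex_rep_normalize xg x0.
have [|||||U [W [U1 W2 UW UE WE]]] := @flag_nbhd x y z g (scale_lattice a M1) (scale_lattice a M2) xg.
- exact: vertex_scale.
- exact: vertex_scale.
- by rewrite -aM scale_lattice_swap; exact: scale_lattice_proper.
- exact: scale_lattice_proper.
- by rewrite -aM; exact: scale_lattice_proper.
by exists U, W; split=> //; [rewrite -UE|rewrite -WE]; exact: vertex_scale.
Qed.

Lemma triangle_linked x y z : triangle x y z -> linked x y.
Proof.
move=> [M0 [M1 [M2 [[x0 y1 z2] [M10 M21 pM]]]]]; exists M0, M1; split=> //.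
exact: proper_trans pM M21.
Qed.

(** The colours of neighbours differ by 1 or 2 modulo 3. *)
Lemma linked_neq x y : linked x y -> x <> y.
Proof.
move=> xy xey; rewrite -xey in xy; have [g xg] := vertex_repP x.
have [W WN xW] := (linkedP _ xg).1 xy.
case/setUP: WN => WN; have := color_subspaces xg WN _ xW; rewrite subrr => /(_ isT)/(congr1 val); by [].
Qed.

Lemma cell_linked i (e : 'I_i.+1 -> vertex K) (j k : 'I_i.+1) :
  building_cell e -> (j < k)%N -> linked (e j) (e k).
Proof.
move=> [L [eL LL pL]] jk; exists (L j), (L k); split=> //; first exact: LL.
have L0 : L j `<=` L ord0.
  have [j0|j0] := posnP j; last exact: (properW (LL ord0 j j0)).
  by have -> : j = ord0 by apply/val_inj.
have L1 : L ord_max `<=` L k.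
  have := ltn_ord k; rewrite ltnS leq_eqVlt => /orP[/eqP ki|ki]; last exact: (properW (LL k ord_max ki)).
  by rewrite (_ : k = ord_max) //; apply/val_inj.
apply: (sub_proper_trans (scale_lattice_subset L0)); exact: (proper_sub_trans pL).
Qed.

Lemma cell_triangle i (e : 'I_i.+1 -> vertex K) (j k l : 'I_i.+1) :
  building_cell e -> (j < k)%N -> (k < l)%N -> triangle (e j) (e k) (e l).
Proof.
move=> [L [eL LL pL]] jk kl; exists (L j), (L k), (L l); split; split=> //; try exact: LL.
have L0 : L j `<=` L ord0.
  have [j0|j0] := posnP j; last exact: (properW (LL ord0 j j0)).
  by have -> : j = ord0 by apply/val_inj.
have L1 : L ord_max `<=` L l.
  have := ltn_ord l; rewrite ltnS leq_eqVlt => /orP[/eqP ki|ki]; last exact: (properW (LL l ord_max ki)).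
  by rewrite (_ : l = ord_max) //; apply/val_inj.
apply: (sub_proper_trans (scale_lattice_subset L0)); exact: (proper_sub_trans pL).
Qed.

Lemma vertex_cell x : building_cell (fun _ : 'I_1 => x).
Proof.
have [g xg] := vertex_repP x; exists (fun=> lattice_of g); split.
- by move=> _; exact: xg.2.
- by move=> j k; rewrite !ord1.
- exact: lattice_of_proper_pi xg.1.
Qed.

Lemma linked_cell x y : linked x y ->
  building_cell (fun i : 'I_2 => if i == ord0 then x else y).
Proof.
move=> [M0 [M1 [x0 y1 M10 pM]]]; exists (fun i => if i == ord0 then M0 else M1); split=> //.
  by move=> k; case: ifP.
by move=> j k; case: j => -[|[|]] // ?; case: k => -[|[|]].
Qed.

Lemma triangle_cell x y z : triangle x y z ->
  building_cell (fun i : 'I_3 => if i == ord0 then x else if i == ord_max then z else y).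
Proof.
move=> [M0 [M1 [M2 [[x0 y1 z2] [M10 M21 pM]]]]].
exists (fun i => if i == ord0 then M0 else if i == ord_max then M2 else M1); split=> //.
  by move=> k; case: ifP => // _; case: ifP.
have M20 := proper_trans M21 M10.
by move=> j k; case: j => -[|[|[|]]] // ?; case: k => -[|[|[|]]].
Qed.

Lemma adjacentE x y : adjacent x y <-> linked x y.
Proof.
split=> [/asboolP[e ec xye]|xy]; last first.
  apply/asboolP; exists (fun i : 'I_2 => if i == ord0 then x else y); first exact: linked_cell.
  apply/seteqP; split=> [z [->|->]|z [i _ <-]]; first by exists ord0.
    by exists ord_max.
  by case: ifP => _; [left|right].
have l01 : linked (e ord0) (e ord_max) by apply: cell_linked.
have e0 : [set x; y] (e ord0) by rewrite xye; exists ord0.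
have e1 : [set x; y] (e ord_max) by rewrite xye; exists ord_max.
have := linked_neq l01.
case: e0 => E0; case: e1 => E1; rewrite E0 E1 in l01 * => // _.
exact: linked_sym.
Qed.

Lemma adjacent_sym x y : adjacent x y -> adjacent y x.
Proof. by move/adjacentE/linked_sym/adjacentE. Qed.

Lemma colored_edgeP x y g d : vertex_rep x g -> (0 < d < 3)%N ->
  colored_edge d%:R x y <-> exists2 W, W \in subspaces K d & \val y (sub_lattice g W).
Proof.
move=> xg d3; split=> [[/adjacentE/(linkedP _ xg)[W WN yW] cxy]|[W WN yW]].
  exists W => //; have /nbhdP[B [d' [Bu d'3 WE]]] := WN.
  rewrite WE in yW *; have d'3' : (d' <= 3)%N by case/andP: d'3 => _ /ltnW.
  have := color_flag xg Bu d'3' yW; rewrite cxy => /Z3_natr_inj-> //.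
  by apply/imsetP; exists B.
split; last by apply: (color_subspaces xg WN _ yW); case/andP: d3 => _ /ltnW.
apply/adjacentE/(linkedP _ xg); exists W => //.
by case: d d3 WN => [|[|[|]]] // _ WN; rewrite inE WN ?orbT.
Qed.

Lemma colored_edge_sym x y : colored_edge 1 x y <-> colored_edge 2%:R y x.
Proof.
have N1 : 2%:R = - 1 :> 'Z_3 by apply/val_inj.
split=> -[xy c]; split; try exact: adjacent_sym.
  by rewrite -opprB c N1.
by rewrite -opprB c N1 opprK.
Qed.

(** In the projective plane of [y], both [x] and [z] are lines; a point on both of them is the
    vertex [y']. *)
Lemma diamond_ex x y z : colored_edge 1 x y -> colored_edge 2%:R y z ->
  exists2 y', colored_edge 2%:R x y' & colored_edge 1 y' z.
Proof.
move=> /colored_edge_sym yx yz; have [h yh] := vertex_repP y.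
have [U U2 xU] := (colored_edgeP x yh (isT : (0 < 2 < 3)%N)).1 yx.
have [U' U'2 zU'] := (colored_edgeP z yh (isT : (0 < 2 < 3)%N)).1 yz.
have [W W1 /andP[WU WU']] := subspaces2_meet U2 U'2.
have WN : W \in nbhd by rewrite inE W1.
have [y' y'W] := nbhd_rep yh.1 WN.
have cy' := color_subspaces yh W1 isT y'W.
have key u V : V \in subspaces K 2 -> W \subset V -> \val u (sub_lattice h V) ->
    colored_edge 2%:R u y'.
  move=> V2 WV uV; split.
    apply/adjacentE; apply: (@triangle_linked _ _ y); apply: triangle_rot.
    by apply/(triangleP _ _ yh); exists W, V.
  have cu := color_subspaces yh V2 isT uV.
  have -> : color u - color y' = (color y - color y') - (color y - color u).
    by rewrite opprB [RHS]addrC addrA subrK.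
  by rewrite cy' cu; exact/val_inj.
exists y'; first exact: (key x U).
by apply/colored_edge_sym; exact: (key z U').
Qed.

(** In the plane of [x], the vertices [y1] and [y2] are distinct points. One lattice of [z] lies in
    both of their lattices, hence in [t L] because the points meet in 0, and it has the determinant
    valuation of [t L]; so it is [t L]. *)
Lemma diamond_uniq x y1 y2 z : colored_edge 1 x y1 -> colored_edge 1 x y2 ->
  colored_edge 2%:R y1 z -> colored_edge 2%:R y2 z -> y1 <> y2 -> x = z.
Proof.
move=> xy1 xy2 y1z y2z y12.
have [g xg] := vertex_repP x; have [n gn] := has_val_ex (det_neq0 xg.1).
(* A subspace of dimension 1 adds 2 to the valuation and one of dimension 2 adds 1; the total
   [n + 3] is also the valuation for [pi *: g]. *)
have step y : colored_edge 1 x y -> colored_edge 2%:R y z -> exists W m,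
   [/\ W \in subspaces K 1, \val y (sub_lattice g W), vertex_rep z m, has_val (\det m) (n + 2%:Z + 1%:Z)
     & lattice_of m `<=` sub_lattice g W].
  move=> xy yz; have [W W1 yW] := (colored_edgeP y xg (isT : (0 < 1 < 3)%N)).1 xy.
  have /imsetP[B Bu WE] := W1; rewrite WE in yW.
  have yh := sub_lattice_rep xg.1 Bu yW.
  have [U U2 zU] := (colored_edgeP z yh (isT : (0 < 2 < 3)%N)).1 yz.
  have UN : U \in nbhd by rewrite inE U2 orbT.
  have [_ [UW _]] := nbhd_proper yh.1 UN.
  have /imsetP[B' B'u UE] := U2; rewrite UE in zU UW.
  exists W, (flag_mx (flag_mx g B 1) B' 2); split.
  - exact: W1.
  - by rewrite WE.
  - exact: sub_lattice_rep yh.1 B'u zU.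
  - apply: (@has_val_flag_mx K _ B' 2 _ isT yh.1 B'u).
    exact: (@has_val_flag_mx K _ B 1 _ isT xg.1 Bu gn).
  - rewrite -(sub_lattice_flag _ _ B'u) WE (sub_lattice_flag _ _ Bu); exact: UW.
have [W1 [m1 [W1s y1W zm1 vm1 m1W]]] := step _ xy1 y1z.
have [W2 [m2 [W2s y2W zm2 vm2 m2W]]] := step _ xy2 y2z.
have mm : lattice_of m2 = lattice_of m1 := vertex_rep_val_eq zm1 zm2 vm1 vm2.
have W12 : W1 != W2.
  by apply/eqP => E; apply: y12; apply: (vertex_mem_inj y1W); rewrite E.
have msub : lattice_of m1 `<=` lattice_of (pi *: g).
  move=> v vm; rewrite -scale_lattice_of -sub_lattice0.
  have [w wW1 vE] := m1W _ vm.
  have : sub_lattice g W2 v by apply: m2W; rewrite mm.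
  rewrite -vE => /(sub_latticeP _ _ xg.1) wW2; apply/(sub_latticeP _ _ xg.1).
  by rewrite inE; apply: contraNT W12 => w0; apply/eqP; apply: (subspaces1_disjoint W1s W2s wW1 wW2).
have pgu : pi *: g \in unitmx := unitmx_scale (unif_neq0 K) xg.1.
have pgv : has_val (\det (pi *: g)) (n + 2%:Z + 1%:Z).
  have -> : n + 2%:Z + 1%:Z = (1 : int) *+ 3 + n by lia.
  by apply: has_val_detZ => //; rewrite -[pi]expr1z; apply: has_val_pi.
have E := lattice_of_sub_val pgu zm1.1 pgv vm1 msub.
apply: (@vertex_mem_inj _ _ (lattice_of m1)); last exact: zm1.2.
by rewrite E -scale_lattice_of; apply: vertex_scale (unif_neq0 K) xg.2.
Qed.

Lemma moves_ex g x : g \in unitmx -> exists y, moves_to g x y.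
Proof.
move=> gu; have [h [hu xh]] := vertex_repP x.
have ghu : g *m h \in unitmx by rewrite unitmx_mul gu hu.
have [y [_ yg]] := vertex_ex ghu; exists y.
rewrite /moves_to (vertex_mem_class yg) (vertex_mem_class xh).
apply/seteqP; split=> M.
  case=> a a0 <-; exists (scale_lattice a (lattice_of h)); first by exists a.
  by rewrite !scale_lattice_of act_lattice_of scalemxAr.
case=> _ [a a0 <-] <-; exists a => //.
by rewrite !scale_lattice_of act_lattice_of scalemxAr.
Qed.

Lemma moves_mem g x y L : moves_to g x y -> \val x L -> \val y (act_lattice g L).
Proof. by rewrite /moves_to => -> xL; exists L. Qed.

Lemma moves_rep g x y h : g \in unitmx -> moves_to g x y -> vertex_rep x h -> vertex_rep y (g *m h).
Proof.
move=> gu gxy [hu xh]; split; first by rewrite unitmx_mul gu hu.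
by rewrite -act_lattice_of; apply: moves_mem gxy xh.
Qed.

Lemma scalars_moves g x y : scalars g -> moves_to g x y -> y = x.
Proof.
move=> [a a0 <-] gxy; have [h [hu xh]] := vertex_repP x.
apply: (vertex_mem_inj (moves_mem gxy xh)).
by rewrite act_lattice_of mul_scalar_mx -scale_lattice_of; apply: vertex_scale.
Qed.

End Vertices.

(** * Schur's test *)

(** Expand the nonnegative sum of [phi y * (a y / phi y - A / P)^2]. *)
Lemma cauchy_schwarz_seq (R : realFieldType) (T : eqType) (r : seq T) (a phi : T -> R) :
  (forall y, 0 < phi y) ->
  (\sum_(y <- r) a y) ^+ 2 <= (\sum_(y <- r) phi y) * \sum_(y <- r) (a y) ^+ 2 / phi y.
Proof.
move=> phi0; case: r => [|y0 r0]; first by rewrite !big_nil expr0n mul0r.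
set r := y0 :: r0; set A := \sum_(y <- r) a y; set P := \sum_(y <- r) phi y.
have P0 : 0 < P.
  rewrite /P big_cons; apply: ltr_pwDl => //; apply: sumr_ge0 => y _; exact: ltW.
have : 0 <= \sum_(y <- r) phi y * (a y / phi y - A / P) ^+ 2.
  by apply: sumr_ge0 => y _; rewrite mulr_ge0 ?sqr_ge0 // ltW.
have -> : \sum_(y <- r) phi y * (a y / phi y - A / P) ^+ 2 =
    \sum_(y <- r) a y ^+ 2 / phi y - A ^+ 2 / P.
  transitivity (\sum_(y <- r) (a y ^+ 2 / phi y - a y * (2 * (A / P)) + phi y * (A / P) ^+ 2)).
    by apply: eq_bigr => y _; field; rewrite !gt_eqF.
  rewrite big_split sumrB /= -!mulr_suml -/A -/P; field.
  by rewrite gt_eqF.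
by rewrite subr_ge0 ler_pdivrMr // [P * _]mulrC.
Qed.

Lemma normc_ge0 (R : rcfType) (x : R[i]) : 0 <= Normc.normc x.
Proof. by case: x => a b; rewrite /Normc.normc sqrtr_ge0. Qed.

Lemma normc_sum (R : rcfType) (T : Type) (r : seq T) (f : T -> R[i]) :
  Normc.normc (\sum_(y <- r) f y) <= \sum_(y <- r) Normc.normc (f y).
Proof.
elim: r => [|y r IH]; first by rewrite !big_nil Normc.normc0.
by rewrite !big_cons (le_trans (le_normcD _ _)) // lerD2l.
Qed.

Lemma esum_scale_le (R : realType) (T : choiceType) (c : R) (a : T -> R) :
  0 <= c -> (forall x, 0 <= a x) ->
  (\esum_(x in [set: T]) (c * a x)%:E <= c%:E * \esum_(x in [set: T]) (a x)%:E)%E.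
Proof.
move=> c0 a0; apply: ge_ereal_sup => _ [F [Ffin FT] <-].
rewrite fsbig_finite // sumEFin -mulr_sumr EFinM; apply: lee_wpmul2l; first by rewrite lee_fin.
apply: esum_ge; exists F; first by split.
by rewrite fsbig_finite // sumEFin.
Qed.

Lemma esum_seq (R : realType) (T : choiceType) (A : set T) (r : seq T) (a : T -> R) :
  uniq r -> (forall y, A y <-> y \in r) -> (forall y, 0 <= a y) ->
  \esum_(y in A) (a y)%:E = (\sum_(y <- r) a y)%:E.
Proof.
move=> ur Ar a0; have -> : A = [set` r].
  by apply/seteqP; split=> y /Ar.
rewrite esum_fset; last by move=> i _; rewrite lee_fin.
  by rewrite -fsbig_seq // sumEFin.
exact: finite_seq.
Qed.

Section SchurTest.
Variables (R : realType) (T : choiceType) (E : T -> T -> Prop).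
Variables (nb nb' : T -> seq T) (phi : T -> R) (lam : R).
Hypothesis nb_uniq : forall x, uniq (nb x).
Hypothesis nb'_uniq : forall x, uniq (nb' x).
Hypothesis nbP : forall x y, E x y <-> y \in nb x.
Hypothesis nb'P : forall x y, E x y <-> x \in nb' y.
Hypothesis phi0 : forall x, 0 < phi x.
Hypothesis nb_phi : forall x, \sum_(y <- nb x) phi y <= lam * phi x.
Hypothesis nb'_phi : forall y, \sum_(x <- nb' y) phi x <= lam * phi y.

Lemma hecke_seq (f : T -> R[i]) x : hecke E f x = \sum_(y <- nb x) f y.
Proof.
rewrite /hecke; have -> : [set y | E x y] = [set` nb x].
  by apply/seteqP; split=> y /nbP.
by rewrite -fsbig_seq.
Qed.

Lemma schur_lam0 (x : T) : 0 <= lam.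
Proof.
have : 0 <= lam * phi x by rewrite (le_trans _ (nb_phi x)) // sumr_ge0 // => y _; rewrite ltW.
by rewrite pmulr_lge0.
Qed.

(** Cauchy-Schwarz with weight [phi] over out-neighbours bounds the left side by a sum over edges.
    In the other order of summation the inner sum runs over in-neighbours, where [nb'_phi] yields
    the second factor [lam]. *)
Lemma schur_test (f : T -> R[i]) : (l2sq (hecke E f) <= (lam ^+ 2)%:E * l2sq f)%E.
Proof.
have phi_ge0 x : 0 <= phi x by apply: ltW.
pose n2 y := Normc.normc (f y) ^+ 2.
have n20 y : 0 <= n2 y by apply: sqr_ge0.
pose k x y : R := lam * phi x * (n2 y / phi y).
have k0 x y : 0 <= k x y by apply: mulr_ge0; [apply: mulr_ge0; [exact: schur_lam0 x|]|apply: divr_ge0].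
have step1 : (l2sq (hecke E f) <= \esum_(x in [set: T]) \esum_(y in [set y | E x y]) (k x y)%:E)%E.
  apply: le_esum => x _; rewrite (@esum_seq _ _ _ (nb x) (k x) (nb_uniq x) (nbP x) (k0 x)).
  rewrite lee_fin hecke_seq.
  rewrite -mulr_sumr.
  apply: (@le_trans _ _ ((\sum_(y <- nb x) Normc.normc (f y)) ^+ 2)).
    by rewrite lerXn2r ?nnegrE ?normc_ge0 ?normc_sum // sumr_ge0 // => y _; apply: normc_ge0.
  apply: (le_trans (cauchy_schwarz_seq _ _ phi0)).
  by apply: ler_wpM2r => //; apply: sumr_ge0 => y _; apply: divr_ge0 => //; apply: sqr_ge0.
apply: (le_trans step1); rewrite esum_esum; last by move=> x y _ _; rewrite lee_fin.
have -> : \esum_(p in [set: T] `*`` (fun x => [set y | E x y])) (k p.1 p.2)%:E =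
   \esum_(p in [set: T] `*`` (fun y => [set x | E x y])) (k p.2 p.1)%:E.
  rewrite (@reindex_esum _ _ _ ([set: T] `*`` (fun y => [set x | E x y])) _ (fun p => (p.2, p.1))) //.
  split.
  - by move=> [y x] /= [_ xy].
  - by move=> [y x] [y' x'] _ _ [-> ->].
  - by move=> [x y] /= [_ xy]; exists (y, x).
rewrite -(@esum_esum _ _ _ _ (fun y => [set x | E x y]) (fun y x => (k x y)%:E)); last first.
  by move=> x y _ _; rewrite lee_fin.
apply: (@le_trans _ _ (\esum_(y in [set: T]) (lam ^+ 2 * n2 y)%:E)%E).
  apply: le_esum => y _; rewrite (@esum_seq _ _ _ (nb' y) (k ^~ y) (nb'_uniq y) (fun x => nb'P x y) (k0 ^~ y)).
  rewrite lee_fin -mulr_suml -mulr_sumr.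
  apply: (@le_trans _ _ (lam * (lam * phi y) * (n2 y / phi y))).
    apply: ler_wpM2r; first by rewrite divr_ge0.
    by apply: ler_wpM2l; [exact: schur_lam0 y|exact: nb'_phi].
  by rewrite le_eqVlt; apply/orP; left; apply/eqP; field; rewrite gt_eqF.
by apply: esum_scale_le => //; apply: sqr_ge0.
Qed.

(** The factor 2 comes from the pointwise bound [|l f|^2 <= 2 (|A f - l f|^2 + |A f|^2)], which
    takes the place of the triangle inequality for the [L^2] norm. *)
Lemma schur_approx_eigenvalue (l : R[i]) :
  (forall e : R, 0 < e -> exists f : T -> R[i], l2sq f = 1%E /\
     (l2sq (fun x => (hecke E f x - l * f x)%R) < e%:E)%E) ->
  Normc.normc l ^+ 2 <= 2 * lam ^+ 2.
Proof.
move=> happ; have [->|l0] := eqVneq l 0.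
  by rewrite Normc.normc0 expr0n mulr_ge0 // sqr_ge0.
set nl := Normc.normc l ^+ 2.
have nl0 : 0 < nl.
  rewrite /nl exprn_gt0 // lt0r normc_ge0 andbT; apply: contraNneq l0.
  by move/Normc.eq0_normc->.
rewrite leNgt; apply/negP => lt.
(* Chosen so that [2 (e + lam^2) = nl], which turns the estimate below into [1 < 1]. *)
pose e := (nl - 2 * lam ^+ 2) / 2.
have e0 : 0 < e by rewrite divr_gt0 // subr_gt0.
have [f [f1 fe]] := happ e e0.
have sA := schur_test f; rewrite f1 mule1 in sA.
pose d x := Normc.normc (hecke E f x - l * f x) ^+ 2.
pose u x := Normc.normc (hecke E f x) ^+ 2.
have d0 x : 0 <= d x by apply: sqr_ge0.
have u0 x : 0 <= u x by apply: sqr_ge0.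
have pt x : Normc.normc (f x) ^+ 2 <= (2 / nl) * (d x + u x).
  rewrite mulrAC ler_pdivlMr // -exprMn -Normc.normcM mulrC.
  have : Normc.normc (l * f x) <= Normc.normc (hecke E f x - l * f x) + Normc.normc (hecke E f x).
    rewrite [X in Normc.normc X <= _](_ : _ = - (hecke E f x - l * f x) + hecke E f x); last by rewrite opprB subrK.
    by apply: le_trans (le_normcD _ _) _; rewrite normcN.
  rewrite /d /u; move: (normc_ge0 (l * f x)); set A := Normc.normc _; set B := Normc.normc _; set C := Normc.normc _.
  move=> A0 AB; have : A ^+ 2 <= (B + C) ^+ 2 by rewrite lerXn2r ?nnegrE // (le_trans A0).
  by have := sqr_ge0 (B - C); nra.
have : (1 <= (2 / nl)%:E * (\esum_(x in [set: T]) (d x + u x)%:E))%E.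
  rewrite -f1; apply: (@le_trans _ _ (\esum_(x in [set: T]) ((2 / nl) * (d x + u x))%:E)%E).
    by apply: le_esum => x _; rewrite lee_fin.
  by apply: esum_scale_le => [|x]; rewrite ?addr_ge0 ?divr_ge0 // ltW.
under eq_esum => x _ do rewrite EFinD.
rewrite esumD; try by move=> x _; rewrite lee_fin.
have lt2 : (\esum_(x in [set: T]) (d x)%:E + \esum_(x in [set: T]) (u x)%:E < (e + lam ^+ 2)%:E)%E.
  by rewrite EFinD; apply: lte_leD => //; rewrite ge0_fin_numE ?(le_lt_trans sA) ?ltry // esum_ge0 // => x _; rewrite lee_fin.
apply/negP; rewrite -ltNge.
have pos : (0 < (2 / nl)%:E)%E by rewrite lte_fin divr_gt0.
apply: (lt_le_trans (y := ((2 / nl)%:E * (e + lam ^+ 2)%:E)%E)).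
  by rewrite lte_pmul2l.
rewrite -EFinM lee_fin mulrAC ler_pdivrMr // mul1r /e; lra.
Qed.

End SchurTest.

(** * The weight of a horofunction and the spectrum of the building *)

Lemma expf_shift (F : fieldType) (p : F) j k n : p != 0 ->
  p ^+ j * p ^- n = p ^- (k + n) * p ^+ k * p ^+ j.
Proof. by move=> p0; rewrite exprD invfM [_ * p ^+ k]mulrAC mulVf ?expf_neq0 // mul1r mulrC. Qed.

Section Busemann.
Variable K : finFieldType.
Local Notation O := (fps K).
Local Notation F := (laurent K).
Local Notation iota := (@tofrac O).
Local Notation pi := (unif K).
Local Notation red := (@fps_red K).
Local Notation const := (@fps_const K).
Local Notation q := #|K|.
Implicit Types (g h : 'M[F]_3) (x y z : vertex K) (r : 'rV[O]_3).

(* [m] is the least valuation of the first coordinate on [lattice_of g], and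
   [l] the functional which that coordinate induces on its reduction. *)
Definition row_val g (m : int) (l : 'rV[K]_3) := exists r,
  [/\ row ord0 g = pi ^ m *: map_mx iota r, l = map_mx red r & l != 0].

Lemma row_red0_divt r : map_mx red r = 0 -> exists r', r = fps_t K *: r'.
Proof.
move=> r0; have [|w wE] := @red0_divt K r^T; first by rewrite -map_trmx r0 trmx0.
by exists w^T; rewrite -[r]trmxK wE linearZ.
Qed.

Lemma row_primitive r : r != 0 -> exists j r', r = fps_t K ^+ j *: r' /\ map_mx red r' != 0.
Proof.
case/rV0Pn=> i /fps_factor[n [u [uu]]].
elim: n r => [|n IH] r ri.
  exists 0%N, r; split; first by rewrite expr0 scale1r.
  apply/rV0Pn; exists i; rewrite mxE ri expr0 mul1r.
  by rewrite -fps_unitE.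
have [r0|r0] := eqVneq (map_mx red r) 0; last by exists 0%N, r; rewrite expr0 scale1r.
have [r' rE] := row_red0_divt r0.
have /IH[j [r'' [r'E r''0]]] : r' ord0 i = fps_t K ^+ n * u.
  apply: (mulfI (fps_t_neq0 K)); rewrite mulrA -exprS -ri rE mxE //.
by exists j.+1, r''; rewrite exprS -scalerA -r'E.
Qed.

(** Stated for all [m >= n], so that the three entries of a row can be put over one common power of
    [t]. *)
Lemma integral_multiple (x : F) : exists n : nat, exists a : O, forall m : nat,
  (n <= m)%N -> x = pi ^- m * iota (fps_t K ^+ (m - n) * a).
Proof.
have [->|x0] := eqVneq x 0; first by exists 0%N, 0 => m _; rewrite mulr0 rmorph0 mulr0.
have [v [u uu xE]] := has_val_ex x0.
have [n [j vE]] : exists n j : nat, v = j%:Z - n%:Z.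
  case: v {xE} => k; first by exists 0%N, k; rewrite subr0.
  by exists k.+1, 0%N; rewrite NegzE sub0r.
exists n, (fps_t K ^+ j * u) => m nm.
rewrite xE vE !rmorphM !rmorphXn /= mulrA mulrA; congr (_ * _).
rewrite -(subnK nm); move: (m - n)%N => k.
rewrite expfzDr ?unif_neq0 // -exprnN -exprnP addnK.
rewrite mulrA; exact: (@expf_shift F pi j k n (unif_neq0 K)).
Qed.

Lemma row_val_ex g : g \in unitmx -> exists m l, row_val g m l.
Proof.
move=> gu.
have [f fP] : {f : 'I_3 -> nat * O & forall i m, ((f i).1 <= m)%N ->
    g ord0 i = pi ^- m * iota (fps_t K ^+ (m - (f i).1) * (f i).2)}.
  apply: (@choice _ _ (fun i p => forall m, (p.1 <= m)%N ->
    g ord0 i = pi ^- m * iota (fps_t K ^+ (m - p.1) * p.2))) => i.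
  by have [n [a na]] := integral_multiple (g ord0 i); exists (n, a).
pose m := (\sum_i (f i).1)%N.
have fm i : ((f i).1 <= m)%N by rewrite /m (bigD1 i) //= leq_addr.
pose r := \row_i (fps_t K ^+ (m - (f i).1) * (f i).2).
have gr : row ord0 g = pi ^- m *: map_mx iota r.
  by apply/matrixP => a i; rewrite !mxE (fP i m (fm i)).
have r0 : r != 0.
  apply/eqP => r0; move: gr; rewrite r0 map_mx0 scaler0 => g0.
  have := congr1 (mulmx ^~ (invmx g)) g0; rewrite -row_mul (mulmxV gu) mul0mx.
  move=> /matrixP/(_ ord0 ord0)/eqP; rewrite !mxE eqxx /=.
  by rewrite oner_eq0.
have [j [r' [rE r'0]]] := row_primitive r0.
exists (j%:Z - m%:Z), (map_mx red r'), r'; split=> //.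
rewrite gr rE map_mxZ scalerA rmorphXn expfzDr ?unif_neq0 // -exprnN -exprnP.
by rewrite mulrC.
Qed.

Lemma row_val_uniq g m m' l l' : row_val g m l -> row_val g m' l' -> m = m'.
Proof.
wlog le_mm : m m' l l' / m <= m'.
  by move=> W xm xn; case: (leP m m') => [|/ltW] le; [|symmetry]; apply: W; eauto.
move=> [r [gr lr l0]] [r' [gr' l'r l'0]].
have [k mk] : exists k : nat, m' = m + k%:Z.
  by exists `|m' - m|%N; rewrite gez0_abs ?subr_ge0 // subrKC.
case: k mk => [|k] mk; first by rewrite mk addr0.
move: l0; rewrite lr; suff -> : r = fps_t K ^+ k.+1 *: r'.
  by rewrite map_mxZ exprS rmorphM /= fps_red_t mul0r scale0r eqxx.
apply: (@map_iota_inj K 1 3).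
have pm0 : pi ^ m != 0 by apply: expfz_neq0; apply: unif_neq0.
apply: (scalerI pm0); rewrite -gr gr' mk expfzDr ?unif_neq0 // -scalerA map_mxZ rmorphXn.
by rewrite -exprnP.
Qed.

(** Scaling a lattice by [t] adds 3 to [d] and 1 to [m], so [d - 3 m] depends only on the vertex; it
    is an integer-valued horofunction. *)
Definition busemann x (n : int) := exists g d m l,
  [/\ vertex_rep x g, has_val (\det g) d, row_val g m l & n = d - m *+ 3].

Lemma row_val_unit g k m l : k \in unitmx -> row_val g m l ->
  row_val (g *m map_mx iota k) m (l *m map_mx red k).
Proof.
move=> ku [r [gr lr l0]]; exists (r *m k); split.
- by rewrite row_mul gr -scalemxAl map_mxM.
- by rewrite lr map_mxM.
- have rku : map_mx red k \in unitmx.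
    by rewrite unitmxE det_map_mx; apply: rmorph_unit; rewrite -unitmxE.
  by apply: contraNneq l0 => l0; rewrite -[l](mulmxK rku) l0 mul0mx.
Qed.

Lemma row_val_scale g (a : F) n m l : has_val a n -> row_val g m l ->
  exists l', row_val (a *: g) (n + m) l'.
Proof.
move=> [u uu ->] [r [gr lr l0]]; exists (red u *: l), (u *: r); split.
- rewrite linearZ /= gr scalerA map_mxZ scalerA expfzDr ?unif_neq0 //.
  by rewrite -mulrA [iota u * _]mulrC mulrA.
- by rewrite map_mxZ lr.
- by rewrite scalemx_eq0 (negPf l0) orbF -fps_unitE.
Qed.

Lemma busemann_uniq x n n' : busemann x n -> busemann x n' -> n = n'.
Proof.
move=> [g [d [m [l [xg gd gm ->]]]]] [h [d' [m' [l' [xh hd hm ->]]]]].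
have [a a0 hE] := vertex_rep_scale xg xh.
have agu : a *: g \in unitmx := unitmx_scale a0 xg.1.
have [k ku hk] := (lattice_of_eq agu xh.1).1 hE.
have [s as_] := has_val_ex a0.
have [l1 gm1] := row_val_scale as_ gm.
have E1 := lattice_of_eq_val agu xh.1 hE (has_val_detZ as_ gd) hd.
have := row_val_unit ku gm1; rewrite -hk => hm1.
have E2 := row_val_uniq hm1 hm.
lia.
Qed.

Lemma flag_space_row (B : 'M[K]_3) d (l : 'rV[K]_3) : B \in unitmx ->
  (flag_space B d \subset ker1 l) = [forall i : 'I_3, (i < d)%N ==> ((l *m B) ord0 i == 0)].
Proof.
move=> Bu; apply/fintype.subsetP/forallP => [lB i|lB w].
  apply/implyP => id; have : col i B \in flag_space B d.
    rewrite inE; apply/forallP => j; apply/implyP => dj.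
    rewrite colE (mulKmx Bu) mxE andbT; have [ji|//] := eqVneq j i.
    by move: dj; rewrite ji leqNgt id.
  by move/lB; rewrite inE colE mulmxA -colE => /eqP/matrixP/(_ ord0 ord0); rewrite !mxE => ->.
rewrite !inE => /forallP wB; rewrite -[w](mulKVmx Bu) (mulmxA l B); apply/eqP/matrixP => a b.
rewrite !ord1 [LHS]mxE [RHS]mxE big1 // => i _; case: (ltnP i d) => id.
  by rewrite (eqP (implyP (lB i) id)) mul0r.
by rewrite (eqP (implyP (wB i) id)) mulr0.
Qed.

(** In the adapted basis the first coordinate has entries [r'] in the first [d] columns and [t r']
    in the others. All are divisible by [t] exactly when [l] vanishes on the subspace, and then only
    once, as [l B] has a nonzero entry past the first [d]. *)
Lemma row_val_flag g B d m l : B \in unitmx -> row_val g m l ->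
  exists l', row_val (flag_mx g B d) (m + (flag_space B d \subset ker1 l)%:Z) l'.
Proof.
move=> Bu [r [gr lr l0]].
have [r' [redr' rowE]] : exists r', map_mx red r' = l *m B /\
    row ord0 (flag_mx g B d) = pi ^ m *: map_mx iota (r' *m flag_diag K d).
  exists (r *m map_mx const B); split.
    by rewrite map_mxM lr; congr (_ *m _); apply/matrixP => i j; rewrite !mxE.
  by rewrite /flag_mx row_mul gr -scalemxAl -map_mxM mulmxA.
have lB0 : l *m B != 0.
  by apply: contraNneq l0 => l0; rewrite -[l](mulmxK Bu) l0 mul0mx.
have rD : r' *m flag_diag K d = \row_i (r' ord0 i * if (i < d)%N then 1 else fps_t K).
  by apply/matrixP => a i; rewrite mul_mx_diag !mxE ord1.
rewrite flag_space_row //; have [/forallP lB|/forallPn [j]] :=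
  boolP [forall i : 'I_3, (i < d)%N ==> ((l *m B) ord0 i == 0)].
  pose r2 := \row_i (if (i < d)%N then xget 0 [set c : O | r' ord0 i = fps_t K * c] else r' ord0 i).
  have r2E : r' *m flag_diag K d = fps_t K *: r2.
    rewrite rD; apply/matrixP => a i; rewrite !mxE; case: ifP => id; last by rewrite mulrC.
    have [c cE] : exists c, r' ord0 i = fps_t K * c.
      apply: fps_red0_divt; have /matrixP/(_ ord0 i) := redr'; rewrite [LHS]mxE => ->.
      exact: (eqP (implyP (lB i) id)).
    by rewrite mulr1; exact: (@xgetPex _ 0 [set c : O | r' ord0 i = fps_t K * c] (ex_intro _ c cE)).
  exists (map_mx red r2), r2; split=> //.
    rewrite rowE r2E map_mxZ scalerA expfzDr ?unif_neq0 //.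
  have /rV0Pn[i li] := lB0.
  apply/rV0Pn; exists i; rewrite !mxE; case: ifP => id.
    by rewrite (eqP (implyP (lB i) id)) eqxx in li.
  by have /matrixP/(_ ord0 i) := redr'; rewrite [LHS]mxE => ->.
rewrite negb_imply => /andP[jd lj].
exists (map_mx red (r' *m flag_diag K d)), (r' *m flag_diag K d); split=> //.
  by rewrite addr0.
by apply/rV0Pn; exists j; rewrite rD !mxE jd mulr1; have /matrixP/(_ ord0 j) := redr'; rewrite [LHS]mxE => ->.
Qed.


Lemma busemann_nbhd x g : vertex_rep x g -> exists n l, [/\ busemann x n, l != 0 &
  forall d W y, (d <= 3)%N -> W \in subspaces K d -> \val y (sub_lattice g W) ->
    busemann y (n + (3 - d)%N%:Z - (W \subset ker1 l)%:Z *+ 3)].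
Proof.
move=> xg; have [e ge] := has_val_ex (det_neq0 xg.1).
have [m [l gm]] := row_val_ex xg.1.
exists (e - m *+ 3), l; split; first by exists g, e, m, l.
  by case: gm => r [].
move=> d W y d3 /imsetP[B Bu ->] yB.
have [l' hm] := row_val_flag d Bu gm.
exists (flag_mx g B d), (e + (3 - d)%N%:Z), (m + (flag_space B d \subset ker1 l)%:Z), l'.
split; [exact: sub_lattice_rep xg.1 Bu yB|exact: has_val_flag_mx d3 xg.1 Bu ge|exact: hm|lia].
Qed.

Variable R : realType.
Local Notation s := (Num.sqrt (q%:R : R)).

Definition busemann_index x : int := xget 0 [set n | busemann x n].

Lemma busemann_indexP x n : busemann x n -> busemann_index x = n.
Proof.
move=> xn; apply: (busemann_uniq (x := x)); last exact: xn.
rewrite /busemann_index.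
exact: (@xgetPex _ 0 [set n | busemann x n] (ex_intro _ n xn)).
Qed.

Definition busemann_weight x : R := s ^ (- busemann_index x).

Let q1 : 1 < (q%:R : R).
Proof. by rewrite -[1]/(1%:R) ltr_nat card_finNzRing_gt1. Qed.

Let s0 : 0 < s.
Proof. by rewrite sqrtr_gt0 (lt_trans ltr01). Qed.

Let s2 : s ^+ 2 = q%:R.
Proof. by rewrite sqr_sqrtr // ler0n. Qed.

Lemma busemann_weight_gt0 x : 0 < busemann_weight x.
Proof. by rewrite /busemann_weight exprz_gt0. Qed.

(** Of order [q^(3/2)], against the degree [q^2 + q + 1] of either Hecke operator. *)
Definition hecke_bound : R := q%:R + (q%:R + 1) * s.

(** A neighbour of dimension [d] has index larger by [3 - d], less 3 if its subspace lies in
    [ker1 l]. With [s = sqrt q], points contribute the factor [s^-2 ((q+1) s^3 + q^2)] and lines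
    [s^-1 (s^3 + q^2 + q)]; both equal [hecke_bound] because [s^2 = q]. *)
Lemma nbr_seq x d : (0 < d < 3)%N -> exists r : seq (vertex K),
  [/\ uniq r, forall y, colored_edge d%:R x y <-> y \in r
    & \sum_(y <- r) busemann_weight y <= hecke_bound * busemann_weight x].
Proof.
move=> d3; have [g xg] := vertex_repP x.
have [n [l [xn l0 nW]]] := busemann_nbhd xg.
have dle : (d <= 3)%N by case/andP: d3 => _ /ltnW.
have sN W : W \in subspaces K d -> W \in nbhd K.
  by case: d d3 {nW dle} => [|[|[|]]] // _ WN; rewrite inE WN ?orbT.
have [f fP] : {f : {set 'cV[K]_3} -> vertex K &
    forall W, W \in subspaces K d -> \val (f W) (sub_lattice g W)}.
  apply: (@choice _ _ (fun W y => W \in subspaces K d -> \val y (sub_lattice g W))) => W.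
  have [/sN WN|_] := boolP (W \in subspaces K d); last by exists x.
  by have [y yW] := nbhd_rep xg.1 WN; exists y.
exists [seq f W | W <- enum (subspaces K d)]; split.
- rewrite map_inj_in_uniq ?enum_uniq // => W W'; rewrite !mem_enum => Ws W's E.
  apply: (nbhd_inj xg (sN _ Ws) (sN _ W's) (fP _ Ws)).
  by rewrite E; apply: fP.
- move=> y; split=> [/(colored_edgeP _ xg d3)[W Ws yW]|/mapP[W]].
    apply/mapP; exists W; rewrite ?mem_enum //.
    exact: vertex_mem_inj yW (fP _ Ws).
  rewrite mem_enum => Ws ->; apply/(colored_edgeP _ xg d3); exists W => //; exact: fP.
rewrite big_map big_enum /=.
pose w0 : R := s ^ (- n).
have w0E : busemann_weight x = w0 by rewrite /busemann_weight (busemann_indexP xn).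
have wE W : W \in subspaces K d -> busemann_weight (f W) =
    w0 * s ^- (3 - d) * (if W \subset ker1 l then s ^+ 3 else 1).
  move=> Ws; rewrite /busemann_weight (busemann_indexP (nW _ _ _ dle Ws (fP _ Ws))).
  rewrite opprB opprD addrA addrAC expfzDr ?gt_eqF // expfzDr ?gt_eqF // -/w0 exprnN.
  rewrite mulrC [_ * s ^ (- _)]mulrC mulrA; congr (_ * _).
  by case: ifP => _; rewrite ?mul0rn ?expr0z // exprnP.
rewrite w0E (eq_bigr _ wE) -mulr_sumr -[X in X <= _]mulrA mulrC.
rewrite ler_pM2r; last by rewrite exprz_gt0.
rewrite (bigID (fun W : {set 'cV[K]_3} => W \subset ker1 l)) /=.
have -> : \sum_(W in subspaces K d | W \subset ker1 l) (if W \subset ker1 l then s ^+ 3 else 1)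
   = #|[set W in subspaces K d | W \subset ker1 l]|%:R * s ^+ 3.
  under eq_bigr => W /andP[_ ->] do [].
  by rewrite sumr_const cardsE mulr_natl.
have -> : \sum_(W in subspaces K d | ~~ (W \subset ker1 l)) (if W \subset ker1 l then s ^+ 3 else 1)
   = #|subspaces K d|%:R - #|[set W in subspaces K d | W \subset ker1 l]|%:R.
  under eq_bigr => W /andP[_ /negPf->] do [].
  rewrite sumr_const; apply/eqP; rewrite eq_sym subr_eq -natrD; apply/eqP; congr (_%:R).
  rewrite addnC -(cardsID [set W : {set 'cV[K]_3} | W \subset ker1 l] (subspaces K d)).
  by congr (_ + _)%N; apply: eq_card => W; rewrite !inE // andbC.
have kl : ker1 l \in subspaces K 2 by apply/subspaces2P; exists l.
have s1 : s != 0 by rewrite gt_eqF.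
case: d d3 {dle sN fP nW wE f} => [|[|[|]]] // _.
  rewrite card_subspaces1 (card_subspaces1_in kl) !natrD !natrX /hecke_bound.
  have aux (S Q : R) : S ^+ 2 = Q -> S != 0 ->
      S ^- 2 * ((Q + 1) * S ^+ 3 + (Q ^+ 2 + Q + 1 - (Q + 1))) = Q + (Q + 1) * S.
    by move=> <- S0; field.
  by rewrite -(aux _ _ s2 s1).
have -> : #|[set W in subspaces K 2 | W \subset ker1 l]| = 1%N.
  apply/eqP/cards1P; exists (ker1 l); apply/setP => W; rewrite !inE.
  apply/andP/eqP => [[W2 Wl]|->]; last by rewrite kl fintype.subxx.
  by apply/eqP; rewrite finset.eqEcard Wl (card_subspace2 W2) (card_subspace2 kl) leqnn.
rewrite card_subspaces2 !natrD !natrX /hecke_bound.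
have aux (S Q : R) : S ^+ 2 = Q -> S != 0 ->
    S ^- 1 * (1 * S ^+ 3 + (Q ^+ 2 + Q + 1 - 1)) = Q + (Q + 1) * S.
  by move=> <- S0; field.
by rewrite -(aux _ _ s2 s1).
Qed.

(** Edges of colour 2 are the reversed edges of colour 1, so the neighbours of colour 2 serve as the
    in-neighbours in Schur's test for [A_1]. *)
Lemma joint_spectrum_bound (l1 l2 : R[i]) : joint_spectrum (@colored_edge K) l1 l2 ->
  Normc.normc l1 ^+ 2 <= 2 * hecke_bound ^+ 2.
Proof.
move=> js.
have [nb nbP] := @choice _ _ _ (fun x => @nbr_seq x 1 isT).
have [nb' nb'P] := @choice _ _ _ (fun x => @nbr_seq x 2 isT).
apply: (@schur_approx_eigenvalue R (vertex K) (@colored_edge K 1) nb nb' busemann_weight hecke_bound).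
- by move=> x; case: (nbP x).
- by move=> x; case: (nb'P x).
- by move=> x y; case: (nbP x).
- move=> x y; case: (nb'P y) => _ h _; apply: iff_trans (h x); exact: colored_edge_sym.
- exact: busemann_weight_gt0.
- by move=> x; case: (nbP x).
- by move=> x; case: (nb'P x).
by move=> e /js[f [f1 fe _]]; exists f.
Qed.

End Busemann.

(** * Quotients *)

Section Action.
Variable K : finFieldType.
Implicit Types (x y z : vertex K).

Lemma moves_linked (g : 'M[laurent K]_3) x x' y y' : g \in unitmx ->
  moves_to g x x' -> moves_to g y y' -> linked x y -> linked x' y'.
Proof.
move=> gu gx gy; have [h xh] := vertex_repP x.
move/(linkedP _ xh) => [W WN yW]; apply/(linkedP _ (moves_rep gu gx xh)).
by exists W => //; rewrite -act_sub_lattice; apply: moves_mem gy yW.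
Qed.

Lemma moves_triangle (g : 'M[laurent K]_3) x x' y y' z z' : g \in unitmx ->
  moves_to g x x' -> moves_to g y y' -> moves_to g z z' -> triangle x y z -> triangle x' y' z'.
Proof.
move=> gu gx gy gz; have [h xh] := vertex_repP x.
move/(triangleP _ _ xh) => [U [W [U1 W2 UW zU yW]]]; apply/(triangleP _ _ (moves_rep gu gx xh)).
by exists U, W; split=> //; rewrite -act_sub_lattice; [apply: moves_mem gz zU|apply: moves_mem gy yW].
Qed.

Lemma moves_colored_edge (g : 'M[laurent K]_3) x x' y y' d : g \in unitmx -> (0 < d < 3)%N ->
  moves_to g x x' -> moves_to g y y' -> colored_edge d%:R x y -> colored_edge d%:R x' y'.
Proof.
move=> gu d3 gx gy; have [h xh] := vertex_repP x.
move/(colored_edgeP _ xh d3) => [W WN yW]; apply/(colored_edgeP _ (moves_rep gu gx xh) d3).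
by exists W => //; rewrite -act_sub_lattice; apply: moves_mem gy yW.
Qed.

End Action.

Section Quotient.
Variables (K : finFieldType) (Gam : set 'M[laurent K]_3) (V : finType) (p : vertex K -> V).
Hypothesis Gam_sub : pgl_subgroup Gam.
Hypothesis Gam_disp : large_displacement Gam.
Hypothesis pq : is_quotient_map Gam p.
Local Notation X := (quotient_complex p).
Local Notation E := (quotient_edge p).
Implicit Types (x y z : vertex K) (u v w : V) (s : {set V}).

Let Gam_unit g : Gam g -> g \in unitmx.
Proof. by case: Gam_sub => GamGL _ _ _ /GamGL. Qed.

Let p_surj u : exists x, p x = u.
Proof. by case: pq => + _; apply. Qed.

Let p_orbit x y : p x = p y <-> exists2 g, Gam g & moves_to g x y.
Proof. by case: pq => _; apply. Qed.

(** The path through [x] has length 2, so an element of [Gam] that takes [y] to [z] must be a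
    scalar, and scalars fix every vertex. *)
Lemma dist_le2_inj x y z : linked x y -> linked x z -> p y = p z -> y = z.
Proof.
move=> xy xz /p_orbit[g Gg gyz].
have [sg|nsg] := pselect (scalars g); first by rewrite (scalars_moves sg gyz).
case: (Gam_disp Gg nsg gyz); exists [:: x; y] => //; split=> //=.
rewrite andbT; apply/andP; split; first by apply/adjacentE/linked_sym.
exact/adjacentE.
Qed.

Lemma linked_p_neq x y : linked x y -> p x <> p y.
Proof.
move=> xy /p_orbit[g Gg gxy].
have [sg|nsg] := pselect (scalars g); first by apply: (linked_neq xy); rewrite (scalars_moves sg gxy).
case: (Gam_disp Gg nsg gxy); exists [:: x] => //; split=> //=.
by rewrite andbT; apply/adjacentE/linked_sym.
Qed.

Lemma lift_edge x x' y d : (0 < d < 3)%N -> p x = p x' -> colored_edge d%:R x y ->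
  exists2 y', colored_edge d%:R x' y' & p y' = p y.
Proof.
move=> d3 /p_orbit[g Gg gx] xy; have gu := Gam_unit Gg.
have [y' gy] := moves_ex y gu; exists y'; first exact: moves_colored_edge gu d3 gx gy xy.
by apply/esym/p_orbit; exists g.
Qed.

Lemma lift_linked x x' y : p x = p x' -> linked x y ->
  exists2 y', linked x' y' & p y' = p y.
Proof.
move=> /p_orbit[g Gg gx] xy; have gu := Gam_unit Gg.
have [y' gy] := moves_ex y gu; exists y'; first exact: moves_linked gu gx gy xy.
by apply/esym/p_orbit; exists g.
Qed.

Lemma lift_triangle x x' y z : p x = p x' -> triangle x y z ->
  exists y' z', [/\ triangle x' y' z', p y' = p y & p z' = p z].
Proof.
move=> /p_orbit[g Gg gx] xyz; have gu := Gam_unit Gg.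
have [y' gy] := moves_ex y gu; have [z' gz] := moves_ex z gu; exists y', z'; split.
- exact: moves_triangle gu gx gy gz xyz.
- by apply/esym/p_orbit; exists g.
- by apply/esym/p_orbit; exists g.
Qed.

Lemma cells0P u : [set u]%SET \in X.
Proof.
have [x <-] := p_surj u; rewrite inE; apply/asboolP; exists 0%N, (fun=> x).
split; first exact: vertex_cell.
apply/setP => v; rewrite inE; apply/eqP/imsetP => [->|[k _ ->] //].
by exists ord0.
Qed.

(** The building cell behind [s] may have any dimension, as only its image is known; two of its
    indices with distinct images give the edge. *)
Lemma cells1P s : s \in cells X 1 <-> exists x y, linked x y /\ s = [set p x; p y]%SET.
Proof.
split=> [|[x [y [xy ->]]]]; last first.
  rewrite inE cards2 (introN eqP (linked_p_neq xy)) andbT inE; apply/asboolP.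
  exists 1%N, (fun i : 'I_2 => if i == ord0 then x else y); split; first exact: linked_cell.
  apply/setP => v; rewrite !inE; apply/orP/imsetP.
    by case=> /eqP->; [exists ord0|exists ord_max].
  by case=> k _ ->; case: ifP => _; [left|right].
rewrite inE => /andP[sX /cards2P[a [b [ab sab]]]].
have {sX} [i [x [xc sE]]] : exists i (x : 'I_i.+1 -> vertex K),
    building_cell x /\ s = [set p (x k) | k in 'I_i.+1]%SET.
  by move: sX; rewrite inE => /asboolP.
have /imsetP[k _ ak] : a \in [set p (x k) | k in 'I_i.+1]%SET by rewrite -sE sab !inE eqxx.
have /imsetP[l _ bl] : b \in [set p (x k) | k in 'I_i.+1]%SET by rewrite -sE sab !inE eqxx orbT.
exists (x k), (x l); split; last by rewrite -ak -bl.
have [kl|lk|kl] := ltngtP k l; first exact: cell_linked.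
  by apply: linked_sym; exact: cell_linked.
by move: ab; rewrite ak bl (val_inj kl) eqxx.
Qed.

(** As for edges, three indices with distinct images are selected; their order in the cell decides
    the order of the triangle. *)
Lemma cells2P s : s \in cells X 2 <-> exists x y z, triangle x y z /\ s = [set p x; p y; p z]%SET.
Proof.
split=> [|[x [y [z [xyz ->]]]]]; last first.
  have xy := linked_p_neq (triangle_linked xyz).
  have yz := linked_p_neq (triangle_linked (triangle_rot xyz)).
  have zx := linked_p_neq (triangle_linked (triangle_rot (triangle_rot xyz))).
  rewrite inE; apply/andP; split; last first.
    rewrite finset.setUC cardsU1 cards2 !inE (introN eqP xy) (introF eqP zx).
    by rewrite [p z == _]eq_sym (introF eqP yz).
  rewrite inE; apply/asboolP.
  exists 2%N, (fun i : 'I_3 => if i == ord0 then x else if i == ord_max then z else y).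
  split; first exact: triangle_cell.
  apply/setP => v; rewrite !inE; apply/idP/imsetP.
    case/orP=> [/orP[]|] /eqP->; first by exists ord0.
      by exists (Ordinal (isT : (1 < 3)%N)).
    by exists ord_max.
  by case=> k _ ->; case: ifP => _; rewrite ?eqxx //; case: ifP => _; rewrite eqxx ?orbT.
rewrite inE => /andP[sX /eqP s3].
have {sX} [i [x [xc sE]]] : exists i (x : 'I_i.+1 -> vertex K),
    building_cell x /\ s = [set p (x k) | k in 'I_i.+1]%SET.
  by move: sX; rewrite inE => /asboolP.
have [a as_] : exists a, a \in s by apply/set0Pn; rewrite -card_gt0 s3.
have /cards2P[b [c [bc sbc]]] : #|s :\ a| == 2%N by rewrite -eqSS -s3 (cardsD1 a s) as_ add1n.
have bs : b \in s :\ a by rewrite sbc !inE eqxx.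
have cs : c \in s :\ a by rewrite sbc !inE eqxx orbT.
have {}sE' : s = [set a; b; c]%SET by rewrite -(finset.setD1K as_) sbc finset.setUA.
move: bs cs; rewrite !inE => /andP[ba bs] /andP[ca cs].
have /imsetP[k _ ak] : a \in [set p (x k) | k in 'I_i.+1]%SET by rewrite -sE.
have /imsetP[l _ bl] : b \in [set p (x k) | k in 'I_i.+1]%SET by rewrite -sE.
have /imsetP[m _ cm] : c \in [set p (x k) | k in 'I_i.+1]%SET by rewrite -sE.
rewrite sE' ak bl cm.
have kl : k != l by apply: contraNneq ba => kl; rewrite ak bl kl.
have km : k != m by apply: contraNneq ca => e; rewrite ak cm e.
have lm : l != m by apply: contraNneq bc => e; rewrite bl cm e.
have T (j1 j2 j3 : 'I_i.+1) : (j1 < j2)%N -> (j2 < j3)%N -> triangle (x j1) (x j2) (x j3).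
  by move=> *; exact: cell_triangle.
have [kl'|lk'|kl'] := ltngtP k l; last by move: kl; rewrite (val_inj kl') eqxx.
- have [lm'|ml'|lm'] := ltngtP l m; last by move: lm; rewrite (val_inj lm') eqxx.
    by exists (x k), (x l), (x m); split; first exact: T.
  have [km'|mk'|km'] := ltngtP k m; last by move: km; rewrite (val_inj km') eqxx.
    by exists (x k), (x m), (x l); split; [exact: T|by apply/setP => t; rewrite !inE; case: (t == p (x k)); case: (t == p (x l)); case: (t == p (x m))].
  by exists (x m), (x k), (x l); split; [exact: T|by apply/setP => t; rewrite !inE; case: (t == p (x k)); case: (t == p (x l)); case: (t == p (x m))].
- have [km'|mk'|km'] := ltngtP k m; last by move: km; rewrite (val_inj km') eqxx.
    by exists (x l), (x k), (x m); split; [exact: T|by apply/setP => t; rewrite !inE; case: (t == p (x k)); case: (t == p (x l)); case: (t == p (x m))].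
  have [lm'|ml'|lm'] := ltngtP l m; last by move: lm; rewrite (val_inj lm') eqxx.
    by exists (x l), (x m), (x k); split; [exact: T|by apply/setP => t; rewrite !inE; case: (t == p (x k)); case: (t == p (x l)); case: (t == p (x m))].
  by exists (x m), (x l), (x k); split; [exact: T|by apply/setP => t; rewrite !inE; case: (t == p (x k)); case: (t == p (x l)); case: (t == p (x m))].
Qed.

(* Displacement more than 2 makes [p] injective on stars, so a star of the
   quotient is that of the building: the subspaces of the residue space. *)
Lemma star_chart u : exists f : {set 'cV[K]_3} -> V,
  [/\ {in nbhd K &, injective f} /\ (forall W, W \in nbhd K -> f W != u),
      forall d v, (0 < d < 3)%N -> E d%:R u v <-> exists2 W, W \in subspaces K d & v = f W,
      forall s, s \in cells X 1 /\ u \in s <-> exists2 W, W \in nbhd K & s = [set u; f W]%SET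
    & forall s, s \in cells X 2 /\ u \in s <-> exists U W,
        [/\ U \in subspaces K 1, W \in subspaces K 2, U \subset W & s = [set u; f U; f W]%SET]].
Proof.
have [x xu] := p_surj u; have [g xg] := vertex_repP x.
have [F FP] : {F : {set 'cV[K]_3} -> vertex K &
    forall W, W \in nbhd K -> \val (F W) (sub_lattice g W)}.
  apply: (@choice _ _ (fun W y => W \in nbhd K -> \val y (sub_lattice g W))) => W.
  have [WN|_] := boolP (W \in nbhd K); last by exists x.
  by have [y yW] := nbhd_rep xg.1 WN; exists y.
have FE W y : W \in nbhd K -> \val y (sub_lattice g W) -> y = F W.
  by move=> WN yW; apply: vertex_mem_inj yW (FP _ WN).
have Fl W : W \in nbhd K -> linked x (F W).
  by move=> WN; apply/(linkedP _ xg); exists W => //; apply: FP.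
have s1N W : W \in subspaces K 1 -> W \in nbhd K by move=> W1; rewrite inE W1.
have s2N W : W \in subspaces K 2 -> W \in nbhd K by move=> W1; rewrite inE W1 orbT.
exists (p \o F); split; first split.
- move=> W W' WN W'N /= /(dist_le2_inj (Fl _ WN) (Fl _ W'N)) FF.
  by apply: (nbhd_inj xg WN W'N (FP _ WN)); rewrite FF; apply: FP.
- by move=> W WN; apply/eqP => E0; apply: (linked_p_neq (Fl _ WN)); rewrite xu -E0.
- move=> d v d3; have sN W : W \in subspaces K d -> W \in nbhd K.
    by case: d d3 => [|[|[|]]] // _; [apply: s1N|apply: s2N].
  split=> [[x' [y [x'u yv xy]]]|[W Ws ->]].
    have [y' xy' y'y] := lift_edge d3 (etrans x'u (esym xu)) xy.
    have [W Ws y'W] := (colored_edgeP _ xg d3).1 xy'.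
    by exists W => //=; rewrite -(FE _ _ (sN _ Ws) y'W) y'y.
  exists x, (F W); split=> //; apply/(colored_edgeP _ xg d3); exists W => //.
  exact/FP/sN.
- move=> s; split=> [[/cells1P[x' [y [xy ->]]]]|[W WN ->]]; last first.
    by split; [apply/cells1P; exists x, (F W); rewrite xu; split=> //; exact: Fl|rewrite !inE eqxx].
  have key a b : linked a b -> u = p a -> exists2 W, W \in nbhd K & [set p a; p b]%SET = [set u; p (F W)]%SET.
    move=> ab ua; have [b' xb' b'b] := lift_linked (etrans (esym ua) (esym xu)) ab.
    have [W WN b'W] := (linkedP _ xg).1 xb'.
    by exists W => //; rewrite -(FE _ _ WN b'W) b'b ua.
  rewrite !inE => /orP[] /eqP; first exact: key xy.
  by move/(key _ _ (linked_sym xy)) => [W WN WE]; exists W => //=; rewrite -WE finset.setUC.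
- move=> s; split=> [[/cells2P[x' [y [z [xyz ->]]]]]|[U [W [U1 W2 UW ->]]]]; last first.
    split; last by rewrite !inE eqxx.
    apply/cells2P; exists x, (F W), (F U); rewrite xu /=; split; last by rewrite finset.setUAC.
    by apply/(triangleP _ _ xg); exists U, W; split=> //; [apply/FP/s1N|apply/FP/s2N].
  have key a b c : triangle a b c -> u = p a -> exists U W,
      [/\ U \in subspaces K 1, W \in subspaces K 2, U \subset W
        & [set p a; p b; p c]%SET = [set u; p (F U); p (F W)]%SET].
    move=> abc ua; have [b' [c' [xbc b'b c'c]]] := lift_triangle (etrans (esym ua) (esym xu)) abc.
    have [U [W [U1 W2 UW cU bW]]] := (triangleP _ _ xg).1 xbc.
    exists U, W; split=> //.
    by rewrite -(FE _ _ (s1N _ U1) cU) -(FE _ _ (s2N _ W2) bW) b'b c'c ua finset.setUAC.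
  rewrite !inE => /orP[/orP[]|] /eqP; first exact: key xyz.
    move/(key _ _ _ (triangle_rot xyz)) => [U [W [? ? ? sE]]]; exists U, W; split=> //.
    by rewrite -sE; apply/setP => t; rewrite !inE -orbA orbC.
  move/(key _ _ _ (triangle_rot (triangle_rot xyz))) => [U [W [? ? ? sE]]]; exists U, W; split=> //.
  by rewrite -sE; apply/setP => t; rewrite !inE; case: (t == p x'); case: (t == p y); case: (t == p z).
Qed.

Lemma quotient_edge_sym u v : E 1 u v <-> E 2%:R v u.
Proof.
by split=> -[x [y [xu yv xy]]]; exists y, x; split=> //; apply/colored_edge_sym.
Qed.

(** Lift a path from [u] over [v] to [w] to a path [x, y, z] from a fixed [x], complete it to a
    diamond, and send [v] to the image of the opposite corner [y']. This map is injective when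
    [u != w]. *)
Lemma quotient_diamond u w : u != w ->
  (#|[set v | `[< E 1%R u v >] && `[< E 2%:R%R v w >]]%SET| <=
   #|[set v | `[< E 2%:R%R u v >] && `[< E 1%R v w >]]%SET|)%N.
Proof.
move=> uw; have [x xu] := p_surj u.
(* The triple [t] is [(y, z, y')]: the middle and the end of the lifted path, and the opposite
   corner. *)
pose good v (t : vertex K * vertex K * vertex K) :=
  [/\ colored_edge 1 x t.1.1, p t.1.1 = v & colored_edge 2%:R t.1.1 t.1.2] /\
  [/\ p t.1.2 = w, colored_edge 2%:R x t.2 & colored_edge 1 t.2 t.1.2].
have [h hP] : {h : V -> vertex K * vertex K * vertex K &
    forall v, E 1 u v /\ E 2%:R v w -> good v (h v)}.
  apply: (@choice _ _ (fun v t => E 1 u v /\ E 2%:R v w -> good v t)) => v.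
  have [[[x0 [y0 [x0u y0v xy0]]] [y1 [z1 [y1v z1w yz1]]]]|nE] := pselect (E 1 u v /\ E 2%:R v w); last first.
    by exists (x, x, x).
  have [y xy yv] := @lift_edge _ x _ 1 isT (etrans x0u (esym xu)) xy0.
  have [z yz zw] := @lift_edge _ y _ 2 isT (etrans y1v (esym (etrans yv y0v))) yz1.
  have [y' xy' y'z] := diamond_ex xy yz.
  by exists (y, z, y') => _; split; split=> //=; rewrite ?yv ?zw.
have lk c (a b : vertex K) : colored_edge c a b -> linked a b by case=> /adjacentE.
rewrite -(card_in_imset (f := fun v => p (h v).2)).
  apply/subset_leq_card/fintype.subsetP => _ /imsetP[v + ->].
  rewrite !inE => /andP[/asboolP uv /asboolP vw].
  have [_ [hw xh hz]] := hP v (conj uv vw).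
  apply/andP; split; apply/asboolP; first by exists x, (h v).2.
  by exists (h v).2, (h v).1.2.
move=> v v'; rewrite !inE => /andP[/asboolP uv /asboolP vw] /andP[/asboolP uv' /asboolP vw'].
have [[xy yv yz] [zw xy' y'z]] := hP v (conj uv vw).
have [[xy2 yv2 yz2] [zw2 xy'2 y'z2]] := hP v' (conj uv' vw').
move=> /= E0; have yy := dist_le2_inj (lk _ _ _ xy') (lk _ _ _ xy'2) E0.
rewrite -yy in y'z2.
have zz := dist_le2_inj (lk _ _ _ y'z) (lk _ _ _ y'z2) (etrans zw (esym zw2)).
rewrite -zz in yz2.
(* The corner [y'] has determined [z]. Two different middles between [x] and [z] would force
   [x = z], against [u != w]. *)
have [yE|yN] := pselect ((h v).1.1 = (h v').1.1); first by rewrite -yv yE.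
have xz := diamond_uniq xy xy2 yz yz2 yN.
by move: uw; rewrite -xu xz zw eqxx.
Qed.

End Quotient.

Local Close Scope classical_set_scope.

(** * Expander mixing *)

Section Mixing.
Variables (R : realType) (V : finType) (E1 E2 : V -> V -> Prop) (e : rel V) (d : nat) (Lam : R).
Local Notation C := (R[i]%type).
Local Notation N := #|V|.
Hypothesis e1P : forall u v, E1 u v <-> e u v.
Hypothesis e2P : forall u v, E2 u v <-> e v u.
Hypothesis outdeg : forall u, #|[set v | e u v]| = d.
Hypothesis indeg : forall v, #|[set u | e u v]| = d.
Hypothesis normal : forall u w,
  #|[set v | e u v && e w v]| = #|[set v | e v u && e v w]|.
Hypothesis Lam0 : 0 <= Lam.
Hypothesis gap : forall (f : V -> C) (l1 l2 : C), (exists x, f x != 0) -> \sum_x f x = 0 ->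
  (forall x, hecke E1 f x = l1 * f x) -> (forall x, hecke E2 f x = l2 * f x) ->
  Normc.normc l1 <= Lam.

Local Notation ev := (@enum_val V predT).
Local Notation "M ^*T" := (map_mx Num.conj M^T) (at level 8, format "M ^*T").

Let sum_ev (F : V -> C) : \sum_(i < N) F (ev i) = \sum_v F v.
Proof.
rewrite [RHS](reindex (fun i : 'I_N => ev i)) //.
by exists enum_rank => i _; [exact: enum_valK|exact: enum_rankK].
Qed.

Let A : 'M[C]_N := \matrix_(i, j) (e (ev i) (ev j))%:R.
Let J : 'M[C]_N := const_mx 1.
Let c : C := d%:R / N%:R.
(** [A] without its action on constants: with [c = d/N], [B] kills the constants and agrees with [A]
    on functions of sum 0. *)
Let B : 'M[C]_N := A - c *: J.

Let AJ : A *m J = d%:R *: J.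
Proof.
apply/matrixP => i j; rewrite !mxE mulr1.
under eq_bigr => k _ do rewrite !mxE mulr1.
rewrite (sum_ev (fun v => (e (ev i) v)%:R)) -(outdeg (ev i)) -sum1_card natr_sum.
by rewrite [RHS]big_mkcond; apply: eq_bigr => v _; rewrite inE; case: (e _ _).
Qed.

Let JA : J *m A = d%:R *: J.
Proof.
apply/matrixP => i j; rewrite !mxE mulr1.
under eq_bigr => k _ do rewrite !mxE mul1r.
rewrite (sum_ev (fun v => (e v (ev j))%:R)) -(indeg (ev j)) -sum1_card natr_sum.
by rewrite [RHS]big_mkcond; apply: eq_bigr => v _; rewrite inE; case: (e _ _).
Qed.

Let JT : J^T = J.
Proof. by apply/matrixP => i j; rewrite !mxE. Qed.

Let AJT : A^T *m J = d%:R *: J.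
Proof. by rewrite -{1}JT -trmx_mul JA linearZ /= JT. Qed.

Let JAT : J *m A^T = d%:R *: J.
Proof. by rewrite -{1}JT -trmx_mul AJ linearZ /= JT. Qed.

Let AAT : A *m A^T = A^T *m A.
Proof.
apply/matrixP => i j; rewrite !mxE.
under eq_bigr => k _ do rewrite !mxE -natrM mulnb.
under [RHS]eq_bigr => k _ do rewrite !mxE -natrM mulnb.
rewrite (sum_ev (fun v => (e (ev i) v && e (ev j) v)%:R)).
rewrite (sum_ev (fun v => (e v (ev i) && e v (ev j))%:R)).
have cnt (P : pred V) : \sum_v (P v)%:R = #|[set v | P v]|%:R :> C.
  rewrite -sum1_card natr_sum [RHS]big_mkcond; apply: eq_bigr => v _.
  by rewrite inE; case: (P v).
by rewrite (cnt (fun v => e (ev i) v && e (ev j) v)) (cnt (fun v => e v (ev i) && e v (ev j))) normal.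
Qed.

Let cconj : c^* = c.
Proof. by rewrite /c rmorphM fmorphV !rmorph_nat. Qed.

Let Bconj : B^*T = A^T - c *: J.
Proof.
apply/matrixP => i j; rewrite !mxE rmorphB rmorphM rmorph1 rmorph_nat.
by congr (_ - _ * _); exact: cconj.
Qed.

Let Bnormal : B \is normalmx.
Proof.
apply/normalmxP; rewrite Bconj /B !mulmxBr !mulmxBl -!scalemxAl -!scalemxAr.
by rewrite AJ JA AJT JAT AAT.
Qed.

Let P := spectralmx B.
Let D := spectral_diag B.
Let Pu : P \is unitarymx := spectral_unitarymx B.
Let BE : B = P^*T *m diag_mx D *m P.
Proof.
have /orthomx_spectralP := Bnormal; rewrite -/P -/D invmx_unitary //.
Qed.

Let PPT : P *m P^*T = 1%:M.
Proof. exact/unitarymxP. Qed.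

Let trC_mul m n p (M : 'M[C]_(m, n)) (M' : 'M[C]_(n, p)) : (M *m M')^*T = M'^*T *m M^*T.
Proof. by rewrite trmx_mul map_mxM. Qed.

Let trCK m n (M : 'M[C]_(m, n)) : M^*T^*T = M.
Proof. by apply/matrixP => i j; rewrite !mxE conjCK. Qed.

Let PB : P *m B = diag_mx D *m P.
Proof. by rewrite BE !mulmxA PPT mul1mx. Qed.

Let PBT : P *m B^*T = (diag_mx D)^*T *m P.
Proof. by rewrite BE !trC_mul trCK !mulmxA PPT mul1mx. Qed.

Let dN0 (i : 'I_N) : N%:R != 0 :> C.
Proof. by rewrite pnatr_eq0 -lt0n; apply: leq_ltn_trans (ltn_ord i). Qed.

Let JJ : J *m J = N%:R *: J.
Proof.
apply/matrixP => i j; rewrite !mxE mulr1.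
by under eq_bigr => k _ do rewrite !mxE mulr1; rewrite sumr_const card_ord.
Qed.

Let BJ : B *m J = 0.
Proof.
apply/matrixP => i j; rewrite mulmxBl AJ -scalemxAl JJ scalerA /c divfK ?(dN0 i) //.
by rewrite subrr.
Qed.

Let eigen_bound (i : 'I_N) : Normc.normc (D ord0 i) <= Lam.
Proof.
have [->|Di0] := eqVneq (D ord0 i) 0; first by rewrite Normc.normc0.
pose r := row i P.
have rB : r *m B = D ord0 i *: r.
  by rewrite -row_mul PB row_mul row_diag_mx -scalemxAl -rowE.
have rBT : r *m B^*T = (D ord0 i)^* *: r.
  rewrite -row_mul PBT row_mul; apply/matrixP => a b; rewrite !mxE (bigD1 i) //= big1 => [|k ki].
    by rewrite !mxE eqxx mulr1n addr0.
  by rewrite !mxE (negPf ki) mulr0n rmorph0 mul0r.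
(* Since [B] kills constants, an eigenvector with nonzero eigenvalue has sum 0, as the hypothesis
   [gap] demands. *)
have rJ : r *m J = 0.
  apply: (scalerI Di0); rewrite scalemxAl -rB -mulmxA BJ mulmx0 scaler0 //.
have rA : r *m A = D ord0 i *: r.
  by rewrite -rB /B mulmxBr -scalemxAr rJ scaler0 subr0.
have rAT : r *m A^T = (D ord0 i)^* *: r.
  by rewrite -rBT Bconj mulmxBr -scalemxAr rJ scaler0 subr0.
pose f v := r ord0 (enum_rank v).
have fev k : f (ev k) = r ord0 k by rewrite /f enum_valK.
have nD : Normc.normc (D ord0 i) = Normc.normc (D ord0 i)^*.
  by case: (D ord0 i) => a b /=; rewrite sqrrN.
(* A row vector times [A] sums over in-neighbours, which is the operator of [E2]. So the eigenvalue
   for [E1] is the conjugate of [D ord0 i], of the same modulus. *)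
rewrite nD; apply: (@gap f _ (D ord0 i)).
- have r0 : r != 0.
    apply: contraTneq (oner_neq0 C) => r0.
    have := congr1 (fun M : 'M[C]_N => M i i) PPT; rewrite !mxE eqxx mulr1n => <-.
    by rewrite big1 ?eqxx // => k _; have /matrixP/(_ ord0 k) := r0; rewrite !mxE => ->; rewrite mul0r.
  by have /rV0Pn[k rk] := r0; exists (ev k); rewrite fev.
- rewrite -sum_ev; transitivity ((r *m J) ord0 i); last by rewrite rJ mxE.
  by rewrite [RHS]mxE; apply: eq_bigr => k _; rewrite fev [J _ _]mxE mulr1.
- move=> u; rewrite (@hecke_seq R V E1 (fun u => enum (e u))); first last.
  + by move=> x y; rewrite mem_enum; apply: e1P.
  + by move=> x; apply: enum_uniq.
  rewrite big_enum /= big_mkcond -sum_ev -(enum_rankK u) fev.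
  have /matrixP/(_ ord0 (enum_rank u)) := rAT; rewrite [in X in _ = X -> _]mxE => <-.
  rewrite mxE; apply: eq_bigr => k _; rewrite fev ![A^T _ _]mxE [A _ _]mxE !enum_rankK.
  by rewrite -[_ \in _]/(e _ _); case: (e _ _); rewrite ?mulr1 ?mulr0.
- move=> u; rewrite (@hecke_seq R V E2 (fun u => enum (e^~ u))); first last.
  + by move=> x y; rewrite mem_enum; apply: e2P.
  + by move=> x; apply: enum_uniq.
  rewrite big_enum /= big_mkcond -sum_ev -(enum_rankK u) fev.
  have /matrixP/(_ ord0 (enum_rank u)) := rA; rewrite [in X in _ = X -> _]mxE => <-.
  rewrite mxE; apply: eq_bigr => k _; rewrite fev [A _ _]mxE !enum_rankK.
  by rewrite -[_ \in _]/(e _ _); case: (e _ _); rewrite ?mulr1 ?mulr0.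
Qed.

(** Evaluate the quadratic form of [B] at the indicator of [S] in a unitary eigenbasis; the
    subtracted multiple of [J] contributes the main term. *)
Lemma expander_mixing (S : {set V}) :
  (\sum_(u in S) \sum_(v in S) (e u v)%:R : R) <= d%:R * #|S|%:R ^+ 2 / N%:R + Lam * #|S|%:R.
Proof.
pose chi : 'rV[C]_N := \row_i (ev i \in S)%:R.
have chiC : chi^*T = chi^T by apply/matrixP => i j; rewrite !mxE rmorph_nat.
have chi2 : (chi *m chi^T) ord0 ord0 = #|S|%:R.
  rewrite mxE; under eq_bigr => k _ do rewrite !mxE -natrM mulnb andbb.
  rewrite (sum_ev (fun v => (v \in S)%:R)) -sum1_card natr_sum [RHS]big_mkcond.
  by apply: eq_bigr => v _; case: (v \in S).
have chiJ : (chi *m J *m chi^T) ord0 ord0 = #|S|%:R ^+ 2.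
  have -> : J = const_mx 1 *m (const_mx 1 : 'rV_N).
    by apply/matrixP => i j; rewrite !mxE big_ord1 !mxE mulr1.
  rewrite mulmxA -mulmxA mxE big_ord1 expr2.
  have cnt : \sum_(k < N) (ev k \in S)%:R = #|S|%:R :> C.
    rewrite (sum_ev (fun v => (v \in S)%:R)) -sum1_card natr_sum [RHS]big_mkcond.
    by apply: eq_bigr => v _; case: (v \in S).
  by congr (_ * _); rewrite mxE -cnt; apply: eq_bigr => k _; rewrite !mxE ?mulr1 ?mul1r.
set e_S : R := \sum_(u in S) _.
have chiA : (chi *m A *m chi^T) ord0 ord0 = e_S%:C%C.
  rewrite -mulmxA mxE /e_S.
  under eq_bigr => k _ do rewrite !mxE mulr_sumr.
  under eq_bigr => k _ do under eq_bigr => j _ do rewrite !mxE.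
  under eq_bigr => k _ do rewrite (sum_ev (fun v => (ev k \in S)%:R * ((e (ev k) v)%:R * (v \in S)%:R))).
  rewrite (sum_ev (fun u => \sum_v (u \in S)%:R * ((e u v)%:R * (v \in S)%:R))).
  rewrite raddf_sum [RHS]big_mkcond; apply: eq_bigr => u _.
  case: (u \in S); last by rewrite big1 // => v _; rewrite mul0r.
  rewrite raddf_sum [RHS]big_mkcond; apply: eq_bigr => v _.
  by case: (v \in S); rewrite ?mulr0 // mul1r mulr1; case: (e u v).
pose y := chi *m P^*T.
have yE : y^*T = P *m chi^T by rewrite /y trC_mul trCK chiC.
have chiB : (chi *m B *m chi^T) ord0 ord0 = \sum_i D ord0 i * (y ord0 i * (y ord0 i)^*).
  rewrite BE !mulmxA -/y -mulmxA -yE mul_mx_diag mxE; apply: eq_bigr => i _.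
  by rewrite !mxE -mulrA mulrCA.
have y2 : \sum_i y ord0 i * (y ord0 i)^* = #|S|%:R.
  have PTP : P^*T *m P = 1%:M by apply: mulmx1C.
  have yy : y *m y^*T = chi *m chi^T by rewrite yE /y -mulmxA (mulmxA P^*T) PTP mul1mx.
  rewrite -chi2 -yy mxE.
  by apply: eq_bigr => i _; rewrite !mxE.
have : `|(chi *m B *m chi^T) ord0 ord0| <= (Lam * #|S|%:R)%:C%C.
  rewrite chiB rmorphM rmorph_nat -y2 mulr_sumr; apply: (le_trans (ler_norm_sum _ _ _)).
  apply: ler_sum => i _; rewrite normrM [`|_ * _^*|]ger0_norm ?mul_conjC_ge0 //.
  apply: ler_wpM2r; first exact: mul_conjC_ge0.
  have -> : `|D ord0 i| = (Normc.normc (D ord0 i))%:C%C by [].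
  by rewrite lecR; apply: eigen_bound.
have -> : (chi *m B *m chi^T) ord0 ord0 = (e_S - d%:R / N%:R * #|S|%:R ^+ 2)%:C%C.
  have subE (M M' : 'M[C]_1) : (M - c *: M') ord0 ord0 = M ord0 ord0 - c * M' ord0 ord0.
    by rewrite !mxE.
  rewrite /B mulmxBr mulmxBl -scalemxAr -scalemxAl subE chiA chiJ.
  by rewrite rmorphB 2!rmorphM fmorphV rmorphXn !rmorph_nat.
rewrite normc_def /= expr0n addr0 sqrtr_sqr lecR => /(le_trans (ler_norm _)).
rewrite lerBlDl => /le_trans -> //; apply/lerD => //.
by rewrite mulrAC.
Qed.

End Mixing.

(* Gives the finite-set lemmas precedence over their namesakes on [set]. *)
From mathcomp Require Import fintype finset.

(** * Cochains *)

Lemma sum_card (R : pzSemiRingType) (T : finType) (P : pred T) :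
  \sum_(x | P x) 1 = #|P|%:R :> R.
Proof. by rewrite sumr_const. Qed.

Lemma sum_pred_card (R : pzSemiRingType) (T : finType) (P Q : pred T) :
  \sum_(x | P x) (Q x)%:R = #|[pred x | P x && Q x]|%:R :> R.
Proof.
rewrite -sum_card [RHS]big_mkcondr; apply: eq_bigr => x _.
by case: (Q x).
Qed.

(** * Spectral gap of a point-line incidence graph *)

Section Crossing.
Variables (R : rcfType) (T : finType) (P L : {set T}) (I : rel T) (q : nat).
Let k := q.+1.
Let n := (q ^ 2 + q + 1)%N.
Hypothesis cardL : #|L| = n.
Hypothesis degP : forall x, x \in P -> #|[set y in L | I x y]| = k.
Hypothesis degL : forall y, y \in L -> #|[set x in P | I x y]| = k.
Hypothesis codeg : forall x x', x \in P -> x' \in P -> x != x' ->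
  (#|[set y in L | I x y && I x' y]| <= 1)%N.

Variable A : {set T}.
Let al x : R := (x \in A)%:R.
Let a : R := \sum_(x in P) al x.
Let b : R := \sum_(y in L) al y.
Let f y : R := \sum_(x in P) al x * (I x y)%:R.

Let alal x : al x * al x = al x.
Proof. by rewrite /al; case: (x \in A); rewrite ?mulr1 ?mulr0. Qed.

Let degPR x : x \in P -> \sum_(y in L) (I x y)%:R = k%:R :> R.
Proof. by move=> xP; rewrite sum_pred_card -(degP xP) cardsE. Qed.

Let degLR y : y \in L -> \sum_(x in P) (I x y)%:R = k%:R :> R.
Proof. by move=> yL; rewrite sum_pred_card -(degL yL) cardsE. Qed.

Let sum_f : \sum_(y in L) f y = k%:R * a.
Proof.
rewrite exchange_big mulr_sumr; apply: eq_bigr => x xP.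
by rewrite -mulr_sumr degPR // mulrC.
Qed.

(** The square counts pairs of points of [A] on a common line: a point lies on [q + 1] lines, and
    two distinct points on at most one. *)
Let sum_f2 : \sum_(y in L) f y ^+ 2 <= a ^+ 2 + q%:R * a.
Proof.
have -> : \sum_(y in L) f y ^+ 2 =
    \sum_(x in P) \sum_(x' in P) al x * al x' * \sum_(y in L) (I x y && I x' y)%:R.
  under [RHS]eq_bigr => x _ do under eq_bigr => x' _ do rewrite mulr_sumr.
  under [RHS]eq_bigr => x _ do rewrite exchange_big /=.
  rewrite [RHS]exchange_big /=; apply: eq_bigr => y _.
  rewrite expr2 mulr_suml; apply: eq_bigr => x _.
  rewrite mulr_sumr; apply: eq_bigr => x' _.
  by rewrite mulrACA -[(I x y)%:R * _]natrM mulnb.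
have -> : a ^+ 2 + q%:R * a = \sum_(x in P) \sum_(x' in P) al x * al x' * (1 + (x == x')%:R * q%:R).
  rewrite expr2 mulr_suml mulr_sumr -big_split; apply: eq_bigr => x xP.
  under [RHS]eq_bigr => x' _ do rewrite mulrDr mulr1.
  rewrite big_split /= -mulr_sumr; congr (_ + _).
  rewrite (bigD1 x) //= big1 => [|x' /andP[_ xx']]; last by rewrite eq_sym (negPf xx') mul0r mulr0.
  by rewrite eqxx mul1r addr0 alal mulrC.
apply: ler_sum => x xP; apply: ler_sum => x' x'P.
apply: ler_wpM2l; first by rewrite mulr_ge0 ?ler0n.
rewrite sum_pred_card; have [<-|xx'] := eqVneq x x'.
  rewrite mul1r -[1]/(1%:R) -natrD add1n -/k ler_nat -(degP xP) cardsE.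
  by apply/eq_leq/eq_card => y; rewrite !inE andbb.
by rewrite mul0r addr0 -[1]/(1%:R) ler_nat -cardsE; apply: codeg.
Qed.

Let nE : n%:R = q%:R ^+ 2 + q%:R + 1 :> R.
Proof. by rewrite /n !natrD natrX. Qed.

Let n0 : 0 < n%:R :> R.
Proof. by rewrite ltr0n /n addn1. Qed.

Let q0 : 0 <= q%:R :> R.
Proof. exact: ler0n. Qed.

Let a0 : 0 <= a.
Proof. by apply: sumr_ge0 => x _; rewrite ler0n. Qed.

(** Subtracting the mean from the second moment leaves [a^2 (1 - k^2/n) + q a], and
    [(q+1)^2 >= q^2 + q + 1]. *)
Let variance : \sum_(y in L) (f y - k%:R * a / n%:R) ^+ 2 <= q%:R * a.
Proof.
under eq_bigr => y _ do rewrite sqrrB.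
rewrite big_split sumrB /= sumr_const cardL -[(_ ^+ 2) *+ n]mulr_natl.
under [X in _ - X + _]eq_bigr => y _ do rewrite -mulr_natr -mulrA.
rewrite -mulr_suml sum_f.
have := sum_f2; have := nE; have := n0; have := q0.
rewrite /k -natr1; set N : R := n%:R; set Q : R := q%:R; set S := \sum_(y in L) _ => Q0 N0 NE Sle.
set c := (Q + 1) * a / N.
have cN : c * N = (Q + 1) * a by rewrite /c divfK ?gt_eqF.
have -> : S - (Q + 1) * a * (c * 2%:R) + N * c ^+ 2 = S - (c * N) * c.
  by rewrite -cN; ring.
suff : a ^+ 2 <= c * N * c by lra.
rewrite cN /c mulrA ler_pdivlMr //.
have -> : (Q + 1) * a * ((Q + 1) * a) = a ^+ 2 * (Q + 1) ^+ 2 by ring.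
by apply: ler_wpM2l; [exact: sqr_ge0|nra].
Qed.

(** There are [k (a + b)] minus twice the incidences inside [A] crossing pairs. These incidences are
    compared with their mean [k a b / n]: the variance bounds the deviation, and
    [4 a b <= (a + b)^2] the mean. *)
Lemma crossing_bound :
  let x : R := a + b in
  k%:R * x - k%:R * x ^+ 2 / (2%:R * n%:R) - Num.sqrt q%:R * x <=
  \sum_(x in P) \sum_(y in L) (I x y && ((x \in A) != (y \in A)))%:R.
Proof.
have -> : \sum_(x in P) \sum_(y in L) (I x y && ((x \in A) != (y \in A)))%:R
  = k%:R * (a + b) - 2%:R * \sum_(y in L) al y * f y :> R.
  have -> : k%:R * (a + b) = \sum_(x in P) \sum_(y in L) (al x + al y) * (I x y)%:R.
    under eq_bigr => x _ do under eq_bigr => y _ do rewrite mulrDl.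
    under eq_bigr => x _ do rewrite big_split /=.
    rewrite big_split /= mulrDr; congr (_ + _).
      rewrite mulr_sumr; apply: eq_bigr => x xP.
      by rewrite -mulr_sumr degPR // mulrC.
    rewrite exchange_big mulr_sumr; apply: eq_bigr => y yL.
    by rewrite -mulr_sumr degLR // mulrC.
  rewrite mulr_sumr; under [X in _ - X]eq_bigr => y _ do rewrite mulr_sumr mulr_sumr.
  rewrite [X in _ - X]exchange_big -sumrB; apply: eq_bigr => x _.
  rewrite -sumrB; apply: eq_bigr => y _ /=.
  rewrite /al; case: (I x y); case: (x \in A); case: (y \in A); rewrite ?eqxx /=; ring.
move=> /=; set x := a + b; set J := \sum_(y in L) al y * f y.
have := q0; have := n0; set s := Num.sqrt q%:R; set Q : R := q%:R; set N : R := n%:R => N0 Q0.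
have s0 : 0 <= s by rewrite sqrtr_ge0.
have s2 : s ^+ 2 = Q by rewrite sqr_sqrtr.
set c := k%:R * a / N.
have b0 : 0 <= b by apply: sumr_ge0 => y _; rewrite ler0n.
have Jle : 2%:R * J <= 2%:R * c * b + s * (a + b).
  (* The estimate below is obtained multiplied by [s]; for [s = 0] the variance vanishes and [f] is
     constant. *)
  have [sz|s_gt0] : s = 0 \/ 0 < s by rewrite lt0r s0 andbT; case: eqVneq; [left|right].
    have var0 : \sum_(y in L) (f y - c) ^+ 2 = 0.
      apply: le_anti; rewrite (le_trans variance) /=; last by rewrite -/Q -s2 sz expr0n mul0r.
      by apply: sumr_ge0 => y _; apply: sqr_ge0.
    have fc y : y \in L -> f y = c.
      move=> yL; apply/eqP; rewrite -subr_eq0 -sqrf_eq0; apply/eqP.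
      by apply: (psumr_eq0P _ var0) => // z _; apply: sqr_ge0.
    rewrite /J; under eq_bigr => y yL do rewrite fc //.
    by rewrite -mulr_suml sz mul0r addr0 -/b mulrCA mulrC mulrA.
  (* Sum [2 s (f y - c) <= s^2 + (f y - c)^2] over the lines in [A]. *)
  have : s * (2%:R * J - 2%:R * c * b) <= \sum_(y in L) (al y * Q + (f y - c) ^+ 2).
    rewrite [2%:R * c]mulrC -[c * _ * b]mulrA [c * _]mulrC /J /b.
    rewrite -mulrA mulr_suml -mulrBr -sumrB mulrA mulr_sumr; apply: ler_sum => y _.
    rewrite -s2; set z := f y.
    have -> : s * 2 * (al y * z - al y * c) = al y * (s * 2 * (z - c)) by ring.
    have : 0 <= (s - (z - c)) ^+ 2 by apply: sqr_ge0.
    have : 0 <= (z - c) ^+ 2 by apply: sqr_ge0.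
    rewrite /al; case: (y \in A); rewrite ?mul1r ?mul0r; lra.
  rewrite big_split /= -mulr_suml -/b => /le_trans/(_ (lerD (lexx _) variance)).
  rewrite -/Q -s2 => le1.
  have : s * (2 * J - 2 * c * b) <= s * (s * (a + b)) by move: le1; lra.
  by rewrite ler_pM2l //; lra.
have cN : c * N = k%:R * a by rewrite /c divfK ?gt_eqF.
have k0 : 0 <= k%:R :> R by rewrite ler0n.
have key : 2 * c * b <= k%:R * x ^+ 2 / (2 * N).
  rewrite ler_pdivlMr; last by rewrite mulr_gt0.
  have -> : 2 * c * b * (2 * N) = 4 * (c * N) * b by ring.
  rewrite cN -subr_ge0.
  have -> : k%:R * x ^+ 2 - 4 * (k%:R * a) * b = k%:R * (a - b) ^+ 2 by rewrite /x; ring.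
  by rewrite mulr_ge0 ?sqr_ge0.
by move: Jle key; rewrite -/x; lra.
Qed.

End Crossing.

(** * Cochains on a complex whose vertex stars are modelled on a projective plane *)

Section Combinatorics.
Variables (R : realType) (K : finFieldType) (V : finType) (X : {set {set V}}).
Variable f : V -> {set 'cV[K]_3} -> V.
Local Notation NB := (nbhd K).
Local Notation P := (subspaces K 1).
Local Notation L := (subspaces K 2).
Local Notation q := #|K|.
Local Notation k := (q.+1).
Local Notation n := (q ^ 2 + q + 1)%N.
Local Notation X1 := (cells X 1).
Local Notation X2 := (cells X 2).
Hypothesis f_inj : forall u, {in NB &, injective (f u)}.
Hypothesis f_neq : forall u W, W \in NB -> f u W != u.
Hypothesis X1P : forall u s, s \in X1 /\ u \in s <-> exists2 W, W \in NB & s = [set u; f u W].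
Hypothesis X2P : forall u s, s \in X2 /\ u \in s <-> exists U W,
  [/\ U \in P, W \in L, U \subset W & s = [set u; f u U; f u W]].
Implicit Types (u v : V) (s t : {set V}) (U W : {set 'cV[K]_3}).

Lemma point_nbhd U : U \in P -> U \in NB. Proof. by move=> UP; rewrite inE UP. Qed.
Lemma line_nbhd W : W \in L -> W \in NB. Proof. by move=> WL; rewrite inE WL orbT. Qed.
Hint Resolve point_nbhd line_nbhd : core.

Lemma point_line_neq U W : U \in P -> W \in L -> (U == W) = false.
Proof. by move=> UP WL; apply/eqP => E; apply: (subspaces12 UP); rewrite E. Qed.

Lemma card_over U : U \in P -> #|[set W in L | U \subset W]| = k.
Proof. by move=> UP; rewrite (card_subspaces2_over UP) addn1. Qed.

Lemma card_below W : W \in L -> #|[set U in P | U \subset W]| = k.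
Proof. by move=> WL; rewrite (card_subspaces1_in WL) addn1. Qed.

Lemma chart_eq u W W' : W \in NB -> W' \in NB -> (f u W == f u W') = (W == W').
Proof. by move=> WN W'N; apply/eqP/eqP => [/f_inj->|->]. Qed.

Lemma chart_neq u W : W \in NB -> (f u W == u) = false /\ (u == f u W) = false.
Proof. by move=> WN; rewrite [u == _]eq_sym (negPf (f_neq u WN)). Qed.

Lemma star_edges u (T : nmodType) (F : {set V} -> T) :
  \sum_(s in X1 | u \in s) F s = \sum_(W in NB) F [set u; f u W].
Proof.
rewrite -(big_imset F (h := fun W => [set u; f u W])) /=.
  apply: eq_bigl => s; apply/andP/imsetP => [/X1P[W WN ->]|[W WN ->]]; first by exists W.
  by apply/X1P; exists W.
move=> W W' WN W'N /setP/(_ (f u W)); rewrite !inE eqxx orbT (chart_neq _ WN).1 /=.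
by rewrite chart_eq // => /esym/eqP.
Qed.

Lemma star_triangles u (T : nmodType) (F : {set V} -> T) :
  \sum_(s in X2 | u \in s) F s =
  \sum_(U in P) \sum_(W in L | U \subset W) F [set u; f u U; f u W].
Proof.
pose D := [set x : {set 'cV[K]_3} * {set 'cV[K]_3} | (x.1 \in P) && ((x.2 \in L) && (x.1 \subset x.2))].
rewrite pair_big_dep /= (eq_bigl (mem D)); last by move=> x; rewrite !inE.
rewrite -(big_imset F (h := fun x => [set u; f u x.1; f u x.2])) /=.
  apply: eq_bigl => s; apply/andP/imsetP => [/X2P[U [W [UP WL UW ->]]]|[[U W]]].
    by exists (U, W); rewrite // inE /= UP WL UW.
  by rewrite inE /= => /and3P[UP WL UW] ->; apply/X2P; exists U, W.
move=> [U W] [U' W']; rewrite !inE /= => /and3P[UP WL _] /and3P[U'P W'L _] /setP E.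
have := E (f u U); have := E (f u W); rewrite !inE !eqxx !orbT.
rewrite (chart_neq _ (point_nbhd UP)).1 (chart_neq _ (line_nbhd WL)).1 /= !chart_eq; try exact: point_nbhd; try exact: line_nbhd.
rewrite (point_line_neq UP W'L) orbF [W == U']eq_sym (point_line_neq U'P WL) /=.
by move=> /esym/eqP-> /esym/eqP->.
Qed.

Lemma sum_cells_vertices i (T : nmodType) (F : {set V} -> T) :
  \sum_u \sum_(s in cells X i | u \in s) F s = \sum_(s in cells X i) F s *+ i.+1.
Proof.
under eq_bigr => u _ do rewrite big_mkcondr.
rewrite exchange_big /=; apply: eq_bigr => s; rewrite inE => /andP[_ /eqP <-].
by rewrite -big_mkcond sumr_const.
Qed.

Lemma card_X2 s : s \in X2 -> #|s| = 3%N.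
Proof. by rewrite inE => /andP[_ /eqP]. Qed.

Lemma card_X1 s : s \in X1 -> #|s| = 2%N.
Proof. by rewrite inE => /andP[_ /eqP]. Qed.

Lemma X2_face s x : s \in X2 -> x \in s -> s :\ x \in X1.
Proof.
move=> sX xs; have [u] : exists u, u \in s :\ x.
  by apply/set0Pn; rewrite -card_gt0; have := cardsD1 x s; rewrite xs (card_X2 sX); case: #|_|.
case/setD1P=> ux us; have [U [W [UP WL UW sE]]] := (X2P u s).1 (conj sX us).
have [UN WN] := (point_nbhd UP, line_nbhd WL).
have fUW : f u U != f u W by rewrite chart_eq // (point_line_neq UP WL).
have : (x == f u U) || (x == f u W) by move: xs; rewrite sE !inE eq_sym (negPf ux).
rewrite {1}sE => /orP[] /eqP ->.
  suff -> : [set u; f u U; f u W] :\ f u U = [set u; f u W] by apply: ((X1P u _).2 _).1; exists W.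
  apply/setP => t; rewrite !inE; have [->|tU] := eqVneq t (f u U); last by rewrite orbF.
  by rewrite (chart_neq _ UN).1 (negPf fUW).
suff -> : [set u; f u U; f u W] :\ f u W = [set u; f u U] by apply: ((X1P u _).2 _).1; exists U.
apply/setP => t; rewrite !inE; have [->|tU] := eqVneq t (f u W); last by rewrite orbF.
by rewrite (chart_neq _ WN).1 eq_sym (negPf fUW).
Qed.

(** An edge of a triangle is indexed by the opposite vertex. *)
Lemma X2_faces s (T : nmodType) (F : {set V} -> T) : s \in X2 ->
  \sum_(t in X1 | t \subset s) F t = \sum_(x in s) F (s :\ x).
Proof.
move=> sX; rewrite -(big_imset F (h := fun x => s :\ x)) /=; last first.
  move=> x y xs ys /setP/(_ x); by rewrite !inE eqxx xs /=; case: eqVneq.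
apply: eq_bigl => t; apply/andP/imsetP => [[tX ts]|[x xs ->]]; last first.
  by rewrite X2_face // subD1set.
have : #|s :\: t| == 1%N by rewrite cardsD (setIidPr ts) (card_X2 sX) (card_X1 tX).
case/cards1P=> x sx; exists x.
  have : x \in s :\: t by rewrite sx inE eqxx.
  by case/setDP.
rewrite -sx setDDr setDv set0U; exact/esym/setIidPr.
Qed.

Lemma coface_X2 s : s \in X2 -> coface_count 2 X s = 1%N.
Proof.
move=> sX; apply/eqP/cards1P; exists s; apply/setP => t; rewrite in_set1 in_set.
apply/andP/eqP => [[tX st]|->]; last by rewrite sX subxx.
by apply/esym/eqP; rewrite eqEcard st (card_X2 sX) (card_X2 tX).
Qed.

Lemma star_coface u W : W \in NB -> #|[set t in X2 | (u \in t) && (f u W \in t)]| = k.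
Proof.
move=> WN; rewrite -sum1_card (eq_bigl (fun t => [&& t \in X2, u \in t & f u W \in t])); last first.
  by move=> t; rewrite !inE.
under eq_bigl => t do rewrite andbA.
rewrite big_mkcondr (star_triangles u (fun t => if f u W \in t then 1%N else 0%N)).
have inE3 U W' : U \in P -> W' \in L ->
    (f u W \in [set u; f u U; f u W']) = (W == U) || (W == W').
  by move=> UP WL; rewrite !inE (chart_neq _ WN).1 /= !chart_eq; auto.
case/setUP: (WN) => WS.
  rewrite (bigD1 W) //= [X in _ + X]big1 ?addr0.
    rewrite -(card_over WS) -sum1_card; apply: eq_big => [W'|W' /andP[W'L _]].
      by rewrite inE.
    by rewrite inE3 // eqxx.
  move=> U /andP[UP UW]; apply: big1 => W' /andP[W'L _].
  by rewrite inE3 // eq_sym (negPf UW) (point_line_neq WS W'L).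
rewrite -(card_below WS) -sum1_card [RHS](eq_bigl (fun U => (U \in P) && (U \subset W))); last first.
  by move=> U; rewrite inE.
rewrite [RHS]big_mkcondr; apply: eq_bigr => U UP; rewrite big_mkcondr (bigD1 W) //=.
rewrite inE3 // eqxx orbT big1 ?addr0 // => W' /andP[W'L W'W]; rewrite inE3 //.
by rewrite [W == U]eq_sym (point_line_neq UP WS) eq_sym (negPf W'W); case: ifP.
Qed.

Lemma X1_vertex s : s \in X1 -> exists u W, W \in NB /\ s = [set u; f u W].
Proof.
move=> sX; have [u us] : exists u, u \in s by apply/set0Pn; rewrite -card_gt0 (card_X1 sX).
by have [W WN sE] := (X1P u s).1 (conj sX us); exists u, W.
Qed.

Lemma coface_X1 s : s \in X1 -> coface_count 2 X s = k.
Proof.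
case/X1_vertex=> u [W [WN ->]]; rewrite /coface_count -(star_coface u WN).
by apply: eq_card => t; rewrite !inE subUset !sub1set.
Qed.

Lemma card_points : #|P| = n. Proof. exact: card_subspaces1. Qed.
Lemma card_lines : #|L| = n. Proof. exact: card_subspaces2. Qed.

Lemma card_nbhd : #|NB| = (2 * n)%N.
Proof.
rewrite cardsU card_points card_lines (_ : P :&: L = set0) ?cards0 ?subn0 ?addnn ?mul2n //.
by apply/setP => W; rewrite !inE; apply/negbTE/negP => /andP[/subspaces12].
Qed.

Lemma card_triangles : (3 * #|X2| = #|V| * (n * k))%N.
Proof.
have := sum_cells_vertices 2 (fun=> 1%N); rewrite sumr_const -[(_ *+ 3)%R *+ _]mulrnA.
rewrite natn => <-; rewrite (eq_bigr (fun=> n * k)%N) ?sum_nat_const // => u _.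
rewrite star_triangles (eq_bigr (fun=> k)) ?sum_nat_const ?card_points // => U UP.
by rewrite -(card_over UP) -sum1_card; apply: eq_bigl => W; rewrite inE.
Qed.

Section Cochain.
Variable a : cochain V.
Local Notation b s := (a s != 0).
Local Notation A u := [set W in NB | b [set u; f u W]].
Local Notation supp1 := #|[set s in X1 | b s]|.
Local Notation supp2 := #|[set s in X2 | coboundary X 1 a s != 0]|.

Lemma cells_link u i : cells (link X u) i = [set s :\ u | s in [set s in cells X i.+1 | u \in s]].
Proof.
apply/setP => t; rewrite inE; apply/andP/imsetP => [[/imsetP[s] + ->]|[s]].
  rewrite inE => /andP[sX us] c; exists s => //; rewrite !inE sX us andbT /=.
  by rewrite (cardsD1 u) us (eqP c).
rewrite !inE => /andP[/andP[sX c] us] ->; split.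
  by apply/imsetP; exists s; rewrite // inE sX us.
by move: c; rewrite (cardsD1 u) us.
Qed.

Lemma setD1_inj u : {in [pred s : {set V} | u \in s] &, injective (fun s => s :\ u)}.
Proof. by move=> s t; rewrite !inE => us ut E; rewrite -(setD1K us) E setD1K. Qed.

(** All vertices of the link have the same weight, so norms compare cardinalities. Adding 1 over
    [F_2] complements the support among the [2n] link vertices, and minimality leaves at most half
    of them. *)
Lemma link_minimal u :
  cnorm R 1 (link X u) 0 (link_cochain a u)
      <= cnorm R 1 (link X u) 0 (fun s => link_cochain a u s + 1) ->
  (#|A u| <= n)%N.
Proof.
have E0 : cells (link X u) 0 = [set [set f u W] | W in NB].
  rewrite cells_link; apply/setP => t; apply/imsetP/imsetP => [[s] + ->|[W WN ->]].
    rewrite inE => /andP[sX us]; have [W WN ->] := (X1P u s).1 (conj sX us); exists W => //.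
    by apply/setP => v; rewrite !inE; have [->|] := eqVneq v u; rewrite ?(chart_neq _ WN).2.
  exists [set u; f u W]; first by have [? ?] := (X1P u _).2 (ex_intro2 _ _ W WN erefl); rewrite inE; apply/andP.
  by apply/setP => v; rewrite !inE; have [->|] := eqVneq v u; rewrite ?(chart_neq _ WN).2.
pose om : R := k%:R / (2 * #|cells (link X u) 1|)%:R.
have om_gt0 : 0 < om.
  rewrite divr_gt0 ?ltr0n // muln_gt0 /=.
  have /card_gt0P[U UP] : (0 < #|P|)%N by rewrite card_points addn1.
  have /card_gt0P[W] : (0 < #|[set W in L | U \subset W]|)%N by rewrite (card_subspaces2_over UP) addn1.
  rewrite inE => /andP[WL UW].
  rewrite cells_link; apply/card_gt0P; exists ([set u; f u U; f u W] :\ u).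
  apply: imset_f; rewrite inE; apply/andP/X2P; by exists U, W.
have wE W : W \in NB -> weight R 1 (link X u) [set f u W] = om.
  move=> WN; rewrite /weight cards1 /om; congr (_%:R / _).
  rewrite -(star_coface u WN) /coface_count cells_link.
  rewrite -(card_in_imset (f := fun s => s :\ u) (D := mem [set t in X2 | (u \in t) && (f u W \in t)])).
    apply: eq_card => t; rewrite inE; apply/andP/imsetP => [[/imsetP[s] + ->]|[s]].
      rewrite inE sub1set => /andP[sX us]; rewrite !inE => /andP[_ fs]; exists s => //.
      by rewrite !inE in sX *; rewrite sX us.
    rewrite inE => /and3P[sX us fs] ->; split; last by rewrite sub1set !inE f_neq.
    by apply: imset_f; rewrite inE sX.
  by move=> s t; rewrite !inE => /and3P[_ us _] /and3P[_ ut _]; apply: setD1_inj.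
have norm_eq (c : cochain V) : cnorm R 1 (link X u) 0 c = om * #|[set W in NB | c [set f u W] != 0]|%:R.
  rewrite /cnorm E0 big_mkcondr big_imset /=; last first.
    move=> W W' WN W'N /setP/(_ (f u W)); rewrite !inE eqxx chart_eq // => /esym/eqP //.
  rewrite (eq_bigr (fun W => if c [set f u W] != 0 then om else 0)); last by move=> W WN; rewrite wE.
  by rewrite -big_mkcondr sumr_const cardsE mulr_natr; congr (_ *+ _); apply: eq_card => W; rewrite !inE.
rewrite !norm_eq ler_pM2l // ler_nat => le1.
have F2 (x : 'F_2) : (x + 1 != 0) = ~~ (x != 0) by case: x => -[|[|]].
have : (#|[set W in NB | (link_cochain a u [set f u W] != 0)%R]|
      + #|[set W in NB | (link_cochain a u [set f u W] + 1 != 0)%R]| = 2 * n)%N.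
  rewrite -card_nbhd -(cardsID [set W | link_cochain a u [set f u W] != 0] NB).
  congr (_ + _)%N; apply: eq_card => W; rewrite !inE ?F2 // andbC //.
move: le1; set x := #|_|; set y := #|_| => le1 xy.
by lia.
Qed.

Lemma sum_support_at : (\sum_u #|A u|%:R = 2 * supp1%:R :> R).
Proof.
have := sum_cells_vertices 1 (fun s => (b s)%:R : R).
rewrite sumrMnl sum_pred_card mulr_natl.
have -> : #|[pred s | (s \in X1) && b s]| = supp1 by apply: eq_card => s; rewrite !inE.
move=> <-; apply: eq_bigr => u _; rewrite star_edges sum_pred_card.
by congr (_%:R); apply: eq_card => W; rewrite !inE.
Qed.

Definition cross (u : V) : R :=
  \sum_(U in P) \sum_(W in L) ((U \subset W) && ((U \in A u) != (W \in A u)))%:R.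

Lemma cross_lower u :
  let x : R := #|A u|%:R in
  k%:R * x - k%:R * x ^+ 2 / (2 * n%:R) - Num.sqrt q%:R * x <= cross u.
Proof.
have := @crossing_bound R _ P L (fun U W => U \subset W) q card_lines _ _ _ (A u).
rewrite -/(cross u) /=; have -> : \sum_(x in P) (x \in A u)%:R + \sum_(y in L) (y \in A u)%:R = #|A u|%:R :> R.
  rewrite !sum_pred_card -natrD; congr (_%:R).
  rewrite -(cardsID P (A u)); congr (_ + _)%N; apply: eq_card => W; rewrite !inE.
    by case: (W \in P); rewrite ?andbT ?andbF.
  have [WP|WP] := boolP (W \in P); last by rewrite /=; case: (W \in L).
  by have -> : (W \in L) = false by apply/negP => /(subspaces12 WP).
apply.
- exact: card_over.
- exact: card_below.
- move=> U U' UP U'P UU'; rewrite leqNgt; apply/negP => /card_gt1P[W [W' []]].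
  rewrite !inE => /and3P[WL UW U'W] /and3P[W'L UW' U'W'] WW'.
  by move: WW'; rewrite (subspaces2_join UP U'P UU' WL W'L UW U'W UW' U'W') eqxx.
Qed.

Lemma set3D1 (u v w : V) : u != v -> u != w -> v != w ->
  [/\ [set u; v; w] :\ u = [set v; w], [set u; v; w] :\ v = [set u; w]
    & [set u; v; w] :\ w = [set u; v]].
Proof.
move=> uv uw vw; split; apply/setP => t; rewrite !inE.
- by have [->|_] := eqVneq t u; rewrite ?(negPf uv) ?(negPf uw).
- by have [->|_] := eqVneq t v; rewrite ?(negPf vw) 1?eq_sym ?(negPf uv) ?orbF.
- by have [->|_] := eqVneq t w; rewrite ?orbF //= ![w == _]eq_sym (negPf uw) (negPf vw).
Qed.

Lemma sum_set2 (T : nmodType) (F : V -> T) v w : v != w ->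
  \sum_(x in [set v; w]) F x = F v + F w.
Proof. by move=> vw; rewrite big_setU1 ?big_set1 // inE. Qed.

Lemma sum_set3 (T : nmodType) (F : V -> T) u v w : u != v -> u != w -> v != w ->
  \sum_(x in [set u; v; w]) F x = F u + (F v + F w).
Proof. by move=> uv uw vw; rewrite -setUA big_setU1 ?sum_set2 // !inE negb_or uv. Qed.

(* Whether exactly one of the two edges of [s] at [u] is in the support. *)
Definition cross_at s u : R := (\sum_(x in s :\ u) (b (s :\ x))%:R == 1 :> R)%:R.

Lemma cross_at2 s u v w : v != w -> s :\ u = [set v; w] ->
  cross_at s u = (b (s :\ v) != b (s :\ w))%:R.
Proof.
move=> vw E; rewrite /cross_at E sum_set2 // -natrD -[1]/(1%:R) eqr_nat.
by do 2!case: (b _).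
Qed.

Lemma cross_sum u : cross u = \sum_(s in X2 | u \in s) cross_at s u.
Proof.
rewrite star_triangles; apply: eq_bigr => U UP; rewrite [RHS]big_mkcondr.
apply: eq_bigr => W WL; have [UW|//] := boolP (U \subset W).
have [UN WN] := (point_nbhd UP, line_nbhd WL).
have fUW : f u U != f u W by rewrite chart_eq // (point_line_neq UP WL).
have [D1 D2 D3] := set3D1 (negbT (chart_neq u UN).2) (negbT (chart_neq u WN).2) fUW.
have AE W' : W' \in NB -> (W' \in A u) = b [set u; f u W'] by move=> h; rewrite inE h.
by rewrite (cross_at2 fUW D1) D2 D3 !AE //= eq_sym.
Qed.

(** For 0, 1, 2 or 3 edges of [s] in the support, the left side is 0, 2, 2, 0 and the right side is
    0, 2, 2, 4. *)
Lemma triangle_ineq s : s \in X2 ->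
  \sum_(u in s) cross_at s u <= (coboundary X 1 a s != 0)%:R + \sum_(x in s) (b (s :\ x))%:R.
Proof.
move=> sX; rewrite /coboundary (X2_faces _ sX).
have /card_gt0P[u us] : (0 < #|s|)%N by rewrite (card_X2 sX).
have [U [W [UP WL UW sE]]] := (X2P u s).1 (conj sX us).
have [UN WN] := (point_nbhd UP, line_nbhd WL).
have vw : f u U != f u W by rewrite chart_eq // (point_line_neq UP WL).
have [uv uw] := (negbT (chart_neq u UN).2, negbT (chart_neq u WN).2).
move: vw uv uw sE; set v := f u U; set w := f u W => vw uv uw sE.
have [D1 D2 D3] := set3D1 uv uw vw; rewrite -sE in D1 D2 D3.
have S3 (T : nmodType) (F : V -> T) : \sum_(x in s) F x = F u + (F v + F w).
  by rewrite sE sum_set3.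
rewrite !S3 (cross_at2 vw D1) (cross_at2 uw D2) (cross_at2 uv D3).
move: (a (s :\ u)) (a (s :\ v)) (a (s :\ w)) => au av aw.
case: au => -[|[|//]] ?; case: av => -[|[|//]] ?; case: aw => -[|[|//]] ? /=; lra.
Qed.

(** Sum [triangle_ineq] over all triangles; each edge lies in [k] of them. *)
Lemma sum_cross : \sum_u cross u <= supp2%:R + k%:R * supp1%:R.
Proof.
under eq_bigr => u _ do rewrite cross_sum big_mkcondr.
rewrite exchange_big /=; under eq_bigr => s _ do rewrite -big_mkcond /=.
apply: (le_trans (ler_sum _ triangle_ineq)); rewrite big_split /=.
apply: lerD.
  by rewrite sum_pred_card ler_nat; apply/eq_leq/eq_card => s; rewrite !inE.
under eq_bigr => s sX do rewrite -(X2_faces (fun t => (b t)%:R) sX) big_mkcondr.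
rewrite exchange_big /= (eq_bigr (fun t => k%:R * (b t)%:R)) => [|t tX]; last first.
  rewrite -big_mkcondr sumr_const -(coface_X1 tX) mulr_natl; congr (_ *+ _).
  by rewrite /coface_count cardsE.
rewrite -mulr_sumr sum_pred_card ler_wpM2l ?ler0n // ler_nat.
by apply/eq_leq/eq_card => s; rewrite !inE.
Qed.

Lemma cnorm_edges : cnorm R 2 X 1 a = supp1%:R * k%:R / (3 * #|X2|)%:R.
Proof.
rewrite /cnorm (eq_bigr (fun=> k%:R / (3 * #|X2|)%:R)); last first.
  by move=> s /andP[sX _]; rewrite /weight (coface_X1 sX) (card_X1 sX).
rewrite sumr_const -[RHS]mulrA [RHS]mulr_natl; congr (_ *+ _).
by rewrite cardsE.
Qed.

Lemma cnorm_coboundary : cnorm R 2 X 2 (coboundary X 1 a) = supp2%:R / #|X2|%:R.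
Proof.
rewrite /cnorm (eq_bigr (fun=> 1 / #|X2|%:R)); last first.
  by move=> s /andP[sX _]; rewrite /weight (coface_X2 sX) (card_X2 sX) mul1n.
rewrite sumr_const div1r [RHS]mulr_natl; congr (_ *+ _).
by rewrite cardsE.
Qed.

Variable e : rel V.
Hypothesis eP : forall u v, e u v <-> exists2 W, W \in P & v = f u W.
Hypothesis eL : forall u v, e v u <-> exists2 W, W \in L & v = f u W.

Let al u v := ([set u; v] \in X1) && b [set u; v].

Lemma card_support_at u : #|A u| = #|[set v | al u v]|.
Proof.
rewrite -(card_in_imset (f := f u)); last by move=> W W'; rewrite !inE => /andP[WN _] /andP[W'N _]; apply: f_inj; rewrite inE.
apply: eq_card => v; rewrite !inE /al; apply/imsetP/andP => [[W]|[uvX buv]].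
  rewrite [W \in _]inE => /andP[WN bW] ->; split=> //.
  by apply: ((X1P u _).2 _).1; exists W.
have [W WN E] := (X1P u _).1 (conj uvX (set21 u v)).
have uv : u != v by apply/eqP => uv; move: (card_X1 uvX); rewrite uv setUid cards1.
have vE : v = f u W.
  have : v \in [set u; f u W] by rewrite -E set22.
  by rewrite !inE eq_sym (negPf uv) => /eqP.
by exists W => //; rewrite inE WN -vE.
Qed.

Lemma support_edge u v : al u v -> e u v || e v u.
Proof.
case/andP=> uvX _; have [W WN E] := (X1P u _).1 (conj uvX (set21 u v)).
have uv : u != v by apply/eqP => uv; move: (card_X1 uvX); rewrite uv setUid cards1.
have vE : v = f u W.
  have : v \in [set u; f u W] by rewrite -E set22.
  by rewrite !inE eq_sym (negPf uv) => /eqP.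
case/setUP: WN => WN; first by apply/orP; left; apply/eP; exists W.
by apply/orP; right; apply/eL; exists W.
Qed.

(** A support edge inside [T] has colour 1 in one of its two directions, hence the factor 2; one
    that leaves [T] is counted at its end outside [T]. *)
Lemma sum_support_split (T : {set V}) :
  \sum_(u in T) #|A u|%:R <=
  2 * \sum_(u in T) \sum_(v in T) (e u v)%:R + \sum_(u in ~: T) #|A u|%:R :> R.
Proof.
have alC u v : al u v = al v u by rewrite /al setUC.
have AE u : #|A u|%:R = \sum_v (al u v)%:R :> R.
  by rewrite sum_pred_card card_support_at; congr (_%:R); apply: eq_card => v; rewrite !inE.
under eq_bigr => u _ do rewrite AE (bigID (mem T)) /=.
rewrite big_split /=; apply: lerD.
  have -> : 2 * \sum_(u in T) \sum_(v in T) (e u v)%:R =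
      \sum_(u in T) \sum_(v in T) ((e u v)%:R + (e v u)%:R) :> R.
    under [RHS]eq_bigr => u _ do rewrite big_split /=.
    by rewrite big_split /= [X in _ + X]exchange_big /= mulr_natl mulr2n.
  apply: ler_sum => u _; apply: ler_sum => v _.
  have := @support_edge u v; case: (al u v) => [/(_ isT)|_]; last by rewrite addr_ge0 ?ler0n.
  by case: (e u v); case: (e v u) => //=; lra.
rewrite exchange_big /= (eq_bigl (mem (~: T))); last by move=> u; rewrite !inE.
apply: ler_sum => v _; rewrite AE big_mkcond /=; apply: ler_sum => u _.
by rewrite alC; case: ifP => _; rewrite ?ler0n.
Qed.

End Cochain.
End Combinatorics.

(** * The isoperimetric inequality *)

(** In the application [x u] is the degree of the cochain at [u], [n] the largest degree that local
    minimality allows, [k = q + 1], [s = sqrt q], [D] the number of triangles in the coboundary,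
    [E T] the number of edges of colour 1 inside [T], and [h] the mixing error. *)
Lemma fat_thin_bound (R : realFieldType) (V : finType) (x : V -> R) (E : {set V} -> R)
    (n k s D h e0 : R) :
  let mu := e0 / 16 in let S := \sum_u x u in let N : R := #|V|%:R in
  0 < e0 <= 1 -> 0 < n -> 0 < k -> 0 <= s -> 0 < N ->
  (forall u, 0 <= x u <= n) ->
  \sum_u (k * x u - k * x u ^+ 2 / (2 * n) - s * x u) <= D + k * S / 2 ->
  (forall T : {set V}, \sum_(u in T) x u <= 2 * E T + \sum_(u in ~: T) x u) ->
  (forall T : {set V}, E T <= n * #|T|%:R ^+ 2 / N + h * #|T|%:R) ->
  s <= k * mu ^+ 2 / 4 -> 8 * h <= e0 * n ->
  S * (2 * (1 + e0)) < N * n ->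
  S * (k * mu ^+ 2) / 4 <= D.
Proof.
move=> mu S N /andP[e0_gt0 e0_le1] n0 k0 s0 N0 xP cross_le fatP mixP s_le h_le S_lt.
have mu0 : 0 < mu by rewrite divr_gt0.
have mu1 : mu <= 1 / 16 by rewrite /mu; lra.
pose T := [set u | (1 - mu) * n < x u].
pose St := \sum_(u in ~: T) x u; pose Sf := \sum_(u in T) x u.
have SE : S = Sf + St.
  rewrite /S (bigID (mem T)) /=; congr (_ + _).
  by apply: eq_bigl => u; rewrite !inE.
have St0 : 0 <= St by apply: sumr_ge0 => u _; case/andP: (xP u).
have Sf0 : 0 <= Sf by apply: sumr_ge0 => u _; case/andP: (xP u).
have S0 : 0 <= S by rewrite SE addr_ge0.
(* With [z = x/n], the main term is [k x/2 + k x (1 - z)/2]. Fat vertices at least balance [k S/2];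
   thin ones leave a surplus of [k mu x/2]. *)
have D_ge : k * mu / 2 * St - s * S <= D.
  suff : k * S / 2 - s * S + k * mu / 2 * St <= \sum_u (k * x u - k * x u ^+ 2 / (2 * n) - s * x u).
    by move=> h1; have := le_trans h1 cross_le; lra.
  have -> : k * S / 2 - s * S + k * mu / 2 * St =
      \sum_u (k * x u / 2 - s * x u + k * mu / 2 * (if u \in T then 0 else x u)).
    rewrite big_split sumrB /= -mulr_sumr -mulr_sumr; congr (_ - _ + _ * _).
      by rewrite -mulr_suml -mulr_sumr.
    by rewrite /St big_mkcond; apply: eq_bigr => u _; rewrite in_setC; case: (u \in T).
  apply: ler_sum => u _; have /andP[x0 xn] := xP u.
  pose z := x u / n.
  have -> : k * x u ^+ 2 / (2 * n) = k * x u / 2 * z by rewrite /z; field; rewrite gt_eqF.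
  have kx : 0 <= k * x u / 2 by rewrite divr_ge0 // mulr_ge0 // ltW.
  case: ifP => uT.
    have z1 : z <= 1 by rewrite /z ler_pdivrMr // mul1r.
    have := ler_wpM2l kx z1; lra.
  have z1 : z <= 1 - mu by rewrite /z ler_pdivrMr // leNgt; move: uT; rewrite inE => ->.
  have := ler_wpM2l kx z1; lra.
(* If thin vertices carry a share [mu] of [S], they gain [k mu^2 S/2], and the error [s S] takes at
   most half of that. *)
have [muS|Smu] := leP (mu * S) St.
  have h1 : k * mu / 2 * (mu * S) <= k * mu / 2 * St.
    by apply: ler_wpM2l => //; rewrite divr_ge0 // mulr_ge0 // ltW.
  have h2 : s * S <= k * mu ^+ 2 / 4 * S by apply: ler_wpM2r.
  by move: h1 h2 D_ge; rewrite !expr2; lra.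
(* Otherwise [Sf - St] exceeds [(1 - 2 mu) S], and twice the number of edges inside the fat set must
   account for it. *)
exfalso; pose r : R := #|T|%:R.
have r0 : 0 <= r by rewrite ler0n.
have S_gt0 : 0 < S by rewrite lt0r S0 andbT; apply: contraTneq Smu => ->; rewrite mulr0 -leNgt.
have rS : (1 - mu) * n * r <= Sf.
  rewrite /r -sum1_card natr_sum mulr_sumr; apply: ler_sum => u; rewrite inE mulr1 => /ltW //.
have ub : Sf - St <= 2 * (n * r ^+ 2 / N + h * r).
  by have := fatP T; have := mixP T; rewrite -/Sf -/St -/r; lra.
have lb : (1 - 2 * mu) * S < Sf - St by move: Smu; rewrite SE; lra.
have m2 : 0 < 1 - 2 * mu by lra.
have r_gt0 : 0 < r.
  rewrite lt0r r0 andbT; apply/negP => /eqP rz.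
  have : 0 < (1 - 2 * mu) * S by apply: mulr_gt0.
  by move: ub lb; rewrite rz expr0n !mulr0 mul0r; lra.
have lb2 : (1 - 2 * mu) * ((1 - mu) * n * r) <= (1 - 2 * mu) * S.
  by apply: ler_wpM2l; [exact: ltW|move: rS; rewrite SE; lra].
(* The main term of mixing per fat vertex. The bound on [S] limits the density [r/N], which gives
   [2 w c <= n] for the [c] below. *)
pose w := n * r / N.
have wE : n * r ^+ 2 / N = w * r by rewrite /w; field; rewrite gt_eqF.
have w_le : w * (2 * (1 + e0) * (1 - mu)) <= n.
  rewrite /w mulrAC ler_pdivrMr //.
  have : (1 - mu) * n * r * (2 * (1 + e0)) <= S * (2 * (1 + e0)).
    by apply: ler_wpM2r; [lra|move: rS; rewrite SE; lra].
  by move: S_lt; lra.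
have key : (1 - 2 * mu) * ((1 - mu) * n) < 2 * (w + h).
  rewrite -(ltr_pM2r r_gt0); apply: (@le_lt_trans _ _ ((1 - 2 * mu) * S)); first by rewrite -!mulrA in lb2 *.
  by apply: (lt_le_trans lb); move: ub; rewrite wE; lra.
pose c := (1 + e0) * (1 - mu).
have c0 : 0 < c by rewrite mulr_gt0 //; lra.
have : (1 - 2 * mu) * ((1 - mu) * n) * c < n + 2 * h * c.
  apply: (@lt_le_trans _ _ (2 * (w + h) * c)); first by rewrite ltr_pM2r.
  by move: w_le; rewrite /c; lra.
(* [c <= 2] since [e0 <= 1]; the mixing error thus costs at most [e0 n/2]. *)
have hc : 2 * h * c <= e0 * n / 4 * 2.
  apply: (@le_trans _ _ (e0 * n / 4 * c)).
    by apply: ler_wpM2r; [exact: ltW|lra].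
  apply: ler_wpM2l; first by rewrite divr_ge0 // mulr_ge0 // ltW.
  by rewrite /c; nra.
(* This is where [mu = e0/16] comes from: [(1 - 2 mu)(1 - mu)^2 >= 1 - 4 mu = 1 - e0/4], and
   [(1 - e0/4)(1 + e0) >= 1 + e0/2] for [e0 <= 1]. *)
suff : n * (1 + e0 / 2) <= (1 - 2 * mu) * ((1 - mu) * n) * c by move: hc; lra.
have -> : (1 - 2 * mu) * ((1 - mu) * n) * c = n * ((1 - 2 * mu) * (1 - mu) ^+ 2 * (1 + e0)).
  by rewrite /c; ring.
apply: ler_wpM2l; first exact: ltW.
have h3 : 1 - 4 * mu <= (1 - 2 * mu) * (1 - mu) ^+ 2 by nra.
apply: (@le_trans _ _ ((1 - 4 * mu) * (1 + e0))).
  by rewrite /mu; nra.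
by apply: ler_wpM2r => //; lra.
Qed.

(** With [s = sqrt q], the hypothesis reads [s e0^2 >= 1024]. The two estimates compare [q^(1/2)]
    with [q] and [q^(3/2)] with [q^2]; the left side of the second is at most [48 s^3]. *)
Lemma large_sqrt_bounds (R : realFieldType) (s e0 : R) (mu := e0 / 16) :
  0 < e0 -> e0 <= 1 -> 4 / mu ^+ 2 <= s ->
  [/\ 0 < s, s <= (s ^+ 2 + 1) * mu ^+ 2 / 4
    & 8 * (2 * (s ^+ 2 + (s ^+ 2 + 1) * s)) <= e0 * (s ^+ 4 + s ^+ 2 + 1)].
Proof.
move=> e0_gt0 e0_le1; have mu0 : 0 < mu by rewrite divr_gt0.
rewrite ler_pdivrMr ?exprn_gt0 // => smu.
have s0 : 0 < s.
  rewrite ltNge; apply/negP => s0.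
  have : s * mu ^+ 2 <= 0 by rewrite mulr_le0_ge0 // sqr_ge0.
  lra.
have s_big : 1024 <= s * e0.
  have : s * e0 ^+ 2 <= s * e0 by apply: ler_wpM2l; [exact: ltW|nra].
  by move: smu; rewrite /mu expr_div_n; lra.
have s_ge1 : 1 <= s.
  have : s * e0 <= s * 1 by apply: ler_wpM2l; [exact: ltW|].
  lra.
split=> //.
  have : s * 4 <= s * (s * mu ^+ 2) by rewrite ler_pM2l.
  have : 0 <= mu ^+ 2 by apply: sqr_ge0.
  rewrite [s ^+ 2]expr2; lra.
have h1 : s <= s ^+ 3 by rewrite -[X in X <= _]expr1; exact: ler_weXn2l.
have h2 : s ^+ 2 <= s ^+ 3 by exact: ler_weXn2l.
have h3 : 1024 * s ^+ 3 <= s * e0 * s ^+ 3 by rewrite ler_pM2r // exprn_gt0.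
have h4 : 0 <= s ^+ 3 by rewrite exprn_ge0 // ltW.
have h5 : 0 <= e0 * s ^+ 2 by rewrite mulr_ge0 ?sqr_ge0 // ltW.
have -> : e0 * (s ^+ 4 + s ^+ 2 + 1) = s * e0 * s ^+ 3 + e0 * s ^+ 2 + e0 by ring.
have -> : 8 * (2 * (s ^+ 2 + (s ^+ 2 + 1) * s)) = 16 * s ^+ 2 + 16 * s ^+ 3 + 16 * s by ring.
lra.
Qed.

(** * Mixing for the edges of colour 1 in a Ramanujan quotient *)

Section QuotientSpectrum.
Variables (R : realType) (K : finFieldType) (Gam : set 'M[laurent K]_3) (V : finType).
Variable p : vertex K -> V.
Hypothesis Gam_sub : pgl_subgroup Gam.
Hypothesis Gam_disp : large_displacement Gam.
Hypothesis pq : is_quotient_map Gam p.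
Hypothesis ram : is_ramanujan R p.
Local Notation q := #|K|.
Local Notation n := (q ^ 2 + q + 1)%N.
Local Notation E := (quotient_edge p).
Let e : rel V := fun u v => `[< E 1 u v >].

Lemma edge1P u v : E 1 u v <-> e u v.
Proof. by split=> [?|/asboolP]; first exact/asboolP. Qed.

Lemma edge2P u v : E 2%:R u v <-> e v u.
Proof. by apply: iff_trans (edge1P v u); apply: iff_sym; exact: quotient_edge_sym. Qed.

Lemma quotient_outdeg u : #|[set v | e u v]| = n.
Proof.
have [f [[f_inj _] fE _ _]] := star_chart Gam_sub Gam_disp pq u.
rewrite -(card_subspaces1 K) -(card_in_imset (f := f)); last first.
  by move=> W W' WP W'P; apply: f_inj; rewrite inE ?WP ?W'P.
apply: eq_card => v; rewrite inE; apply/idP/imsetP => [/edge1P/(fE 1%N v isT)[W WP ->]|[W WP ->]].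
  by exists W.
by apply/edge1P/(fE 1%N _ isT); exists W.
Qed.

Lemma quotient_indeg u : #|[set v | e v u]| = n.
Proof.
have [f [[f_inj _] fE _ _]] := star_chart Gam_sub Gam_disp pq u.
rewrite -(card_subspaces2 K) -(card_in_imset (f := f)); last first.
  by move=> W W' WP W'P; apply: f_inj; rewrite inE ?WP ?W'P orbT.
apply: eq_card => v; rewrite inE; apply/idP/imsetP => [/edge2P/(fE 2%N v isT)[W WP ->]|[W WP ->]].
  by exists W.
by apply/edge2P/(fE 2%N _ isT); exists W.
Qed.

(* The diamonds give one entrywise inequality between [A A^T] and [A^T A];
   both matrices have the same sum of entries, so they are equal. *)
Lemma quotient_normal u w :
  #|[set v | e u v && e w v]| = #|[set v | e v u && e v w]|.
Proof.
pose M (x : V * V) := #|[set v | e x.1 v && e x.2 v]|.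
pose M' (x : V * V) := #|[set v | e v x.1 && e v x.2]|.
have MM' x : (M x <= M' x)%N.
  case: x => u' w'; rewrite /M /M' /=; have [<-|uw] := eqVneq u' w'.
    have -> : [set v | e u' v && e u' v] = [set v | e u' v] by apply/setP => v; rewrite !inE andbb.
    have -> : [set v | e v u' && e v u'] = [set v | e v u'] by apply/setP => v; rewrite !inE andbb.
    by rewrite quotient_outdeg quotient_indeg.
  have eb2 a b : `[< E 2%:R a b >] = e b a.
    by apply/asboolP/idP => /edge2P.
  have := quotient_diamond Gam_sub Gam_disp pq uw.
  have -> : [set v | `[< E 1%R u' v >] && `[< E 2%:R%R v w' >]] = [set v | e u' v && e w' v].
    by apply/setP => v; rewrite !inE eb2.
  by have -> : [set v | `[< E 2%:R%R u' v >] && `[< E 1%R v w' >]] = [set v | e v u' && e v w']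
    by apply/setP => v; rewrite !inE eb2.
have sumM : (\sum_x M x = \sum_x M' x)%N.
  have cnt (P Q : V -> V -> bool) : (\sum_(x : V * V) #|[set v | P x.1 v && Q x.2 v]| =
      \sum_v #|[set u | P u v]| * #|[set w | Q w v]|)%N.
    transitivity (\sum_(x : V * V) \sum_v (P x.1 v && Q x.2 v : nat))%N.
      apply: eq_bigr => x _; rewrite -sum1_card big_mkcond; apply: eq_bigr => v _.
      by rewrite inE; case: (_ && _).
    rewrite exchange_big; apply: eq_bigr => v _; rewrite -!sum1_card big_distrlr /=.
    rewrite pair_big /= [RHS]big_mkcond; apply: eq_bigr => x _.
    by rewrite !inE; case: (P _ _); case: (Q _ _).
  rewrite /M /M' (cnt e e) (cnt (fun u v => e v u) (fun u v => e v u)).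
  by apply: eq_bigr => v _; rewrite quotient_outdeg quotient_indeg.
have := leqif_sum (fun x (_ : true) => conj (MM' x) (erefl (M x == M' x))).
by case=> _; rewrite sumM eqxx => /esym/forallP/(_ (u, w))/implyP/(_ isT)/eqP.
Qed.

Lemma quotient_mixing (T : {set V}) :
  (\sum_(u in T) \sum_(v in T) (e u v)%:R : R) <=
  n%:R * #|T|%:R ^+ 2 / #|V|%:R + 2 * hecke_bound K R * #|T|%:R.
Proof.
have h0 : 0 <= hecke_bound K R.
  by rewrite addr_ge0 ?mulr_ge0 ?addr_ge0 ?ler0n ?sqrtr_ge0.
apply: (expander_mixing edge1P edge2P quotient_outdeg quotient_indeg quotient_normal).
  by rewrite mulr_ge0.
move=> f l1 l2 f0 f1 fl1 fl2.
have := joint_spectrum_bound (ram (ex_intro _ f (And4 f0 f1 fl1 fl2))) => le1.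
(* The bound [|l1|^2 <= 2 h^2] is relaxed to [(2 h)^2], which avoids a square root of 2. *)
rewrite -(@ler_pXn2r _ 2) ?nnegrE ?mulr_ge0 ?normc_ge0 //.
by apply: (le_trans le1); rewrite exprMn; have := sqr_ge0 (hecke_bound K R); lra.
Qed.

End QuotientSpectrum.

Theorem theorem1p9 (R : realType) (eps0 : R) (eps0_gt0 : 0 < eps0) :
  exists (q0 : nat) (eps : R), 0 < eps /\
    forall (K : finFieldType) (Gam : set 'M[laurent K]_3)
           (V : finType) (p : vertex K -> V),
      (q0 <= #|K|)%N ->
      pgl_subgroup Gam ->
      pgl_discrete Gam ->
      pgl_cocompact Gam ->
      large_displacement Gam ->
      non_partite Gam ->
      is_quotient_map Gam p ->
      is_ramanujan R p ->
      forall a : cochain V,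
        locally_minimal R (quotient_complex p) a ->
        cnorm R 2 (quotient_complex p) 1 a < 1 / (4%:R * (1 + eps0)) ->
        eps * cnorm R 2 (quotient_complex p) 1 a
          <= cnorm R 2 (quotient_complex p) 2
               (coboundary (quotient_complex p) 1 a).
Proof.
(* A smaller [e0] only weakens the hypothesis on the norm, and [fat_thin_bound] asks for
   [e0 <= 1]. *)
pose e0 := Num.min eps0 1.
have e0_gt0 : 0 < e0 by rewrite lt_min eps0_gt0 ltr01.
have e0_le1 : e0 <= 1 by rewrite ge_min lexx orbT.
have e0_le : e0 <= eps0 by rewrite ge_min lexx.
pose mu := e0 / 16; have mu0 : 0 < mu by rewrite divr_gt0.
pose M := 4 / mu ^+ 2.
have M0 : 0 < M by rewrite divr_gt0 // exprn_gt0.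
(* [M] is the lower bound on [sqrt q] in [large_sqrt_bounds], so [q] has to exceed [M^2]. *)
exists (Num.bound (M ^+ 2)), (mu ^+ 2); split; first exact: exprn_gt0.
move=> K Gam V p qle Gsub _ _ Gdisp _ pq ram a amin anorm.
set X := quotient_complex p in amin anorm *.
have [f fP] := @choice _ _ _ (star_chart Gsub Gdisp pq).
pose q := #|K|; pose n := (q ^ 2 + q + 1)%N.
pose s : R := Num.sqrt q%:R.
have s2 : s ^+ 2 = q%:R by rewrite sqr_sqrtr ?ler0n.
have s_ge : M <= s.
  have : M ^+ 2 <= q%:R.
    by apply: ltW; apply: (lt_le_trans (archi_boundP (sqr_ge0 M))); rewrite ler_nat.
  by rewrite -s2 ler_pXn2r ?nnegrE ?sqrtr_ge0 // ltW.
have f_inj u : {in nbhd K &, injective (f u)} by case: (fP u) => -[].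
have f_neq u W : W \in nbhd K -> f u W != u by case: (fP u) => -[_ h] _ _ _; apply: h.
have X1P u t : t \in cells X 1 /\ u \in t <-> exists2 W, W \in nbhd K & t = [set u; f u W].
  by case: (fP u) => _ _ h _; apply: h.
have X2P u t : t \in cells X 2 /\ u \in t <-> exists U W,
    [/\ U \in subspaces K 1, W \in subspaces K 2, U \subset W & t = [set u; f u U; f u W]].
  by case: (fP u) => _ _ _; apply.
pose e (u v : V) := `[< quotient_edge p 1 u v >].
have eP u v : e u v <-> exists2 W, W \in subspaces K 1 & v = f u W.
  by case: (fP u) => _ h _ _; split=> [/edge1P/(h 1%N v isT)|/(h 1%N v isT)/edge1P].
have eL u v : e v u <-> exists2 W, W \in subspaces K 2 & v = f u W.
  by case: (fP u) => _ h _ _; split=> [/edge2P/(h 2%N v isT)|/(h 2%N v isT)/edge2P].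
pose A u := [set W in nbhd K | a [set u; f u W] != 0].
have A_le u : (#|A u| <= n)%N.
  by apply: (@link_minimal R K V X f) => //; apply: amin; exact: cells0P pq u.
(* The building has a vertex, so [V] is nonempty and division by [#|V|] is meaningful. *)
have [x0 _] := @vertex_ex K 1%:M (unitmx1 _ _).
have N0 : 0 < #|V|%:R :> R by rewrite ltr0n; apply/card_gt0P; exists (p x0).
pose S : R := \sum_u #|A u|%:R.
pose supp1 : R := #|[set t in cells X 1 | a t != 0]|%:R.
pose supp2 : R := #|[set t in cells X 2 | coboundary X 1 a t != 0]|%:R.
have S1 : S = 2 * supp1 := sum_support_at R f_inj f_neq X1P a.
pose k : R := q.+1%:R; pose nR : R := n%:R; pose N : R := #|V|%:R.
have k0 : 0 < k by rewrite ltr0n.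
have n0 : 0 < nR by rewrite ltr0n /n addn1.
have nE : nR = s ^+ 4 + s ^+ 2 + 1 by rewrite /nR /n !natrD natrX -s2 -exprM.
have kE : k = s ^+ 2 + 1 by rewrite /k -natr1 s2.
have X2E : (3 * #|cells X 2|)%:R = N * (nR * k) :> R.
  by rewrite (card_triangles f_inj f_neq X2P) !natrM.
have X20 : 0 < #|cells X 2|%:R :> R.
  have : 0 < (3 * #|cells X 2|)%:R :> R by rewrite X2E !mulr_gt0.
  by rewrite !ltr0n muln_gt0.
have norm1E : cnorm R 2 X 1 a = supp1 / (N * nR).
  rewrite (cnorm_edges R f_inj f_neq X1P X2P a) X2E -/supp1 -/k; field.
  by rewrite !gt_eqF.
have norm2E : cnorm R 2 X 2 (coboundary X 1 a) = 3 * supp2 / (N * (nR * k)).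
  rewrite (cnorm_coboundary R) -/supp2 -X2E natrM; field.
  by rewrite gt_eqF.
have S_lt : S * (2 * (1 + e0)) < N * nR.
  move: anorm; rewrite norm1E ltr_pdivrMr ?mulr_gt0 // mulrAC ltr_pdivlMr; last first.
    by rewrite mulr_gt0 // addr_gt0.
  rewrite mul1r S1; apply: le_lt_trans.
  have -> : 2 * supp1 * (2 * (1 + e0)) = supp1 * (4 * (1 + e0)) by ring.
  by apply: ler_wpM2l; [exact: ler0n|rewrite ler_pM2l // lerD2l].
have [s0 s_k s_n] := large_sqrt_bounds e0_gt0 e0_le1 s_ge.
have D_ge : S * (k * mu ^+ 2) / 4 <= supp2.
  apply: (@fat_thin_bound R V (fun u => #|A u|%:R) (fun T => \sum_(u in T) \sum_(v in T) (e u v)%:R)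
    nR k s supp2 (2 * hecke_bound K R) e0) => //.
  - by rewrite e0_gt0.
  - exact: ltW.
  - by move=> u; rewrite ler0n ler_nat A_le.
  - apply: (@le_trans _ _ (\sum_u cross R f a u)).
      by apply: ler_sum => u _; apply: cross_lower.
    apply: (le_trans (sum_cross R f_inj f_neq X1P X2P a)); rewrite -/supp1 -/supp2 -/k.
    by rewrite -/S S1 -[2 * _ in X in _ <= X]mulrC mulrA mulfK ?pnatr_eq0.
  - by move=> T; apply: (sum_support_split R f_inj X1P a eP eL).
  - exact: quotient_mixing Gsub Gdisp pq ram.
  - by rewrite kE.
  - by rewrite /hecke_bound -/q -/s -s2 nE.
(* Cleared of denominators, the claim is [supp1 k mu^2 <= 3 supp2]. As [S = 2 supp1], [D_ge] gives
   this even with 2 in place of 3. *)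
rewrite norm1E norm2E ler_pdivlMr ?mulr_gt0 //.
have -> : mu ^+ 2 * (supp1 / (N * nR)) * (N * (nR * k)) = supp1 * (k * mu ^+ 2).
  by field; rewrite !gt_eqF.
have S0 : 0 <= S by rewrite S1 mulr_ge0 ?ler0n.
have : 0 <= S * (k * mu ^+ 2) by rewrite !mulr_ge0 ?sqr_ge0 // ltW.
by move: D_ge; rewrite S1; lra.
Qed.
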